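(* Let $F\in L^\infty\setminus\{0\}$ and $u\in H^2\setminus\{0\}$ be such that $\ker T_F\neq\{0\}$ and $u\ker T_F\subseteq H^2$. Let $u_o$ be the outer factor of $u$. For any nonconstant inner function $\psi$, there exists a minimal Toeplitz kernel containing $C_\psi(u\ker T_F)$, and it is $\ker T_H$, where $$H=\psi\,(F\circ\psi)\,\frac{\overline{u\circ\psi}}{z\,(u_o\circ\psi)}.$$ Moreover, if $\phi_m$ is a maximal vector for $\ker T_F$, then $C_\psi(u\phi_m)$ is a maximal vector for $\ker T_H$.
   Context: $\mathbb{D}$ is the open unit disc, $\mathbb{T}$ the unit circle with normalized Lebesgue measure, $L^\infty=L^\infty(\mathbb{T})$, and $H^2$ is the Hardy space of $\mathbb{D}$, regarded as a closed subspace of $L^2(\mathbb{T})$ via boundary values; $P_{H^2}:L^2(\mathbb{T})\to H^2$ is the orthogonal projection. For $g\in L^\infty$ the Toeplitz operator is $T_g:H^2\to H^2$, $T_gf=P_{H^2}(gf)$; a Toeplitz kernel is a space of the form $\ker T_g$ with $g\in L^\infty$. For an inner function $\psi$ (bounded analytic on $\mathbb{D}$ with $|\psi|=1$ a.e. on $\mathbb{T}$), $C_\psi f=f\circ\psi$; for $F\in L^\infty$, $F\circ\psi$ is the composition of $F$ with the boundary function of $\psi$, and $z$ in symbols denotes the identity function on $\mathbb{T}$. The minimal Toeplitz kernel containing a set $E\subseteq H^2$ is a Toeplitz kernel $\ker T_g\supseteq E$ such that $\ker T_g\subseteq\ker T_h$ for every $h\in L^\infty$ with $E\subseteq\ker T_h$.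 A function $k\in H^2\setminus\{0\}$ is a maximal vector for $\ker T_g$ if $\ker T_g$ is the minimal Toeplitz kernel containing $\{k\}$. *)

(* Defs.v *)
From HB Require Import structures.
From mathcomp Require Import all_boot all_order all_algebra.
From mathcomp Require Import all_classical all_reals all_analysis.
From mathcomp Require Import complex.

Set Implicit Arguments.
Unset Strict Implicit.
Unset Printing Implicit Defensive.

Import Order.TTheory GRing.Theory Num.Theory.
Import numFieldNormedType.Exports.
Import Normc.

Local Open Scope complex_scope.
Local Open Scope classical_set_scope.
Local Open Scope ring_scope.

(* Analytic functions on the open unit disc and functions on the unit circle
   are both represented by total functions on R[i]; only the values on the disc
   (resp. almost every value on the circle) matter. *)

Section UnitCircle.
Context {R : realType}.
Implicit Types (f g : R[i] -> R[i]) (z zeta : R[i]).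

Definition cis (t : R) : R[i] := cos t +i* sin t.

Definition expC z : R[i] := (expR (complex.Re z))%:C * cis (complex.Im z).

Definition arcT : set R := `[0, 2 * pi].

Definition aeT (P : R[i] -> Prop) : Prop :=
  {ae lebesgue_measure, forall t : R, arcT t -> P (cis t)}.

Definition meanT (f : R[i] -> R) : R :=
  (2 * pi)^-1 * \int[lebesgue_measure]_(t in arcT) f (cis t).

Definition meanTC f : R[i] :=
  meanT (fun zeta => complex.Re (f zeta)) +i*
  meanT (fun zeta => complex.Im (f zeta)).

Definition borelT f : Prop :=
  measurable_fun arcT (fun t : R => complex.Re (f (cis t))) /\
  measurable_fun arcT (fun t : R => complex.Im (f (cis t))).

(* Lebesgue measurability: the library's lebesgue_measure lives on the Borel
   sets, so we allow a modification on a null set.  The integral is defined for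
   arbitrary functions and is insensitive to such modifications. *)
Definition measurableT f : Prop :=
  exists g, borelT g /\ aeT (fun zeta => f zeta = g zeta).

Definition Linfty f : Prop :=
  measurableT f /\ exists M : R, aeT (fun zeta => normc (f zeta) <= M).

Definition L2 f : Prop :=
  measurableT f /\
  (\int[lebesgue_measure]_(t in arcT) (normc (f (cis t)) ^+ 2)%:E < +oo)%E.

Definition inner_product f g : R[i] := meanTC (fun zeta => f zeta * (g zeta)^*).

End UnitCircle.

Section Hardy.
Context {R : realType}.
Implicit Types (f g h k p u psi : R[i] -> R[i]) (z zeta : R[i]).

Definition disc : set R[i] := [set z | `|z| < 1].

Definition holomorphicD f : Prop :=
  forall z, disc z -> derivable (f : R[i]^o -> R[i]^o) z 1.

Definition H2 f : Prop :=
  holomorphicD f /\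
  exists M : R, forall r : R, 0 <= r < 1 ->
    meanT (fun zeta => normc (f (r%:C * zeta)) ^+ 2) <= M.

Definition nonzeroD f : Prop := exists2 z, disc z & f z != 0.

Definition nonconstantD f : Prop := ~ exists c, forall z, disc z -> f z = c.

(* Radial limits; the value where the limit does not exist is irrelevant, since
   for the functions considered here the limit exists almost everywhere. *)
Definition bv f : R[i] -> R[i] :=
  fun zeta => lim ((f (r%:C * zeta) : R[i]^o) @[r --> (1 : R)^'-]).

(* p is the orthogonal projection of h onto H^2. *)
Definition orth_proj_H2 h p : Prop :=
  [/\ L2 h, H2 p &
      forall k, H2 k ->
        inner_product (fun zeta => h zeta - bv p zeta) (bv k) = 0].

(* The graph of the Toeplitz operator T_g : H^2 -> H^2, i.e. p = T_g f. *)
Definition toeplitz g f p : Prop :=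
  H2 f /\ orth_proj_H2 (fun zeta => g zeta * bv f zeta) p.

Definition toeplitz_ker g : set (R[i] -> R[i]) :=
  [set f | toeplitz g f (cst 0)].

Definition is_toeplitz_ker (K : set (R[i] -> R[i])) : Prop :=
  exists2 g, Linfty g & K = toeplitz_ker g.

Definition is_min_toeplitz_ker (E K : set (R[i] -> R[i])) : Prop :=
  [/\ is_toeplitz_ker K, E `<=` K &
      forall h, Linfty h -> E `<=` toeplitz_ker h -> K `<=` toeplitz_ker h].

Definition maximal_vector k (K : set (R[i] -> R[i])) : Prop :=
  [/\ H2 k, nonzeroD k & is_min_toeplitz_ker [set k] K].

Definition inner_fun psi : Prop :=
  [/\ holomorphicD psi,
      exists M : R, forall z, disc z -> normc (psi z) <= M &
      aeT (fun zeta => normc (bv psi zeta) = 1)].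

Definition outer_fun f : Prop :=
  exists (lambda : R[i]) (k : R[i] -> R),
    [/\ `|lambda| = 1,
        lebesgue_measure.-integrable arcT (fun t : R => (k (cis t))%:E) &
        forall z, disc z ->
          f z = lambda * expC (meanTC (fun zeta =>
                  (zeta + z) / (zeta - z) * (k zeta)%:C))].

(* Determined up to a unimodular constant. *)
Definition outer_factor u uo : Prop :=
  [/\ H2 uo, outer_fun uo &
      exists2 ui, inner_fun ui & forall z, disc z -> u z = ui z * uo z].

Definition comp_op psi f : R[i] -> R[i] := f \o psi.

Definition mul_op u f : R[i] -> R[i] := fun z => u z * f z.

End Hardy.

(* Main.v *)
(* For g in L^oo, f lies in ker T_g iff g f = conj(z p) on the circle for some p in
   H^2; call p the companion of f.  If the companion q of k is outer, then ker T_g is the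
   minimal Toeplitz kernel containing k: given f in ker T_g with companion s and
   k in ker T_h with companion t, the L^2 function w = conj(z h f) satisfies
   w q = s t on the circle, and dividing by the outer function q shows that w is the boundary
   function of an H^2 function, i.e. f lies in ker T_h.

   If f has companion p in ker T_F, then (u f) o psi has companion (p u_o) o psi in
   ker T_H, since |u| = |u_o| on the circle.  Multiplying f by the inner factor of p
   makes the companion outer, which gives minimality of ker T_H; and when f is a
   maximal vector its companion is already outer.

   The Hardy space theory behind this (mean value property, Fatou's theorem,
   H^2 boundary functions, inner-outer factorization, composition with an inner
   function) rests on the Poisson and Herglotz integrals.  Outerness is used only
   through bounded analytic r_n with |r_n q| <= 1 and r_n q -> 1 in the disc. *)
Require Import Defs.
From mathcomp Require Import all_boot all_order all_algebra.
From mathcomp Require Import all_classical all_reals all_analysis.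
From mathcomp Require Import complex.
From mathcomp Require Import measurable_realfun.
From mathcomp Require Import ring lra zify.

Set Implicit Arguments.
Unset Strict Implicit.
Unset Printing Implicit Defensive.

Import Order.TTheory GRing.Theory Num.Theory.
Import numFieldNormedType.Exports.
Import Normc.

Local Open Scope complex_scope.
Local Open Scope classical_set_scope.
Local Open Scope ring_scope.

(** The shape of [H] comes from composing [F f = conj(z p)] with [psi] on the circle: the result is
    [conj(psi) conj(p o psi)], the factor [psi] cancels [conj(psi)], and [1/z] supplies the missing
    [conj(z)]. The quotient [conj(u)/u_o] is unimodular, so [H] has the modulus of [F o psi]; it
    also turns the factor [u] of [u f] into [conj(u_o)]. The companion [p u_o] is a product of two
    H^2 functions, a priori only in H^1; it lies in H^2 because [|p u_o| = |F u f|] on the circle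
    and [u f] is in H^2. This is where the inclusion of [u ker T_F] in H^2 enters.

    Products such as [s t] are only integrable, so their means against [z^(n+1)] are computed by
    approximating both factors in L^2 by polynomials.

    The obstacle is [F o psi] for a merely measurable [F]: almost everywhere statements must survive
    composition with the boundary function of [psi], so null sets must pull back to null sets.
    Identifying the boundary function of [f o psi] with that of [f] composed with that of [psi]
    rests on this too. *)

Local Notation measT := Defs.measurableT.

(** * Integrals of arbitrary functions up to null sets *)

Section ae_integral.
Local Open Scope ereal_scope.
Import HBNNSimple.
Context d (T : measurableType d) (R : realType).
Variable mu : {measure set T -> \bar R}.

(** The integral is a supremum over simple functions below the integrand. Cutting such a function to
    0 on the null set where [f <= g] fails keeps its integral and puts it below [g]. This covers
    nonmeasurable integrands, for which [meanT] is defined as well. *)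
Lemma ge0_ae_le_integral (D : set T) (f g : T -> \bar R) :
  (forall x, D x -> 0 <= f x) -> (forall x, D x -> 0 <= g x) ->
  {ae mu, forall x, D x -> f x <= g x} ->
  \int[mu]_(x in D) f x <= \int[mu]_(x in D) g x.
Proof.
move=> f0 g0 [N [mN N0 fgN]].
rewrite !ge0_integralE//; apply: ge_ereal_sup => _ [h /= hf <-].
have mNC : measurable (~` N) by exact: measurableC.
pose h' : {nnsfun T >-> R} := mul_nnsfun h (indic_nnsfun R mNC).
have h'E x : h' x = (h x * \1_(~` N) x)%R by [].
apply: le_ereal_sup_tmp; exists (sintegral mu h').
  exists h' => // x; rewrite h'E indicE.
  have [xN|xN] := boolP (x \in ~` N); last first.
    rewrite mulr0 patchE; case: ifPn => //; rewrite inE => /g0; by [].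
  rewrite mulr1; apply: (le_trans (hf x)).
  rewrite /patch; case: ifPn => // xD.
  move: xN; rewrite !inE in xD *.
  by apply: contra_notP => fg; apply: fgN => /= /(_ xD).
rewrite -!integralT_nnsfun; rewrite le_eqVlt; apply/orP; left; apply/eqP; apply: ge0_ae_eq_integral => //.
- by apply/measurable_EFinP; exact: measurable_funTS.
- by apply/measurable_EFinP; exact: measurable_funTS.
- by move=> x _; rewrite lee_fin.
- by move=> x _; rewrite lee_fin.
exists N; split => // x /= /not_implyP[_] H.
apply: contrapT => xN; apply: H; congr EFin.
by rewrite mindicE mem_set// mulr1.
Qed.

Lemma ae_eq_integral_any (D : set T) (f g : T -> \bar R) :
  {ae mu, forall x, D x -> f x = g x} ->
  \int[mu]_(x in D) f x = \int[mu]_(x in D) g x.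
Proof.
move=> fg; rewrite integralE [RHS]integralE; congr (_ - _);
  apply/eqP; rewrite eq_le; apply/andP; split;
  apply: ge0_ae_le_integral => //; apply: filterS fg => x fg Dx;
  by rewrite ?funeposE ?funenegE (fg Dx).
Qed.

End ae_integral.

(** * Means over the circle *)

Section circle_mean.
Context {R : realType}.
Implicit Types (P Q : R[i] -> Prop) (k l : R[i] -> R) (a b c : R).
Local Notation mu := (@lebesgue_measure R).
Local Notation C := R[i].

Lemma measurable_arcT : measurable (@arcT R : set (measurableTypeR R)).
Proof. exact: measurable_itv. Qed.
Hint Resolve measurable_arcT : core.

Lemma arcT_measure : mu (@arcT R) = (2 * pi)%:E.
Proof.
rewrite /arcT lebesgue_measure_itv/= lte_fin mulr_gt0 ?pi_gt0//=.
by rewrite oppr0 adde0.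
Qed.

Lemma twopi_gt0 : 0 < 2 * pi :> R.
Proof. by rewrite mulr_gt0// pi_gt0. Qed.

Lemma normc_cis (t : R) : normc (cis t) = 1.
Proof. by rewrite /cis /= cos2Dsin2 sqrtr1. Qed.

Lemma aeT_all P : (forall z, normc z = 1 -> P z) -> aeT P.
Proof. by move=> h; apply: aeW => t _; apply: h; rewrite normc_cis. Qed.

Lemma ae_lebesgue_filter : Filter (nbhs (almost_everywhere mu)).
Proof. exact: ae_filter_ringOfSetsType. Qed.
Local Existing Instance ae_lebesgue_filter.

Lemma aeT_mono P Q : (forall z, normc z = 1 -> P z -> Q z) -> aeT P -> aeT Q.
Proof. by move=> h; rewrite /aeT; apply: filterS => t h1 ?; apply: h (h1 _); rewrite ?normc_cis. Qed.

Lemma aeT_mono2 P Q (S : C -> Prop) :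
  (forall z, normc z = 1 -> P z -> Q z -> S z) -> aeT P -> aeT Q -> aeT S.
Proof.
by move=> h; rewrite /aeT; apply: filterS2 => t h1 h2 ?; apply: h (h1 _) (h2 _); rewrite ?normc_cis.
Qed.

Lemma aeT_forall (P : nat -> C -> Prop) :
  (forall n, aeT (P n)) -> aeT (fun z => forall n, P n z).
Proof.
move=> h; have : {ae mu, forall t, forall n, arcT t -> P n (cis t)}.
  by apply/ae_foralln.
by rewrite /aeT; apply: filterS => t h1 h2 n; apply: h1.
Qed.

(* [lebesgue_measure] is not complete: real functions on the circle are measurable
   or integrable here when a Borel function agrees with them almost everywhere. *)
Definition aemeas k := exists l,
  measurable_fun (arcT : set (measurableTypeR R))
    (fun t : measurableTypeR R => l (cis t)) /\ aeT (fun z => k z = l z).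

Definition aeint k := exists l,
  mu.-integrable arcT (EFin \o (fun t : R => l (cis t))) /\
  aeT (fun z => k z = l z).

Lemma meanT_ae k l : aeT (fun z => k z = l z) -> meanT k = meanT l.
Proof.
move=> h; rewrite /meanT; congr (_ * _); rewrite /Rintegral; congr fine.
by apply: ae_eq_integral_any; move: h; rewrite /aeT; apply: filterS => t h1 ?; rewrite h1.
Qed.

Lemma aeint_ae k l : aeT (fun z => k z = l z) -> aeint l -> aeint k.
Proof.
move=> kl [g [ig lg]]; exists g; split => //.
by apply: aeT_mono2 kl lg => z _ ->.
Qed.

Lemma aemeas_ae k l : aeT (fun z => k z = l z) -> aemeas l -> aemeas k.
Proof.
move=> kl [g [ig lg]]; exists g; split => //.
by apply: aeT_mono2 kl lg => z _ ->.
Qed.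

Lemma aeint_aemeas k : aeint k -> aemeas k.
Proof.
move=> [l [il kl]]; exists l; split => //.
by apply/measurable_EFinP; exact: measurable_int il.
Qed.

Lemma aemeas_cst c : aemeas (fun=> c).
Proof. by exists (fun=> c); split => //; exact: aeT_all. Qed.

Lemma aemeas_comp (f : R -> R) k : measurable_fun setT f -> aemeas k ->
  aemeas (fun z => f (k z)).
Proof.
move=> mf [l [ml kl]]; exists (fun z => f (l z)); split.
  exact: (measurableT_comp mf ml).
by apply: aeT_mono kl => z _ ->.
Qed.

Lemma aemeasD k l : aemeas k -> aemeas l -> aemeas (fun z => k z + l z).
Proof.
move=> [k' [mk kk]] [l' [ml ll]]; exists (fun z => k' z + l' z); split.
  exact: measurable_funD.
by apply: aeT_mono2 kk ll => z _ -> ->.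
Qed.

Lemma aemeasM k l : aemeas k -> aemeas l -> aemeas (fun z => k z * l z).
Proof.
move=> [k' [mk kk]] [l' [ml ll]]; exists (fun z => k' z * l' z); split.
  exact: measurable_funM.
by apply: aeT_mono2 kk ll => z _ -> ->.
Qed.

Lemma aemeasN k : aemeas k -> aemeas (fun z => - k z).
Proof.
move=> mk; have := aemeasM (aemeas_cst (-1)) mk; apply: aemeas_ae.
by apply: aeT_all => z _; rewrite mulN1r.
Qed.

(** The upper limit of the Borel representatives is Borel on the whole circle and agrees almost
    everywhere with the limit. *)
Lemma aemeas_cvg (k_ : nat -> C -> R) k : (forall n, aemeas (k_ n)) ->
  aeT (fun z => k_ ^~ z @ \oo --> k z) -> aemeas k.
Proof.
move=> /choice[l /all_and2[ml kl]] cv.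
exists (fun z => fine (limn_esup (fun n => (l n z)%:E))); split.
  apply: (@measurableT_comp _ _ _ _ _ _ (@fine R) _
    (fun t : measurableTypeR R => limn_esup (fun n => (l n (cis t))%:E))) => //.
  by apply: measurable_fun_limn_esup => n; apply/measurable_EFinP.
apply: aeT_mono2 cv (aeT_forall kl) => z _ cv e.
have cv' : (fun n => (l n z)%:E) @ \oo --> (k z)%:E.
  apply: cvg_EFin; first exact: nearW.
  have -> : fine \o (fun n => (l n z)%:E) = k_^~ z by apply/funext => n/=; rewrite e.
  exact: cv.
rewrite is_cvg_limn_esupE; last by apply/cvg_ex; exists (k z)%:E.
by move/cvg_lim : cv' => ->.
Qed.

Lemma aeint_le k l : aemeas k -> aeint l -> aeT (fun z => `|k z| <= l z) ->
  aeint k.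
Proof.
move=> [k' [mk kk]] [l' [il ll]] h.
(* Clamping the representative of [k] makes the bound by [|l'|] hold everywhere; almost everywhere
   nothing changes. *)
pose m z := Num.max (- l' z) (Num.min (k' z) (l' z)).
have ml : measurable_fun arcT (fun t : R => l' (cis t)).
  by apply/measurable_EFinP; exact: measurable_int il.
exists m; split.
  apply: (le_integrable _ _ _ il) => //.
    apply/measurable_EFinP; apply: measurable_maxr.
      exact: measurableT_comp.
    exact: measurable_minr.
  move=> t _ /=; rewrite lee_fin /m.
  rewrite ler_norml; have [l0|l0] := lerP 0 (l' (cis t));
    rewrite ?(ger0_norm l0) ?(ltr0_norm l0);
    case: (leP (k' (cis t)) (l' (cis t))) => h1.
  - case: (leP (- l' (cis t)) (k' (cis t))) => h2; lra.
  - case: (leP (- l' (cis t)) (l' (cis t))) => h2; lra.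
  - case: (leP (- l' (cis t)) (k' (cis t))) => h2; lra.
  - case: (leP (- l' (cis t)) (l' (cis t))) => h2; lra.
apply: aeT_mono2 (kk) (aeT_mono2 (fun z _ => @conj _ _) ll h) => z _ e [e1].
rewrite /m -e -e1 ler_norml => /andP[h1 h2].
by rewrite (min_idPl h2) (max_idPr h1).
Qed.

Lemma aeint_cst c : aeint (fun=> c).
Proof.
exists (fun=> c); split; last exact: aeT_all.
apply: measurable_bounded_integrable => //.
  by rewrite [X in (X < _)%E]arcT_measure ltry.
by exists `|c|; split => // M cM x _ /=; exact: ltW.
Qed.

Lemma meanT_cst c : meanT (fun=> c) = c :> R.
Proof.
rewrite /meanT Rintegral_cst//= arcT_measure /= mulrCA mulVf ?mulr1//.
by rewrite gt_eqF// twopi_gt0.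
Qed.

Lemma aeintD k l : aeint k -> aeint l -> aeint (fun z => k z + l z).
Proof.
move=> [k' [mk kk]] [l' [ml ll]]; exists (fun z => k' z + l' z); split.
  exact: (integrableD measurable_arcT mk ml).
by apply: aeT_mono2 kk ll => z _ -> ->.
Qed.

Lemma meanTD k l : aeint k -> aeint l ->
  meanT (fun z => k z + l z) = meanT k + meanT l.
Proof.
move=> [k' [mk kk]] [l' [ml ll]].
rewrite (meanT_ae kk) (meanT_ae ll) (@meanT_ae _ (fun z => k' z + l' z)).
  by rewrite /meanT RintegralD// mulrDr.
by apply: aeT_mono2 kk ll => z _ -> ->.
Qed.

Lemma aeintZ c k : aeint k -> aeint (fun z => c * k z).
Proof.
move=> [k' [mk kk]]; exists (fun z => c * k' z); split.
  exact: (integrableZl measurable_arcT c mk).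
by apply: aeT_mono kk => z _ ->.
Qed.

Lemma meanTZ c k : aeint k -> meanT (fun z => c * k z) = c * meanT k.
Proof.
move=> [k' [mk kk]].
rewrite (meanT_ae kk) (@meanT_ae _ (fun z => c * k' z)).
  by rewrite /meanT RintegralZl// mulrCA.
by apply: aeT_mono kk => z _ ->.
Qed.

Lemma aeintN k : aeint k -> aeint (fun z => - k z).
Proof.
move=> /(aeintZ (-1)); apply: aeint_ae.
by apply: aeT_all => z _; rewrite mulN1r.
Qed.

Lemma meanTN k : aeint k -> meanT (fun z => - k z) = - meanT k.
Proof.
move=> ik; rewrite -mulN1r -meanTZ//; apply: meanT_ae.
by apply: aeT_all => z _; rewrite mulN1r.
Qed.

Lemma aeintB k l : aeint k -> aeint l -> aeint (fun z => k z - l z).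
Proof. by move=> ik il; exact: aeintD ik (aeintN il). Qed.

Lemma meanTB k l : aeint k -> aeint l ->
  meanT (fun z => k z - l z) = meanT k - meanT l.
Proof. by move=> ik il; rewrite meanTD ?meanTN//; exact: aeintN. Qed.

Lemma aeint_norm k : aeint k -> aeint (fun z => `|k z|).
Proof.
move=> [k' [mk kk]]; exists (fun z => `|k' z|); split.
  exact: integrable_norm.
by apply: aeT_mono kk => z _ ->.
Qed.

Lemma meanT_ge0 k : aeT (fun z => 0 <= k z) -> 0 <= meanT k.
Proof.
move=> h; rewrite (@meanT_ae _ (fun z => Num.max 0 (k z))); last first.
  by apply: aeT_mono h => z _ h; rewrite max_r.
rewrite /meanT mulr_ge0 ?invr_ge0 ?(ltW twopi_gt0)//.
by apply: Rintegral_ge0 => x _; rewrite le_max lexx.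
Qed.

Lemma meanT_le k l : aeint k -> aeint l -> aeT (fun z => k z <= l z) ->
  meanT k <= meanT l.
Proof.
move=> ik il h; rewrite -subr_ge0 -meanTB//; apply: meanT_ge0.
by apply: aeT_mono h => z _; rewrite subr_ge0.
Qed.

Lemma meanT_dominated (k_ : nat -> C -> R) k l : (forall n, aemeas (k_ n)) ->
  aeint l -> (forall n, aeT (fun z => `|k_ n z| <= l z)) ->
  aeT (fun z => k_ ^~ z @ \oo --> k z) ->
  aeint k /\ meanT (k_ n) @[n --> \oo] --> meanT k.
Proof.
move=> mk il kl cv; have mk' := aemeas_cvg mk cv.
have kl' : aeT (fun z => `|k z| <= l z).
  apply: aeT_mono2 cv (aeT_forall kl) => z _ cv h.
  by apply: (cvgr_to_le (cvg_norm cv)); exact: nearW.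
have ik := aeint_le mk' il kl'; split => //.
have [k' [mk2 kk]] := ik; have [l' [il2 ll]] := il.
have /choice[g /all_and2[mg kg]] := mk.
rewrite (meanT_ae kk) (_ : (fun n => meanT (k_ n)) = (fun n => meanT (g n))); last first.
  by apply/funext => n; exact: meanT_ae.
have ik' : mu.-integrable arcT (EFin \o (fun t : R => k' (cis t))).
  by have [k2 [? ?]] := ik; exact: mk2.
have il' : mu.-integrable arcT (EFin \o (fun t : R => l' (cis t))) by [].
have cvg_ae : {ae mu, forall t, arcT t ->
    (fun n => (g n (cis t))%:E) @ \oo --> (k' (cis t))%:E}.
  move: (aeT_mono2 (fun z _ => @conj _ _) cv (aeT_mono2 (fun z _ => @conj _ _) kk (aeT_forall kg))).
  rewrite /aeT; apply: filterS => t h D; have [cv1 [e1 e2]] := h D.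
  rewrite -e1; apply: cvg_EFin; first exact: nearW.
  rewrite (_ : fine \o _ = k_^~ (cis t))//.
  by apply/funext => n /=; rewrite -e2.
have bnd_ae : {ae mu, forall t, forall n, arcT t ->
    (`|(g n (cis t))%:E| <= (l' (cis t))%:E)%E}.
  move: (aeT_mono2 (fun z _ => @conj _ _) (aeT_forall kl) (aeT_mono2 (fun z _ => @conj _ _) ll (aeT_forall kg))).
  rewrite /aeT; apply: filterS => t h n D; have [cv1 [e1 e2]] := h D.
  by rewrite /= lee_fin -e1 -e2.
have [_ _ h] := @dominated_convergence _ (measurableTypeR R) _ mu arcT measurable_arcT
  (fun n (t : R) => (g n (cis t))%:E) (fun t : R => (k' (cis t))%:E)
  (fun t : R => (l' (cis t))%:E)
  (fun n => proj2 (measurable_EFinP _ _) (mg n)) (measurable_int _ ik') cvg_ae il' bnd_ae.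
rewrite /meanT; apply: cvgMr; apply: fine_cvg; rewrite fineK; last first.
  exact: (@integrable_fin_num _ (measurableTypeR R) _ mu _ measurable_arcT _ ik').
exact: h.
Qed.

Lemma normr_max0_le c : `|Num.max c 0| <= `|c|.
Proof. by have [h|h] := leP c 0; rewrite ?normr0. Qed.

(** For use where a uniform bound on the means is known but no dominating function: integrability of
    the limit is part of the conclusion. Positive parts make the Borel representatives nonnegative
    everywhere, as Fatou's lemma requires. *)
Lemma meanT_fatou (k_ : nat -> C -> R) k c : (forall n, aeint (k_ n)) ->
  (forall n, aeT (fun z => 0 <= k_ n z)) -> (forall n, meanT (k_ n) <= c) ->
  aeT (fun z => k_ ^~ z @ \oo --> k z) -> aeint k /\ meanT k <= c.
Proof.
move=> ik k0 kc cv; have /choice[g /all_and2[ig kg]] := ik.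
pose g' n z := Num.max (g n z) 0.
have kg' n : aeT (fun z => k_ n z = g' n z).
  by apply: aeT_mono2 (k0 n) (kg n) => z _ h e; rewrite /g' -e max_l.
have mg n : measurable_fun (arcT : set (measurableTypeR R))
   (fun t : measurableTypeR R => g n (cis t)).
  by apply/measurable_EFinP; exact: measurable_int (ig n).
have mg' n : measurable_fun (arcT : set (measurableTypeR R))
   (fun t : measurableTypeR R => g' n (cis t)).
  exact: measurable_maxr.
pose h (t : measurableTypeR R) := limn_einf (fun n => (g' n (cis t))%:E).
have mh : measurable_fun arcT h.
  rewrite /h /limn_einf.
  apply: (@measurableT_comp _ _ _ _ _ _ (@oppe R) _
    (fun t : measurableTypeR R => limn_esup (fun n => (- (g' n (cis t))%:E)%E))) => //.
  apply: measurable_fun_limn_esup => n.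
  apply: (@measurableT_comp _ _ _ _ _ _ (@oppe R) _
    (fun t : measurableTypeR R => (g' n (cis t))%:E)) => //.
  exact/measurable_EFinP.
have h0 t : arcT t -> (0 <= h t)%E.
  move=> _; rewrite /h limn_einf_lim; apply: lime_ge; first exact: is_cvg_einfs.
  apply: nearW => n; apply: le_ereal_inf_tmp => _ [m _ <-].
  by rewrite lee_fin /g' le_max lexx orbT.
have int_c n : (\int[mu]_(t in arcT) (g' n (cis t))%:E <= (2 * pi * c)%:E)%E.
  have := kc n; rewrite (meanT_ae (kg' n)) /meanT mulrC ler_pdivrMr ?twopi_gt0//.
  rewrite [c * _]mulrC -lee_fin /Rintegral fineK//.
  apply: (@integrable_fin_num _ (measurableTypeR R) _ mu) => //.
  apply: (@le_integrable _ (measurableTypeR R) _ mu _ measurable_arcT _ _ _ _ (ig n)).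
    exact/measurable_EFinP.
  by move=> t _ /=; rewrite lee_fin normr_max0_le.
have int_h : (\int[mu]_(t in arcT) h t <= (2 * pi * c)%:E)%E.
  apply: le_trans (@fatou _ (measurableTypeR R) _ mu arcT measurable_arcT _ _ _) _.
  - by move=> n; exact/measurable_EFinP.
  - by move=> n t _; rewrite lee_fin /g' le_max lexx orbT.
  rewrite limn_einf_lim; apply: lime_le; first exact: is_cvg_einfs.
  apply: nearW => n; apply: le_trans (int_c n).
  by apply: ereal_inf_lbound; exists n => //=.
have hk : {ae mu, forall t, arcT t -> h t = (k (cis t))%:E}.
  move: (aeT_mono2 (fun z _ => @conj _ _) cv (aeT_forall kg')).
  rewrite /aeT; apply: filterS => t H D; have [cv1 e] := H D.
  rewrite /h.
  have cv' : (fun n => (g' n (cis t))%:E) @ \oo --> (k (cis t))%:E.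
    apply: cvg_EFin; first exact: nearW.
    by under eq_fun do rewrite /= -e.
  by rewrite (cvg_limn_einf_sup cv').1.
pose l z := fine (limn_einf (fun n => (g' n z)%:E)).
have kl : aeT (fun z => k z = l z).
  by move: hk; rewrite /aeT; apply: filterS => t H D; rewrite /l -[limn_einf _]/(h t) H.
have il : mu.-integrable arcT (EFin \o (fun t : R => l (cis t))).
  apply/integrableP; split.
    apply/measurable_EFinP; apply: (@measurableT_comp _ _ _ _ _ _ (@fine R) _ h) => //.
  rewrite (@ae_eq_integral_any _ _ _ _ _ _ h).
    by apply: le_lt_trans int_h _; rewrite ltry.
  move: hk; apply: filterS => t H D.
  by rewrite /= /l -[limn_einf _]/(h t) H//= ger0_norm// -lee_fin -H// h0.
split; first by exists l.
rewrite (meanT_ae kl) /meanT mulrC ler_pdivrMr ?twopi_gt0// [c * _]mulrC.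
rewrite /Rintegral -lee_fin fineK; last first.
  by apply: (@integrable_fin_num _ (measurableTypeR R) _ mu).
apply: le_trans int_h; rewrite le_eqVlt; apply/orP; left; apply/eqP.
apply: ae_eq_integral_any.
by move: hk; apply: filterS => t H D; rewrite /l -[limn_einf _]/(h t) H.
Qed.

(** Integrating term by term, the sum has a finite integral, hence is finite almost everywhere. It
    serves the Riesz-Fischer theorem, the integrability of [ln |p|] on the circle, and the
    Borel-Cantelli argument for null sets. *)
Lemma meanT_series (k_ : nat -> C -> R) c : (forall n, aeint (k_ n)) ->
  (forall n, aeT (fun z => 0 <= k_ n z)) ->
  (forall N, \sum_(n < N) meanT (k_ n) <= c) ->
  aeT (fun z => cvgn (series (fun n => k_ n z))).
Proof.
move=> ik k0 kc; have /choice[g /all_and2[ig kg]] := ik.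
pose g' n z := Num.max (g n z) 0.
have kg' n : aeT (fun z => k_ n z = g' n z).
  by apply: aeT_mono2 (k0 n) (kg n) => z _ h e; rewrite /g' -e max_l.
have mg n : measurable_fun (arcT : set (measurableTypeR R))
   (fun t : measurableTypeR R => g n (cis t)).
  by apply/measurable_EFinP; exact: measurable_int (ig n).
have mg' n : measurable_fun (arcT : set (measurableTypeR R))
   (fun t : measurableTypeR R => g' n (cis t)).
  exact: measurable_maxr.
have g0 n (t : measurableTypeR R) : (0 <= (g' n (cis t))%:E)%E.
  by rewrite lee_fin /g' le_max lexx orbT.
have int_g n : (\int[mu]_(t in arcT) (g' n (cis t))%:E = (2 * pi * meanT (k_ n))%:E)%E.
  rewrite (meanT_ae (kg' n)) /meanT mulrA divff ?gt_eqF ?twopi_gt0// mul1r.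
  rewrite /Rintegral fineK//.
  apply: (@integrable_fin_num _ (measurableTypeR R) _ mu) => //.
  apply: (@le_integrable _ (measurableTypeR R) _ mu _ measurable_arcT _ _ _ _ (ig n)).
    exact/measurable_EFinP.
  by move=> t _ /=; rewrite lee_fin normr_max0_le.
have := @integral_nneseries _ (measurableTypeR R) _ mu arcT measurable_arcT
  (fun n t => (g' n (cis t))%:E) (fun n => proj2 (measurable_EFinP _ _) (mg' n))
  (fun n t _ => g0 n t).
move=> e.
have lt_oo : (\int[mu]_(t in arcT) (\sum_(n <oo) (g' n (cis t))%:E) < +oo)%E.
  rewrite e; apply: (@le_lt_trans _ _ (2 * pi * c)%:E); last by rewrite ltry.
  apply: lime_le; first by apply: is_cvg_nneseries => n _ _; rewrite int_g lee_fin mulr_ge0 ?(ltW twopi_gt0)// meanT_ge0.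
  apply: nearW => N; rewrite big_mkord; under eq_bigr do rewrite int_g.
  by rewrite sumEFin lee_fin -mulr_sumr ler_wpM2l ?(ltW twopi_gt0).
have im : mu.-integrable arcT (fun t : R => (\sum_(n <oo) (g' n (cis t))%:E)%E).
  apply/integrableP; split.
    apply: ge0_emeasurable_sum => //; by move=> n _; exact/measurable_EFinP.
  under eq_integral do rewrite gee0_abs ?nneseries_ge0//.
  exact: lt_oo.
have := @integrable_ae _ (measurableTypeR R) _ mu _ measurable_arcT _ im.
move=> fin.
move: (aeT_forall kg'); rewrite /aeT; move: fin; apply: filterS2 => t fin H D.
rewrite (_ : (fun n => k_ n (cis t)) = (fun n => g' n (cis t))); last by apply/funext => n; rewrite H.
apply: nondecreasing_is_cvgn.
  by apply: nondecreasing_series => n _ _; rewrite -lee_fin g0.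
exists (fine (\sum_(n <oo) (g' n (cis t))%:E)%E) => _ [n _ <-].
rewrite -lee_fin fineK; last exact: fin.
rewrite /series/= -sumEFin; apply: nneseries_lim_ge => m _ _; exact: g0.
Qed.

Lemma meanT_eq0 k : aeint k -> aeT (fun z => 0 <= k z) -> meanT k <= 0 ->
  aeT (fun z => k z = 0).
Proof.
move=> ik k0 m0; have [g [ig kg]] := ik.
have mg : measurable_fun (arcT : set (measurableTypeR R))
   (fun t : measurableTypeR R => g (cis t)).
  by apply/measurable_EFinP; exact: measurable_int ig.
have /(ae_eq_integral_abs mu measurable_arcT (proj2 (measurable_EFinP _ _) mg)) :
    (\int[mu]_(t in arcT) `|(g (cis t))%:E| = 0)%E.
  have := @integrable_fin_num _ (measurableTypeR R) _ mu arcT measurable_arcT _ (integrable_abse ig).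
  move=> fi; rewrite -[LHS]fineK//; congr EFin.
  have : meanT (fun z => `|g z|) = 0.
    rewrite (@meanT_ae _ k); first by apply/eqP; rewrite eq_le m0 meanT_ge0.
    by apply: aeT_mono2 k0 kg => z _ h e; rewrite -e ger0_norm.
  rewrite /meanT => /eqP; rewrite mulf_eq0 invr_eq0 (gt_eqF twopi_gt0) /= => /eqP.
  by [].
move=> h; move: h kg; rewrite /aeT; apply: filterS2 => t h e D.
by rewrite e//; have /= [] := h D.
Qed.

End circle_mean.

#[global] Existing Instance ae_lebesgue_filter.

(** * Modulus and limits of complex numbers *)

Section complex_limits.
Context {R : realType}.
Local Notation C := R[i].
Implicit Types (z w : C) (r : R).

Lemma normCE z : `|z| = (normc z)%:C. Proof. by []. Qed.

Lemma normc_ge0 z : 0 <= normc z.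
Proof. by case: z => a b; rewrite /= sqrtr_ge0. Qed.

Lemma normc_sqr z : normc z ^+ 2 = complex.Re z ^+ 2 + complex.Im z ^+ 2.
Proof. by case: z => a b /=; rewrite sqr_sqrtr// addr_ge0 ?sqr_ge0. Qed.

Lemma ler_Re z : `|complex.Re z| <= normc z.
Proof.
rewrite -ler_sqr ?nnegrE ?normc_ge0// normc_sqr real_normK ?num_real//.
by rewrite lerDl sqr_ge0.
Qed.

Lemma ler_Im z : `|complex.Im z| <= normc z.
Proof.
rewrite -ler_sqr ?nnegrE ?normc_ge0// normc_sqr real_normK ?num_real//.
by rewrite lerDr sqr_ge0.
Qed.

Lemma normc_real r : normc r%:C = `|r|.
Proof. by rewrite /= expr0n /= addr0 sqrtr_sqr. Qed.

Lemma normc_conj z : normc z^* = normc z.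
Proof. by case: z => a b /=; rewrite sqrrN. Qed.

Lemma normc_eq0 z : (normc z == 0) = (z == 0).
Proof.
by apply/eqP/eqP => [|->]; [exact: eq0_normc|exact: normc0].
Qed.

Lemma normc_gt0 z : (0 < normc z) = (z != 0).
Proof. by rewrite lt_neqAle normc_ge0 andbT eq_sym normc_eq0. Qed.

Lemma normcX z n : normc (z ^+ n) = normc z ^+ n.
Proof. by elim: n => [|n IH]; rewrite ?expr0 ?normc1// !exprS normcM IH. Qed.

Lemma normcB z w : normc (z - w) = normc (w - z).
Proof. by rewrite -normcN opprB. Qed.

Lemma normc_leReIm z : normc z <= `|complex.Re z| + `|complex.Im z|.
Proof.
rewrite -ler_sqr ?nnegrE ?normc_ge0 ?addr_ge0// normc_sqr sqrrD !real_normK ?num_real//.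
by rewrite lerD2r lerDl mulrn_wge0// mulr_ge0.
Qed.

Lemma mulcJ z : z * z^* = ((normc z) ^+ 2)%:C.
Proof.
rewrite normc_sqr; case: z => a b /=; apply/eqP; rewrite eq_complex /=.
by apply/andP; split; apply/eqP; ring.
Qed.

Lemma lec_normc_sub z w : `|normc z - normc w| <= normc (z - w).
Proof.
rewrite ler_norml; apply/andP; split.
  by rewrite lerNl opprB lerBlDr normcB (le_trans _ (le_normcD _ _))// subrK.
by rewrite lerBlDr (le_trans _ (le_normcD _ _))// subrK.
Qed.

Lemma cReD z w : complex.Re (z + w) = complex.Re z + complex.Re w.
Proof. by case: z w => [a b] [c d]. Qed.
Lemma cImD z w : complex.Im (z + w) = complex.Im z + complex.Im w.
Proof. by case: z w => [a b] [c d]. Qed.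
Lemma cReN z : complex.Re (- z) = - complex.Re z.
Proof. by case: z. Qed.
Lemma cImN z : complex.Im (- z) = - complex.Im z.
Proof. by case: z. Qed.
Lemma cReM z w : complex.Re (z * w) =
  complex.Re z * complex.Re w - complex.Im z * complex.Im w.
Proof. by case: z w => [a b] [c d]. Qed.
Lemma cImM z w : complex.Im (z * w) =
  complex.Re z * complex.Im w + complex.Im z * complex.Re w.
Proof. by case: z w => [a b] [c d]. Qed.
Lemma cReJ z : complex.Re z^* = complex.Re z. Proof. by case: z. Qed.
Lemma cImJ z : complex.Im z^* = - complex.Im z. Proof. by case: z. Qed.

Lemma complex_ext z w : complex.Re z = complex.Re w ->
  complex.Im z = complex.Im w -> z = w.
Proof. by case: z w => [a b] [c d] /= -> ->. Qed.

Lemma cconjD z w : (z + w)^* = z^* + w^*. Proof. exact: rmorphD. Qed.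
Lemma cconjB z w : (z - w)^* = z^* - w^*. Proof. exact: rmorphB. Qed.
Lemma cconjM z w : (z * w)^* = z^* * w^*. Proof. exact: rmorphM. Qed.
Lemma cconjV z : (z^-1)^* = (z^*)^-1. Proof. exact: fmorphV. Qed.
Lemma cconjX z n : (z ^+ n)^* = z^* ^+ n. Proof. exact: rmorphXn. Qed.
Lemma cconj1 : (1 : C)^* = 1. Proof. exact: rmorph1. Qed.
Lemma cconj0 : (0 : C)^* = 0. Proof. exact: rmorph0. Qed.
Lemma cconjK z : z^*^* = z. Proof. exact: conjCK. Qed.
Section filters.
Context {T : Type} {F : set_system T} {FF : Filter F}.
Implicit Types (f g : T -> C).

(** The norm of [C] takes values in [C], and its positive elements are exactly the embedded positive
    reals; this moves the epsilons to [R]. *)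
Lemma cvgC_normc f (l : C^o) :
  ((f : T -> C^o) @ F --> l) <-> (normc (f x - l) @[x --> F] --> (0 : R)).
Proof.
split.
  move=> /cvgrPdist_lt h; apply/cvgrPdist_lt => e e0.
  have := h e%:C; rewrite ltcR => /(_ e0); apply: filterS => x.
  by rewrite normCE ltcR sub0r normrN ger0_norm ?normc_ge0// normcB.
move=> /cvgrPdist_lt h; apply/cvgrPdist_lt => e e0.
have [er e0'] : e = (complex.Re e)%:C /\ 0 < complex.Re e.
  by move: e0; case: (e) => a b; rewrite ltcE /= => /andP[/eqP -> ->].
have := h _ e0'; apply: filterS => x.
by rewrite er normCE ltcR sub0r normrN ger0_norm ?normc_ge0// normcB.
Qed.

Lemma cvg_dist_le (h g : T -> R) (l : R) :
  (\forall x \near F, `|h x - l| <= g x) -> g x @[x --> F] --> (0 : R) ->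
  h x @[x --> F] --> l.
Proof.
move=> hg /cvgrPdist_lt g0; apply/cvgrPdist_lt => e e0.
move: hg (g0 _ e0); apply: filterS2 => x h1.
rewrite sub0r normrN distrC => h2; apply: le_lt_trans h1 _.
by apply: le_lt_trans h2; exact: ler_norm.
Qed.

Lemma cvgC_dist_le f (g : T -> R) (l : C^o) :
  (\forall x \near F, normc (f x - l) <= g x) -> g x @[x --> F] --> (0 : R) ->
  (f : T -> C^o) @ F --> l.
Proof.
move=> hg g0; apply/cvgC_normc; apply: cvg_dist_le g0.
by move: hg; apply: filterS => x; rewrite subr0 ger0_norm ?normc_ge0.
Qed.

Lemma cvgC_Re f (l : C^o) : (f : T -> C^o) @ F --> l ->
  complex.Re (f x) @[x --> F] --> complex.Re l.
Proof.
move=> /cvgC_normc h; apply: cvg_dist_le h; apply: nearW => x.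
by rewrite -cReN -cReD ler_Re.
Qed.

Lemma cvgC_Im f (l : C^o) : (f : T -> C^o) @ F --> l ->
  complex.Im (f x) @[x --> F] --> complex.Im l.
Proof.
move=> /cvgC_normc h; apply: cvg_dist_le h; apply: nearW => x.
by rewrite -cImN -cImD ler_Im.
Qed.

Lemma cvgC_norm f (l : C^o) : (f : T -> C^o) @ F --> l ->
  normc (f x) @[x --> F] --> normc l.
Proof.
move=> /cvgC_normc h; apply: cvg_dist_le h; apply: nearW => x.
exact: lec_normc_sub.
Qed.

Lemma cvgC_conj f (l : C^o) : (f : T -> C^o) @ F --> l ->
  (fun x => (f x)^* : C^o) @ F --> (l^* : C^o).
Proof.
move=> /cvgC_normc h; apply: cvgC_dist_le h; apply: nearW => x.
by rewrite -rmorphB normc_conj.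
Qed.

Lemma cvgC_ReIm f (l : C^o) :
  complex.Re (f x) @[x --> F] --> complex.Re l ->
  complex.Im (f x) @[x --> F] --> complex.Im l ->
  (f : T -> C^o) @ F --> l.
Proof.
move=> h1 h2; apply/cvgC_normc.
apply: (@cvg_dist_le _ (fun x => `|complex.Re (f x) - complex.Re l| +
   `|complex.Im (f x) - complex.Im l|)).
  apply: nearW => x; rewrite subr0 ger0_norm ?normc_ge0//.
  by rewrite -cReN -cReD -cImN -cImD normc_leReIm.
rewrite -[X in _ --> X]addr0; apply: cvgD.
  by rewrite -(normr0 R) -(subrr (complex.Re l)); apply: cvg_norm; apply: cvgB => //; exact: cvg_cst.
by rewrite -(normr0 R) -(subrr (complex.Im l)); apply: cvg_norm; apply: cvgB => //; exact: cvg_cst.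
Qed.

Lemma cvgC_real (g : T -> R) (l : R) : g @ F --> l ->
  (fun x => (g x)%:C : C^o) @ F --> (l%:C : C^o).
Proof. by move=> h; apply: cvgC_ReIm => //=; exact: cvg_cst. Qed.

Lemma cvgCD f g (k l : C^o) : (f : T -> C^o) @ F --> k -> (g : T -> C^o) @ F --> l ->
  (fun x => f x + g x : C^o) @ F --> (k + l : C^o).
Proof. exact: cvgD. Qed.

Lemma cvgCM f g (k l : C^o) : (f : T -> C^o) @ F --> k -> (g : T -> C^o) @ F --> l ->
  (fun x => f x * g x : C^o) @ F --> (k * l : C^o).
Proof. exact: cvgM. Qed.

Lemma cvgCB f g (k l : C^o) : (f : T -> C^o) @ F --> k -> (g : T -> C^o) @ F --> l ->
  (fun x => f x - g x : C^o) @ F --> (k - l : C^o).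
Proof. exact: cvgB. Qed.

Lemma cvgCV f (k : C^o) : k != 0 -> (f : T -> C^o) @ F --> k ->
  (fun x => (f x)^-1 : C^o) @ F --> (k^-1 : C^o).
Proof. exact: cvgV. Qed.

End filters.

Lemma cvgC_unique {T} {F : set_system T} {FF : ProperFilter F} (f : T -> C) (k l : C^o) :
  (f : T -> C^o) @ F --> k -> (f : T -> C^o) @ F --> l -> k = l.
Proof. by move=> h1 h2; apply: (cvg_unique _ h1 h2); exact: norm_hausdorff. Qed.

End complex_limits.

(** * Complex-valued L^1 and L^2 functions on the circle *)

Section complex_mean.
Context {R : realType}.
Local Notation C := R[i].
Implicit Types (f g h : C -> C) (z w c : C) (k l : C -> R).

Lemma measurableTP f : measT f <->
  aemeas (fun z => complex.Re (f z)) /\ aemeas (fun z => complex.Im (f z)).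
Proof.
split=> [[g [[m1 m2] fg]]|[[k [mk fk]] [l [ml fl]]]].
  split; [exists (fun z => complex.Re (g z))|exists (fun z => complex.Im (g z))].
    by split => //; apply: aeT_mono fg => z _ ->.
  by split => //; apply: aeT_mono fg => z _ ->.
exists (fun z => k z +i* l z); split; first by split.
by apply: aeT_mono2 fk fl => z _ e1 e2; apply: complex_ext.
Qed.

Lemma measurableT_ae f g : aeT (fun z => f z = g z) -> measT g -> measT f.
Proof. by move=> fg [h [mh gh]]; exists h; split=> //; apply: aeT_mono2 fg gh => z _ ->. Qed.

Lemma measurableT_cst c : measT (fun=> c).
Proof. by apply/measurableTP; split; exact: aemeas_cst. Qed.

Lemma measurableTD f g : measT f -> measT g -> measT (fun z => f z + g z).
Proof.
move=> /measurableTP[f1 f2] /measurableTP[g1 g2]; apply/measurableTP; split.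
  apply: aemeas_ae (aemeasD f1 g1); apply: aeT_all => z _; exact: cReD.
apply: aemeas_ae (aemeasD f2 g2); apply: aeT_all => z _; exact: cImD.
Qed.

Lemma measurableTM f g : measT f -> measT g -> measT (fun z => f z * g z).
Proof.
move=> /measurableTP[f1 f2] /measurableTP[g1 g2]; apply/measurableTP; split.
  apply: aemeas_ae (aemeasD (aemeasM f1 g1) (aemeasN (aemeasM f2 g2))).
  by apply: aeT_all => z _; exact: cReM.
apply: aemeas_ae (aemeasD (aemeasM f1 g2) (aemeasM f2 g1)).
by apply: aeT_all => z _; exact: cImM.
Qed.

Lemma measurableTN f : measT f -> measT (fun z => - f z).
Proof.
move=> mf; apply: measurableT_ae (measurableTM (measurableT_cst (-1)) mf).
by apply: aeT_all => z _; rewrite mulN1r.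
Qed.

Lemma measurableTB f g : measT f -> measT g -> measT (fun z => f z - g z).
Proof. by move=> mf mg; exact: measurableTD mf (measurableTN mg). Qed.

Lemma measurableT_conj f : measT f -> measT (fun z => (f z)^*).
Proof.
move=> /measurableTP[f1 f2]; apply/measurableTP; split.
  by apply: aemeas_ae f1; apply: aeT_all => z _; rewrite cReJ.
by apply: aemeas_ae (aemeasN f2); apply: aeT_all => z _; rewrite cImJ.
Qed.

Lemma measurableTX f n : measT f -> measT (fun z => f z ^+ n).
Proof.
move=> mf; elim: n => [|n IH]; first exact: measurableT_cst.
by under [X in measT X]eq_fun do rewrite exprS; exact: measurableTM.
Qed.

Lemma measurableT_real k : aemeas k -> measT (fun z => (k z)%:C).
Proof. by move=> mk; apply/measurableTP; split => //=; exact: aemeas_cst. Qed.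

Lemma aemeas_normc f : measT f -> aemeas (fun z => normc (f z)).
Proof.
move=> /measurableTP[f1 f2].
have := aemeas_comp (continuous_measurable_fun (@sqrt_continuous R))
  (aemeasD (aemeasM f1 f1) (aemeasM f2 f2)).
apply: aemeas_ae; apply: aeT_all => z _; rewrite -!expr2.
by case: (f z).
Qed.

Lemma aemeas_normc2 f : measT f -> aemeas (fun z => normc (f z) ^+ 2).
Proof.
move=> /aemeas_normc h; apply: aemeas_ae (aemeasM h h).
by apply: aeT_all => z _; rewrite expr2.
Qed.

Lemma measurableT_cvg (f_ : nat -> C -> C) f : (forall n, measT (f_ n)) ->
  aeT (fun z => (fun n => f_ n z : C^o) @ \oo --> (f z : C^o)) -> measT f.
Proof.
move=> mf cv; apply/measurableTP; split.
  apply: (@aemeas_cvg _ (fun n z => complex.Re (f_ n z))).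
    by move=> n; case/measurableTP: (mf n).
  by apply: aeT_mono cv => z _; exact: cvgC_Re.
apply: (@aemeas_cvg _ (fun n z => complex.Im (f_ n z))).
  by move=> n; case/measurableTP: (mf n).
by apply: aeT_mono cv => z _; exact: cvgC_Im.
Qed.

Lemma measurableT_continuous f :
  continuous (fun t : R => f (cis t) : C^o) -> measT f.
Proof.
move=> cf; exists f; split; last exact: aeT_all.
by split; apply: measurable_funTS; apply: continuous_measurable_fun => t;
  [apply: cvgC_Re|apply: cvgC_Im]; exact: cf.
Qed.

Lemma continuous_cis : continuous (fun t : R => cis t : C^o).
Proof.
by move=> t; apply: cvgC_ReIm => /=; [exact: continuous_cos|exact: continuous_sin].
Qed.

Lemma measurableT_id : measT (fun z : C => z).
Proof. by apply: measurableT_continuous; exact: continuous_cis. Qed.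

Definition L1 f := measT f /\ aeint (fun z => normc (f z)).

Lemma L1_ae f g : aeT (fun z => f z = g z) -> L1 g -> L1 f.
Proof.
move=> fg [m i]; split; first exact: measurableT_ae m.
by apply: aeint_ae i; apply: aeT_mono fg => z _ ->.
Qed.

Lemma L1P f : L1 f <->
  aeint (fun z => complex.Re (f z)) /\ aeint (fun z => complex.Im (f z)).
Proof.
split=> [[/measurableTP[m1 m2] i]|[i1 i2]].
  by split; [apply: aeint_le m1 i _|apply: aeint_le m2 i _];
     apply: aeT_all => z _; [exact: ler_Re|exact: ler_Im].
have mf : measT f by apply/measurableTP; split; exact: aeint_aemeas.
split => //; apply: aeint_le (aemeas_normc mf) (aeintD (aeint_norm i1) (aeint_norm i2)) _.
by apply: aeT_all => z _; rewrite ger0_norm ?normc_ge0// normc_leReIm.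
Qed.

Lemma L1_le f k : measT f -> aeint k -> aeT (fun z => normc (f z) <= k z) -> L1 f.
Proof.
move=> mf ik fk; split => //; apply: aeint_le (aemeas_normc mf) ik _.
by apply: aeT_mono fk => z _; rewrite ger0_norm ?normc_ge0.
Qed.

Lemma L1_real k : aeint k -> L1 (fun z => (k z)%:C).
Proof. by move=> ik; apply/L1P; split => //=; exact: aeint_cst. Qed.

Lemma L1_cst c : L1 (fun=> c).
Proof. by apply/L1P; split; exact: aeint_cst. Qed.

Lemma L1D f g : L1 f -> L1 g -> L1 (fun z => f z + g z).
Proof.
move=> [mf i] [mg j]; apply: L1_le (measurableTD mf mg) (aeintD i j) _.
by apply: aeT_all => z _; exact: le_normcD.
Qed.

Lemma L1_bounded_mul f g (M : R) : measT f -> aeT (fun z => normc (f z) <= M) ->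
  L1 g -> L1 (fun z => f z * g z).
Proof.
move=> mf fM [mg i]; apply: L1_le (measurableTM mf mg) (aeintZ M i) _.
by apply: aeT_mono fM => z _ h; rewrite normcM ler_wpM2r// normc_ge0.
Qed.

Lemma L1Z c f : L1 f -> L1 (fun z => c * f z).
Proof.
by apply: (@L1_bounded_mul _ _ (normc c)); [exact: measurableT_cst|exact: aeT_all].
Qed.

Lemma L1N f : L1 f -> L1 (fun z => - f z).
Proof. by move=> /(L1Z (-1)); apply: L1_ae; apply: aeT_all => z _; rewrite mulN1r. Qed.

Lemma L1B f g : L1 f -> L1 g -> L1 (fun z => f z - g z).
Proof. by move=> i j; exact: L1D i (L1N j). Qed.

Lemma L1_conj f : L1 f -> L1 (fun z => (f z)^*).
Proof.
move=> [mf i]; apply: L1_le (measurableT_conj mf) i _.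
by apply: aeT_all => z _; rewrite normc_conj.
Qed.

Lemma L1_sum (I : Type) (r : seq I) (F : I -> C -> C) :
  (forall i, L1 (F i)) -> L1 (fun z => \sum_(i <- r) F i z).
Proof.
move=> h; elim: r => [|i r IH].
  by apply: L1_ae (L1_cst 0); apply: aeT_all => z _; rewrite big_nil.
by apply: L1_ae (L1D (h i) IH); apply: aeT_all => z _; rewrite big_cons.
Qed.

Lemma L1_bounded f (M : R) : measT f -> aeT (fun z => normc (f z) <= M) -> L1 f.
Proof. by move=> mf fM; apply: L1_le mf (aeint_cst M) fM. Qed.

Lemma meanTC_ae f g : aeT (fun z => f z = g z) -> meanTC f = meanTC g.
Proof.
by move=> fg; rewrite /meanTC; congr (_ +i* _); apply: meanT_ae; apply: aeT_mono fg => z _ ->.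
Qed.

Lemma Re_meanTC f : complex.Re (meanTC f) = meanT (fun z => complex.Re (f z)).
Proof. by []. Qed.

Lemma Im_meanTC f : complex.Im (meanTC f) = meanT (fun z => complex.Im (f z)).
Proof. by []. Qed.

Lemma meanTC_cst c : meanTC (fun=> c) = c.
Proof. by rewrite /meanTC !meanT_cst; case: c. Qed.

Lemma meanTC_real k : meanTC (fun z => (k z)%:C) = (meanT k)%:C.
Proof. by rewrite /meanTC /= meanT_cst. Qed.

Lemma meanTCD f g : L1 f -> L1 g -> meanTC (fun z => f z + g z) = meanTC f + meanTC g.
Proof.
move=> /L1P[f1 f2] /L1P[g1 g2]; apply: complex_ext.
  rewrite cReD !Re_meanTC -meanTD//; apply: meanT_ae; apply: aeT_all => z _; exact: cReD.
rewrite cImD !Im_meanTC -meanTD//; apply: meanT_ae; apply: aeT_all => z _; exact: cImD.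
Qed.

Lemma meanTCZ c f : L1 f -> meanTC (fun z => c * f z) = c * meanTC f.
Proof.
move=> /L1P[f1 f2]; apply: complex_ext.
  rewrite cReM !Re_meanTC !Im_meanTC -!meanTZ// -meanTB; [|exact: aeintZ..].
  by apply: meanT_ae; apply: aeT_all => z _; exact: cReM.
rewrite cImM !Re_meanTC !Im_meanTC -!meanTZ// -meanTD; [|exact: aeintZ..].
by apply: meanT_ae; apply: aeT_all => z _; exact: cImM.
Qed.

Lemma meanTCN f : L1 f -> meanTC (fun z => - f z) = - meanTC f.
Proof.
move=> i; rewrite -mulN1r -meanTCZ//; apply: meanTC_ae.
by apply: aeT_all => z _; rewrite mulN1r.
Qed.

Lemma meanTCB f g : L1 f -> L1 g -> meanTC (fun z => f z - g z) = meanTC f - meanTC g.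
Proof. by move=> i j; rewrite meanTCD ?meanTCN//; exact: L1N. Qed.

Lemma meanTC_sum (I : Type) (r : seq I) (F : I -> C -> C) :
  (forall i, L1 (F i)) -> meanTC (fun z => \sum_(i <- r) F i z) = \sum_(i <- r) meanTC (F i).
Proof.
move=> h; elim: r => [|i r IH].
  rewrite big_nil -[RHS](meanTC_cst 0); apply: meanTC_ae.
  by apply: aeT_all => z _; rewrite big_nil.
rewrite big_cons -IH -meanTCD//; last exact: L1_sum.
by apply: meanTC_ae; apply: aeT_all => z _; rewrite big_cons.
Qed.

Lemma meanTC_conj f : L1 f -> meanTC (fun z => (f z)^*) = (meanTC f)^*.
Proof.
move=> /L1P[f1 f2]; apply: complex_ext.
  by rewrite cReJ !Re_meanTC; apply: meanT_ae; apply: aeT_all => z _; exact: cReJ.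
rewrite cImJ !Im_meanTC -meanTN//; apply: meanT_ae; apply: aeT_all => z _; exact: cImJ.
Qed.

Lemma meanTC_norm f : L1 f -> normc (meanTC f) <= meanT (fun z => normc (f z)).
Proof.
move=> Lf; have [mf i] := Lf.
have [->|m0] := eqVneq (meanTC f) 0.
  by rewrite normc0; apply: meanT_ge0; apply: aeT_all => z _; exact: normc_ge0.
have n0 : 0 < normc (meanTC f) by rewrite normc_gt0.
(* Rotation by this unimodular constant makes the mean equal to its modulus, so only the real part
   of the integrand must be estimated. *)
pose u := (meanTC f)^* / (normc (meanTC f))%:C.
have nu : normc u = 1.
  by rewrite normcM normc_conj normcV normc_real ger0_norm ?normc_ge0// divff// gt_eqF.
have : meanTC (fun z => u * f z) = (normc (meanTC f))%:C.
  rewrite meanTCZ// /u mulrAC [_^* * _]mulrC mulcJ expr2 rmorphM /= mulfK//.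
  by rewrite -(rmorph0 (real_complex R)) (inj_eq (@complexI R)) gt_eqF.
move/(congr1 (@complex.Re R)) => /= <-; rewrite /meanTC /=.
have /L1P[iu _] := L1Z u Lf; apply: meanT_le => //.
apply: aeT_all => z _; apply: le_trans (ler_norm _) _; apply: le_trans (ler_Re _) _.
by rewrite normcM nu mul1r.
Qed.

Lemma meanTC_dominated (f_ : nat -> C -> C) f k : (forall n, measT (f_ n)) ->
  aeint k -> (forall n, aeT (fun z => normc (f_ n z) <= k z)) ->
  aeT (fun z => (fun n => f_ n z : C^o) @ \oo --> (f z : C^o)) ->
  L1 f /\ (fun n => meanTC (f_ n) : C^o) @ \oo --> (meanTC f : C^o).
Proof.
move=> mf ik fk cv.
have [i1 c1] : aeint (fun z => complex.Re (f z)) /\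
    meanT (fun z => complex.Re (f_ n z)) @[n --> \oo] --> meanT (fun z => complex.Re (f z)).
  apply: (@meanT_dominated _ _ _ k) => //.
  - by move=> n; case/measurableTP: (mf n).
  - by move=> n; apply: aeT_mono (fk n) => z _; apply: le_trans; exact: ler_Re.
  - by apply: aeT_mono cv => z _; exact: cvgC_Re.
have [i2 c2] : aeint (fun z => complex.Im (f z)) /\
    meanT (fun z => complex.Im (f_ n z)) @[n --> \oo] --> meanT (fun z => complex.Im (f z)).
  apply: (@meanT_dominated _ _ _ k) => //.
  - by move=> n; case/measurableTP: (mf n).
  - by move=> n; apply: aeT_mono (fk n) => z _; apply: le_trans; exact: ler_Im.
  - by apply: aeT_mono cv => z _; exact: cvgC_Im.
by split; [apply/L1P|apply: cvgC_ReIm].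
Qed.

Lemma L2P f : L2 f <-> measT f /\ aeint (fun z => normc (f z) ^+ 2).
Proof.
split=> -[mf h]; split => //.
  have [g [mg fg]] := aemeas_normc2 mf.
  exists (fun z => Num.max (g z) 0); split; last first.
    by apply: aeT_mono fg => z _ e; rewrite -e max_l// sqr_ge0.
  apply/integrableP; split.
    by apply/measurable_EFinP; exact: measurable_maxr.
  rewrite (le_lt_trans _ h)// le_eqVlt; apply/orP; left; apply/eqP.
  apply: ae_eq_integral_any; move: fg; rewrite /aeT; apply: filterS => t e D.
  by rewrite e//= ger0_norm ?le_max ?lexx ?orbT// max_l// -e// sqr_ge0.
have [g [ig fg]] := h.
rewrite (@ae_eq_integral_any _ _ _ _ _ _ (fun t : measurableTypeR R => (g (cis t))%:E)).
  exact: (@integrable_lty _ (measurableTypeR R) _ _ _ (measurable_arcT) _ ig).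
by move: fg; rewrite /aeT; apply: filterS => t e D; rewrite e.
Qed.

Lemma L2_measT f : L2 f -> measT f. Proof. by move=> /L2P[]. Qed.

Lemma L2_int f : L2 f -> aeint (fun z => normc (f z) ^+ 2).
Proof. by move=> /L2P[]. Qed.

Lemma L2_le f k : measT f -> aeint k -> aeT (fun z => normc (f z) ^+ 2 <= k z) -> L2 f.
Proof.
move=> mf ik fk; apply/L2P; split => //; apply: aeint_le (aemeas_normc2 mf) ik _.
by apply: aeT_mono fk => z _; rewrite ger0_norm ?sqr_ge0.
Qed.

Lemma L2_ae f g : aeT (fun z => f z = g z) -> L2 g -> L2 f.
Proof.
move=> fg Lg; apply: L2_le (L2_int Lg) _.
  exact: measurableT_ae fg (L2_measT Lg).
by apply: aeT_mono fg => z _ ->.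
Qed.

Lemma L2_mul_le f (g : C -> C) (M : R) : measT f -> L2 g ->
  aeT (fun z => normc (f z) <= M * normc (g z)) -> L2 f.
Proof.
move=> mf Lg h; apply: L2_le mf (aeintZ (M ^+ 2) (L2_int Lg)) _.
apply: aeT_mono h => z _ h; rewrite -exprMn ler_sqr ?nnegrE ?normc_ge0//.
exact: le_trans (normc_ge0 _) h.
Qed.

Lemma L2_bounded_mul f g (M : R) : measT f -> aeT (fun z => normc (f z) <= M) ->
  L2 g -> L2 (fun z => f z * g z).
Proof.
move=> mf fM Lg; apply: (@L2_mul_le _ g M) => //.
  exact: measurableTM mf (L2_measT Lg).
by apply: aeT_mono fM => z _ h; rewrite normcM ler_wpM2r// normc_ge0.
Qed.

Lemma L2_bounded f (M : R) : measT f -> aeT (fun z => normc (f z) <= M) -> L2 f.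
Proof.
move=> mf fM; apply: L2_le mf (aeint_cst (M ^+ 2)) _.
apply: aeT_mono fM => z _ h; rewrite ler_sqr ?nnegrE ?normc_ge0//.
exact: le_trans (normc_ge0 _) h.
Qed.

Lemma L2_cst c : L2 (fun=> c).
Proof. by apply: (@L2_bounded _ (normc c)); [exact: measurableT_cst|exact: aeT_all]. Qed.

Lemma L2Z c f : L2 f -> L2 (fun z => c * f z).
Proof.
by apply: (@L2_bounded_mul _ _ (normc c)); [exact: measurableT_cst|exact: aeT_all].
Qed.

Lemma L2N f : L2 f -> L2 (fun z => - f z).
Proof. by move=> /(L2Z (-1)); apply: L2_ae; apply: aeT_all => z _; rewrite mulN1r. Qed.

Lemma L2_conj f : L2 f -> L2 (fun z => (f z)^*).
Proof.
move=> Lf; apply: (@L2_mul_le _ f 1) => //; first exact: measurableT_conj (L2_measT Lf).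
by apply: aeT_all => z _; rewrite normc_conj mul1r.
Qed.

Lemma normcD_sqr z w : normc (z + w) ^+ 2 <= 2 * normc z ^+ 2 + 2 * normc w ^+ 2.
Proof.
have := le_normcD z w; have := normc_ge0 z; have := normc_ge0 w.
have := normc_ge0 (z + w) => ? ? ? ?.
apply: (@le_trans _ _ ((normc z + normc w) ^+ 2)).
  by rewrite ler_sqr ?nnegrE ?addr_ge0 ?normc_ge0.
by have := sqr_ge0 (normc z - normc w); nra.
Qed.

Lemma L2D f g : L2 f -> L2 g -> L2 (fun z => f z + g z).
Proof.
move=> Lf Lg; apply: (@L2_le _ (fun z => 2 * normc (f z) ^+ 2 + 2 * normc (g z) ^+ 2)).
- exact: measurableTD (L2_measT Lf) (L2_measT Lg).
- by apply: aeintD; apply: aeintZ; exact: L2_int.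
by apply: aeT_all => z _; exact: normcD_sqr.
Qed.

Lemma L2B f g : L2 f -> L2 g -> L2 (fun z => f z - g z).
Proof. by move=> Lf Lg; exact: L2D Lf (L2N Lg). Qed.

Lemma aeint_L2M f g : L2 f -> L2 g -> aeint (fun z => normc (f z) * normc (g z)).
Proof.
move=> Lf Lg; apply: (@aeint_le _ _ (fun z => normc (f z) ^+ 2 + normc (g z) ^+ 2)).
- exact: aemeasM (aemeas_normc (L2_measT Lf)) (aemeas_normc (L2_measT Lg)).
- by apply: aeintD; exact: L2_int.
apply: aeT_all => z _; have := normc_ge0 (f z); have := normc_ge0 (g z) => ? ?.
rewrite ger0_norm ?mulr_ge0//; nra.
Qed.

Lemma L1_L2M f g : L2 f -> L2 g -> L1 (fun z => f z * g z).
Proof.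
move=> Lf Lg; split; first exact: measurableTM (L2_measT Lf) (L2_measT Lg).
by apply: aeint_ae (aeint_L2M Lf Lg); apply: aeT_all => z _; rewrite normcM.
Qed.

Lemma L2_L1 f : L2 f -> L1 f.
Proof.
move=> Lf; apply: L1_ae (L1_L2M Lf (L2_cst 1)).
by apply: aeT_all => z _; rewrite mulr1.
Qed.

Definition sqnorm2 f : R := meanT (fun z => normc (f z) ^+ 2).

Lemma sqnorm2_ge0 f : 0 <= sqnorm2 f.
Proof. by apply: meanT_ge0; apply: aeT_all => z _; exact: sqr_ge0. Qed.

Lemma meanT_CauchySchwarz f g : L2 f -> L2 g ->
  meanT (fun z => normc (f z) * normc (g z)) <= Num.sqrt (sqnorm2 f) * Num.sqrt (sqnorm2 g).
Proof.
move=> Lf Lg; set m := meanT _; set a := sqnorm2 f; set b := sqnorm2 g.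
have a0 : 0 <= a := sqnorm2_ge0 f; have b0 : 0 <= b := sqnorm2_ge0 g.
have m0 : 0 <= m.
  by apply: meanT_ge0; apply: aeT_all => z _; rewrite mulr_ge0// normc_ge0.
(* This polynomial in [s] is the mean of [(s |f| - |g|)^2]; the inequality is the sign of its
   discriminant. *)
have quad (s : R) : 0 <= a * s ^+ 2 - 2 * s * m + b.
  have -> : a * s ^+ 2 - 2 * s * m + b =
      meanT (fun z => s ^+ 2 * normc (f z) ^+ 2 + ((- (2 * s)) * (normc (f z) * normc (g z)) + normc (g z) ^+ 2)).
    rewrite !(meanTD, meanTZ); rewrite -/a -/b -/m; do ?[exact: L2_int|exact: aeint_L2M|
      exact: aeintZ (L2_int _)|exact: aeintZ (aeint_L2M _ _)|apply: aeintD].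
    by rewrite -/(sqnorm2 f) -/(sqnorm2 g) -/a -/b; ring.
  apply: meanT_ge0; apply: aeT_all => z _.
  have -> : s ^+ 2 * normc (f z) ^+ 2 + ((- (2 * s)) * (normc (f z) * normc (g z)) + normc (g z) ^+ 2) = (s * normc (f z) - normc (g z)) ^+ 2 by ring.
  exact: sqr_ge0.
rewrite -sqrtrM// -(ger0_norm m0) -sqrtr_sqr ler_wsqrtr//.
have [a_eq0|a_neq0] := eqVneq a 0.
  have [m_eq0|m_neq0] := eqVneq m 0; first by rewrite m_eq0 expr0n /= mulr_ge0.
  (* For [a = 0] the polynomial is affine, and at this [s] its value is -1, which excludes
     [m != 0]. *)
  have := quad ((b + 1) / (2 * m)); rewrite a_eq0 mul0r add0r mul0r.
  have -> : 2 * ((b + 1) / (2 * m)) * m = b + 1 by field.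
  lra.
have a_gt0 : 0 < a by rewrite lt_neqAle eq_sym a_neq0.
have := quad (m / a).
have -> : a * (m / a) ^+ 2 - 2 * (m / a) * m + b = b - m ^+ 2 / a by field.
by rewrite subr_ge0 ler_pdivrMr// mulrC.
Qed.

(** This carries identities for products from polynomials to H^2, where a product is only in L^1.
    The difference of products splits as [(a_ - a)(b_ - b) + (a_ - a) b + a (b_ - b)], and
    Cauchy-Schwarz bounds each term. *)
Lemma meanTC_L2M_cvg (a_ b_ : nat -> C -> C) (a b h : C -> C) (M : R) :
  (forall n, L2 (a_ n)) -> (forall n, L2 (b_ n)) -> L2 a -> L2 b ->
  sqnorm2 (fun z => a_ n z - a z) @[n --> \oo] --> (0 : R) ->
  sqnorm2 (fun z => b_ n z - b z) @[n --> \oo] --> (0 : R) ->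
  measT h -> aeT (fun z => normc (h z) <= M) ->
  (fun n => meanTC (fun z => h z * (a_ n z * b_ n z)) : C^o) @ \oo -->
    (meanTC (fun z => h z * (a z * b z)) : C^o).
Proof.
move=> La_ Lb_ La Lb ca cb mh hM.
have Ld n : L2 (fun z => a_ n z - a z) by exact: L2B.
have Le n : L2 (fun z => b_ n z - b z) by exact: L2B.
have sq0 (u : nat -> R) : u @ \oo --> (0 : R) -> (fun n => Num.sqrt (u n)) @ \oo --> (0 : R).
  by move=> h0; rewrite -(sqrtr0 R); apply: continuous_cvg => //; exact: sqrt_continuous.
apply: (@cvgC_dist_le _ _ _ _ _ (fun n => M * (Num.sqrt (sqnorm2 (fun z => a_ n z - a z)) * Num.sqrt (sqnorm2 (fun z => b_ n z - b z)) +
   (Num.sqrt (sqnorm2 (fun z => a_ n z - a z)) * Num.sqrt (sqnorm2 b) + Num.sqrt (sqnorm2 a) * Num.sqrt (sqnorm2 (fun z => b_ n z - b z)))))); last first.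
  rewrite -(mulr0 M); apply: cvgMr; rewrite -[X in _ --> X]addr0; apply: cvgD.
    by rewrite -[X in _ --> X](mulr0 0); apply: cvgM; exact: sq0.
  rewrite -[X in _ --> X]addr0; apply: cvgD.
    by rewrite -[X in _ --> X](mul0r (Num.sqrt (sqnorm2 b))); apply: cvgMl; exact: sq0.
  by rewrite -[X in _ --> X](mulr0 (Num.sqrt (sqnorm2 a))); apply: cvgMr; exact: sq0.
apply: nearW => n.
(* A negative bound [M] would make every property hold almost everywhere, and then all means are
   0. *)
have M0 : 0 <= M \/ aeT (fun _ : C => False).
  have [?|M0] := leP 0 M; [by left|right].
  by apply: aeT_mono hM => z _ h1; have := normc_ge0 (h z); rewrite leNgt (le_lt_trans h1).
have L1a : L1 (fun z => h z * (a_ n z * b_ n z)) by exact: L1_bounded_mul mh hM (L1_L2M _ _).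
have L1b : L1 (fun z => h z * (a z * b z)) by exact: L1_bounded_mul mh hM (L1_L2M _ _).
rewrite -meanTCB//; apply: le_trans (meanTC_norm (L1B L1a L1b)) _.
have i1 := aeint_L2M (Ld n) (Le n); have i2 := aeint_L2M (Ld n) Lb; have i3 := aeint_L2M La (Le n).
apply: (@le_trans _ _ (meanT (fun z => M * (normc (a_ n z - a z) * normc (b_ n z - b z) +
   (normc (a_ n z - a z) * normc (b z) + normc (a z) * normc (b_ n z - b z)))))).
  apply: meanT_le.
  - by case: (L1B L1a L1b).
  - by apply: aeintZ; apply: aeintD => //; exact: aeintD.
  apply: aeT_mono hM => z _ h1; rewrite -mulrBr normcM.
  apply: ler_pM; rewrite ?normc_ge0//.
  have -> : a_ n z * b_ n z - a z * b z = (a_ n z - a z) * (b_ n z - b z) +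
    ((a_ n z - a z) * b z + a z * (b_ n z - b z)) by ring.
  apply: le_trans (le_normcD _ _) _; rewrite normcM lerD2l.
  by apply: le_trans (le_normcD _ _) _; rewrite !normcM.
rewrite meanTZ; last by apply: aeintD => //; exact: aeintD.
case: M0 => [M0|F].
  rewrite ler_wpM2l// meanTD//; last exact: aeintD.
  apply: lerD; first exact: meanT_CauchySchwarz.
  by rewrite meanTD//; apply: lerD; exact: meanT_CauchySchwarz.
have Fm k : meanT k = 0.
  by rewrite -(meanT_cst 0); apply: meanT_ae; apply: aeT_mono F.
by rewrite /sqnorm2 !Fm sqrtr0; lra.
Qed.

End complex_mean.

(** * Holomorphic functions and the mean value property *)

Section derivable_eps.
Context {K : numFieldType}.
Implicit Types (f : K -> K) (z w D : K).

Lemma derivable_eps f z : derivable (f : K^o -> K^o) z 1 ->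
  exists D, forall e, 0 < e -> exists2 d, 0 < d &
    forall w, `|w - z| < d -> `|f w - f z - D * (w - z)| <= e * `|w - z|.
Proof.
move=> df; exists ('D_1 (f : K^o -> K^o) z) => e e0.
have /cvgrPdist_le /(_ _ e0) := df.
rewrite near_withinE => /nbhs_ballP[d /= d0 h]; exists d => // w wd.
have [->|wz] := eqVneq w z; first by rewrite !subrr mulr0 subrr normr0 mulr0.
have wz0 : w - z != 0 by rewrite subr_eq0.
have := h (w - z); rewrite /ball /= sub0r normrN => /(_ wd wz0).
rewrite -[(w - z) *: 1]/((w - z) * 1) mulr1 subrK -[_ *: _]/(_ * _) => {}h.
have -> : f w - f z - 'D_1 (f : K^o -> K^o) z * (w - z) =
    ((w - z)^-1 * (f w - f z) - 'D_1 (f : K^o -> K^o) z) * (w - z).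
  by rewrite mulrBl mulrAC mulVf// mul1r.
by rewrite normrM ler_wpM2r// distrC.
Qed.

Lemma eps_derivable f z D : (forall e, 0 < e -> exists2 d, 0 < d &
    forall w, `|w - z| < d -> `|f w - f z - D * (w - z)| <= e * `|w - z|) ->
  derivable (f : K^o -> K^o) z 1.
Proof.
move=> h; apply/cvg_ex; exists (D : K^o); apply/cvgrPdist_le => e e0.
have [d d0 {}h] := h _ e0; rewrite near_withinE; apply/nbhs_ballP; exists d => // w /=.
rewrite /ball /= sub0r normrN => wd w0.
have := h (w + z); rewrite addrK => /(_ wd) {}h.
rewrite -[w *: 1]/(w * 1) mulr1 -[_ *: _]/(_ * _).
have -> : D - w^-1 * (f (w + z) - f z) = - ((f (w + z) - f z - D * w) / w).
  by rewrite mulrBl mulfK// mulrC opprB.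
by rewrite normrN normrM normfV ler_pdivrMr// normr_gt0.
Qed.

End derivable_eps.

Section holo.
Context {R : realType}.
Local Notation C := R[i].
Implicit Types (f g : C -> C) (z w c : C).

Definition holo f z := derivable (f : C^o -> C^o) z 1.

Lemma holo_eps f z : holo f z -> exists D, forall e : R, 0 < e ->
  exists2 d : R, 0 < d & forall w, normc (w - z) < d ->
    normc (f w - f z - D * (w - z)) <= e * normc (w - z).
Proof.
move=> /derivable_eps[D h]; exists D => e e0.
have [d d0 {}h] := h e%:C ltac:(by rewrite ltcR).
have [de d0'] : d = (complex.Re d)%:C /\ 0 < complex.Re d.
  by move: d0; case: (d) => a b; rewrite ltcE /= => /andP[/eqP -> ->].
exists (complex.Re d) => // w wd.
have := h w; rewrite de !normCE ltcR => /(_ wd).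
by rewrite -rmorphM /= lecR.
Qed.

Lemma eps_holo f z D : (forall e : R, 0 < e ->
  exists2 d : R, 0 < d & forall w, normc (w - z) < d ->
    normc (f w - f z - D * (w - z)) <= e * normc (w - z)) -> holo f z.
Proof.
move=> h; apply: (@eps_derivable _ _ _ D) => e e0.
have [ee e0'] : e = (complex.Re e)%:C /\ 0 < complex.Re e.
  by move: e0; case: (e) => a b; rewrite ltcE /= => /andP[/eqP -> ->].
have [d d0 {}h] := h _ e0'; exists d%:C; first by rewrite ltcR.
move=> w; rewrite ee !normCE ltcR => /h.
by rewrite -rmorphM /= lecR.
Qed.

(** A quadratic remainder is what an explicit expansion of the Cauchy kernel provides; it replaces
    differentiation under the integral sign. *)
Lemma quadratic_holo f z D (M d : R) : 0 < d ->
  (forall w, normc (w - z) < d -> normc (f w - f z - D * (w - z)) <= M * normc (w - z) ^+ 2) ->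
  holo f z.
Proof.
move=> d0 h; apply: (@eps_holo _ _ D) => e e0.
exists (Num.min d (e / (`|M| + 1))).
  by rewrite lt_min d0 divr_gt0// ltr_wpDl.
move=> w; rewrite lt_min ltr_pdivlMr ?ltr_wpDl// => /andP[wd we].
apply: le_trans (h _ wd) _; rewrite expr2 mulrA ler_wpM2r ?normc_ge0//.
have := normc_ge0 (w - z); have := ler_norm M; nra.
Qed.

Lemma holo_cst c z : holo (fun=> c) z.
Proof. exact: (@derivable_cst _ _ _ (c : C^o)). Qed.

Lemma holo_id z : holo (fun w => w) z.
Proof. exact: derivable_id. Qed.

Lemma holoD f g z : holo f z -> holo g z -> holo (fun w => f w + g w) z.
Proof. exact: derivableD. Qed.

Lemma holoN f z : holo f z -> holo (fun w => - f w) z.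
Proof. exact: derivableN. Qed.

Lemma holoB f g z : holo f z -> holo g z -> holo (fun w => f w - g w) z.
Proof. exact: derivableB. Qed.

Lemma holoM f g z : holo f z -> holo g z -> holo (fun w => f w * g w) z.
Proof. exact: derivableM. Qed.

Lemma holoV f z : f z != 0 -> holo f z -> holo (fun w => (f w)^-1) z.
Proof. exact: derivableV. Qed.

Lemma holoX f n z : holo f z -> holo (fun w => f w ^+ n) z.
Proof.
move=> h; elim: n => [|n IH]; first exact: holo_cst.
have -> : (fun w => f w ^+ n.+1) = (fun w => f w * f w ^+ n).
  by apply/funext => w; rewrite exprS.
exact: holoM.
Qed.

Lemma holo_comp f g z : holo f z -> holo g (f z) -> holo (g \o f) z.
Proof.
move=> /derivable1_diffP hf /derivable1_diffP hg; apply/derivable1_diffP.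
exact: (differentiable_comp hf hg).
Qed.

Lemma holo_sum (I : Type) (r : seq I) (F : I -> C -> C) z :
  (forall i, holo (F i) z) -> holo (fun w => \sum_(i <- r) F i w) z.
Proof.
move=> h; elim: r => [|i r IH].
  have -> : (fun w => \sum_(i <- [::]) F i w) = (fun=> 0).
    by apply/funext => w; rewrite big_nil.
  exact: holo_cst.
have -> : (fun w => \sum_(j <- i :: r) F j w) = (fun w => F i w + \sum_(j <- r) F j w).
  by apply/funext => w; rewrite big_cons.
exact: (holoD (h i) IH).
Qed.

Lemma holo_continuous f z : holo f z -> (f : C^o -> C^o) @ (z : C^o) --> (f z : C^o).
Proof. by move=> /derivable1_diffP h; exact: differentiable_continuous. Qed.

Lemma near_eq_holo f g z (d : R) : 0 < d -> (forall w, normc (w - z) < d -> f w = g w) ->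
  holo f z -> holo g z.
Proof.
move=> d0 fg /holo_eps[D h]; apply: (@eps_holo _ _ D) => e e0.
have [d' d'0 {}h] := h _ e0; exists (Num.min d d'); first by rewrite lt_min d0.
move=> w; rewrite lt_min => /andP[w1 w2]; rewrite -!fg ?subrr ?normc0//.
exact: h.
Qed.

Lemma real_eps (f : R -> R) (x D : R) : is_derive (x : R^o) (1 : R^o) (f : R^o -> R^o) D ->
  forall e : R, 0 < e -> exists2 d : R, 0 < d &
    forall y, `|y - x| < d -> `|f y - f x - D * (y - x)| <= e * `|y - x|.
Proof.
move=> dfx e e0; have /cvgrPdist_le /(_ _ e0) := @ex_derive _ _ _ _ _ _ _ dfx.
have := @derive_val _ _ _ _ _ _ _ dfx; rewrite /derive => ->.
rewrite near_withinE => /nbhs_ballP[d /= d0 h]; exists d => // w wd.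
have [->|wz] := eqVneq w x; first by rewrite !subrr mulr0 subrr normr0 mulr0.
have wz0 : w - x != 0 by rewrite subr_eq0.
have := h (w - x); rewrite /ball /= sub0r normrN => /(_ wd wz0).
rewrite -[(w - x) *: 1]/((w - x) * 1) mulr1 subrK -[_ *: _]/(_ * _) => {}h.
have -> : f w - f x - D * (w - x) = ((w - x)^-1 * (f w - f x) - D) * (w - x).
  by rewrite mulrBl mulrAC mulVf// mul1r.
by rewrite normrM ler_wpM2r// distrC.
Qed.

Lemma cisD (s t : R) : cis (s + t) = cis s * cis t.
Proof. by apply: complex_ext; rewrite ?cReM ?cImM /cis /= ?cosD ?sinD//; ring. Qed.

Lemma expCD z w : expC (z + w) = expC z * expC w.
Proof.
rewrite /expC cReD cImD expRD cisD rmorphM /=; ring.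
Qed.

Lemma expC0 : expC (0 : C) = 1.
Proof. by rewrite /expC /= expR0 /cis cos0 sin0 mul1r. Qed.

Lemma normc_expC z : normc (expC z) = expR (complex.Re z).
Proof. by rewrite /expC normcM normc_cis mulr1 normc_real ger0_norm ?expR_ge0. Qed.

Lemma expC_neq0 z : expC z != 0.
Proof. by rewrite -normc_eq0 normc_expC gt_eqF ?expR_gt0. Qed.

Lemma holo_expC0 : holo expC (0 : C).
Proof.
apply: (@eps_holo _ _ 1) => e e0.
(* The error bounds add up to [7 * (e / 8) * n]: three terms in the real part, three in the
   imaginary part, of which [x * sin y] counts twice. *)
have e8 : 0 < e / 8 by rewrite divr_gt0.
have [d1 d10 h1] := real_eps (is_derive_expR (0 : R)) e8.
have [d2 d20 h2] := real_eps (is_derive_cos (0 : R)) e8.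
have [d3 d30 h3] := real_eps (is_derive_sin (0 : R)) e8.
exists (Num.min (Num.min d1 d2) (Num.min d3 (Num.min 1 (e / 8)))).
  by rewrite !lt_min d10 d20 d30 e8 ltr01.
move=> [x y]; rewrite !subr0 mul1r expC0 !lt_min => /andP[/andP[n1 n2] /andP[n3 /andP[n4 n5]]].
have xn : `|x| <= normc (x +i* y) := ler_Re (x +i* y).
have yn : `|y| <= normc (x +i* y) := ler_Im (x +i* y).
set n := normc (x +i* y) in n1 n2 n3 n4 n5 xn yn *.
have := h1 x; rewrite subr0 expR0 mul1r => /(_ (le_lt_trans xn n1)) {}h1.
have := h2 y; rewrite subr0 cos0 sin0 oppr0 mul0r subr0 => /(_ (le_lt_trans yn n2)) {}h2.
have := h3 y; rewrite subr0 cos0 sin0 subr0 mul1r => /(_ (le_lt_trans yn n3)) {}h3.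
have n0 : 0 <= n by exact: normc_ge0.
apply: le_trans (normc_leReIm _) _.
rewrite /expC /cis /=.
have -> : expR x * cos y - 0 * sin y - 1 - x =
  (expR x - 1 - x) * cos y + x * (cos y - 1) + (cos y - 1) by ring.
have -> : expR x * sin y + 0 * cos y - 0 - y =
  (expR x - 1 - x) * sin y + x * sin y + (sin y - y) by ring.
have cy : `|cos y| <= 1 by rewrite ler_norml cos_geN1 cos_le1.
have sy : `|sin y| <= 1 by rewrite ler_norml sin_geN1 sin_le1.
have bnd (a b c u v : R) : `|a| <= u -> `|b| <= v -> 0 <= c -> u * v <= c -> `|a * b| <= c.
  by move=> ha hb c0 uv; rewrite normrM; apply: le_trans uv; apply: ler_pM.
have t1 : `|(expR x - 1 - x) * cos y| <= e / 8 * n.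
  apply: (bnd _ _ _ (e / 8 * n) 1) => //; last by rewrite mulr1.
    by apply: le_trans h1 _; rewrite ler_wpM2l// ltW.
  by rewrite mulr_ge0// ltW.
have t2 : `|(expR x - 1 - x) * sin y| <= e / 8 * n.
  apply: (bnd _ _ _ (e / 8 * n) 1) => //; last by rewrite mulr1.
    by apply: le_trans h1 _; rewrite ler_wpM2l// ltW.
  by rewrite mulr_ge0// ltW.
have c1 : `|cos y - 1| <= e / 8 * n by apply: le_trans h2 _; rewrite ler_wpM2l// ltW.
have s1 : `|sin y - y| <= e / 8 * n by apply: le_trans h3 _; rewrite ler_wpM2l// ltW.
have en0 : 0 <= e / 8 * n by rewrite mulr_ge0// ltW.
have t3 : `|x * (cos y - 1)| <= e / 8 * n.
  apply: (bnd _ _ _ 1 (e / 8 * n)) => //; last by rewrite mul1r.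
  by apply: le_trans xn _; exact: ltW.
have t4 : `|x * sin y| <= e / 8 * n * 2.
  have -> : x * sin y = x * (sin y - y) + x * y by ring.
  apply: le_trans (ler_normD _ _) _.
  have : `|x * (sin y - y)| <= e / 8 * n.
    apply: (bnd _ _ _ 1 (e / 8 * n)) => //; last by rewrite mul1r.
    by apply: le_trans xn _; exact: ltW.
  have : `|x * y| <= e / 8 * n.
    apply: (bnd _ _ _ (e / 8) n) => //.
    by apply: le_trans xn _; exact: ltW.
  lra.
have := ler_normD ((expR x - 1 - x) * cos y + x * (cos y - 1)) (cos y - 1).
have := ler_normD ((expR x - 1 - x) * cos y) (x * (cos y - 1)).
have := ler_normD ((expR x - 1 - x) * sin y + x * sin y) (sin y - y).
have := ler_normD ((expR x - 1 - x) * sin y) (x * sin y).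
lra.
Qed.

Lemma holo_expC z : holo expC z.
Proof.
have -> : expC = (fun w : C => expC z * expC (w - z)).
  by apply/funext => w; rewrite -expCD addrC subrK.
apply: holoM; first exact: holo_cst.
apply: (@holo_comp (fun w => w - z) expC).
  by apply: holoB; [exact: holo_id|exact: holo_cst].
by rewrite subrr; exact: holo_expC0.
Qed.

End holo.

(** * Goursat's theorem and the mean value property *)

Section goursat.
Context {R : realType}.
Local Notation C := R[i].
Local Notation mu := (@lebesgue_measure R).

(** Goursat's bisection for an abstract additive function of rectangles. If [I a b h k] were
    nonzero, some quarter would always keep [normc I] above a fixed multiple of [(u + v) ^+ 2]; the
    nested quarters shrink to a point, where the local hypothesis forbids this. *)
Lemma bisection_zero (I : R -> R -> R -> R -> C) (a b h k : R) : 0 < h -> 0 < k ->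
  (forall x y u v, 0 < u -> 0 < v -> a <= x -> x + u <= a + h -> b <= y -> y + v <= b + k ->
    I x y u v = I x y (u / 2) (v / 2) + I (x + u / 2) y (u / 2) (v / 2) +
      I x (y + v / 2) (u / 2) (v / 2) + I (x + u / 2) (y + v / 2) (u / 2) (v / 2)) ->
  (forall x y, a <= x <= a + h -> b <= y <= b + k -> forall e, 0 < e ->
    exists2 d, 0 < d & forall x' y' u v, 0 < u -> 0 < v ->
      x' <= x <= x' + u -> y' <= y <= y' + v ->
      a <= x' -> x' + u <= a + h -> b <= y' -> y' + v <= b + k ->
      u + v < d -> normc (I x' y' u v) <= e * (u + v) ^+ 2) ->
  I a b h k = 0.
Proof.
move=> h0 k0 addI locI; apply/eqP; rewrite -normc_eq0; apply: contrapT => /negP I0.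
have {}I0 : 0 < normc (I a b h k) by rewrite lt_neqAle eq_sym I0 normc_ge0.
(* Half of the initial ratio, so that the first rectangle satisfies the strict inequality. Halving
   the sides divides [c * (u + v) ^+ 2] by 4, matching the number of quarters. *)
pose c := normc (I a b h k) / (2 * (h + k) ^+ 2).
have hk0 : 0 < h + k by rewrite addr_gt0.
have c0 : 0 < c by rewrite divr_gt0// mulr_gt0// exprn_gt0.
pose Q (p : R * R * R * R) := let: (x, y, u, v) := p in
  [/\ 0 < u, 0 < v, a <= x /\ x + u <= a + h, b <= y /\ y + v <= b + k &
   c * (u + v) ^+ 2 < normc (I x y u v)].
pose S := {p | Q p}.
pose Rl (s s' : S) := let: (x, y, u, v) := sval s in let: (x', y', u', v') := sval s' in
  [/\ u' = u / 2, v' = v / 2, x <= x' /\ x' + u' <= x + u & y <= y' /\ y' + v' <= y + v].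
have step (s : S) : {s' : S | Rl s s'}.
  apply: cid; case: s => [[[[x y] u] v]] q; have [u0 v0 [x1 x2] [y1 y2] Ic] := q.
  have u20 : 0 < u / 2 by lra.
  have v20 : 0 < v / 2 by lra.
  have : exists x' y', [/\ x <= x', x' + u / 2 <= x + u, y <= y', y' + v / 2 <= y + v &
      c * (u / 2 + v / 2) ^+ 2 < normc (I x' y' (u / 2) (v / 2))].
    apply: contrapT => H.
    have small x' y' : x <= x' -> x' + u / 2 <= x + u -> y <= y' -> y' + v / 2 <= y + v ->
        normc (I x' y' (u / 2) (v / 2)) <= c * (u / 2 + v / 2) ^+ 2.
      by move=> *; rewrite leNgt; apply/negP => ?; apply: H; exists x', y'.
    move: Ic; apply/negP; rewrite -leNgt (addI x y u v)//.
    have half (p w : R) : 0 < w / 2 ->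
        [/\ p <= p + w / 2, p + w / 2 <= p + w & p + w / 2 + w / 2 <= p + w].
      by clear; move=> w0; split; lra.
    have [xu1 xu2 xu3] := half x u u20; have [yv1 yv2 yv3] := half y v v20.
    have s1 := small _ _ xu1 xu3 yv1 yv3.
    have s2 := small _ _ (lexx x) xu2 yv1 yv3.
    have s3 := small _ _ xu1 xu3 (lexx y) yv2.
    have s4 := small _ _ (lexx x) xu2 (lexx y) yv2.
    apply: le_trans (le_normcD _ _) _.
    apply: le_trans (lerD (le_trans (le_normcD _ _) (lerD (le_trans (le_normcD _ _) (lerD s4 s3)) s2)) s1) _.
    by rewrite le_eqVlt; apply/orP; left; apply/eqP; field.
  move=> [x' [y' [e1 e2 e3 e4 e5]]].
  have q' : Q (x', y', u / 2, v / 2) by split => //; split; lra.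
  by exists (exist _ _ q').
have q0 : Q (a, b, h, k).
  split => //; rewrite /c.
  have -> : normc (I a b h k) / (2 * (h + k) ^+ 2) * (h + k) ^+ 2 = normc (I a b h k) / 2.
    by field; rewrite gt_eqF.
  lra.
have [f [f0 fS]] := dependent_choice step (exist _ _ q0).
pose x n := (sval (f n)).1.1.1; pose y n := (sval (f n)).1.1.2.
pose u n := (sval (f n)).1.2; pose v n := (sval (f n)).2.
have fQ n : [/\ 0 < u n, 0 < v n, a <= x n /\ x n + u n <= a + h, b <= y n /\ y n + v n <= b + k &
   c * (u n + v n) ^+ 2 < normc (I (x n) (y n) (u n) (v n))].
  by rewrite /x /y /u /v; case: (f n) => [[[[? ?] ?] ?]].
have fR n : [/\ u n.+1 = u n / 2, v n.+1 = v n / 2, x n <= x n.+1 /\ x n.+1 + u n.+1 <= x n + u n &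
    y n <= y n.+1 /\ y n.+1 + v n.+1 <= y n + v n].
  have := fS n; rewrite /Rl /x /y /u /v.
  by case: (f n) => [[[[? ?] ?] ?] ?]; case: (f n.+1) => [[[[? ?] ?] ?] ?].
(* The supremum of the left endpoints lies in all the nested intervals; this is applied to each
   coordinate. *)
have nested (w s : nat -> R) : (forall n, 0 < s n) ->
    (forall n, w n <= w n.+1 /\ w n.+1 + s n.+1 <= w n + s n) ->
    forall n, w n <= sup (range w) <= w n + s n.
  move=> s0 ws.
  have mono n m : (n <= m)%N -> w n <= w m /\ w m + s m <= w n + s n.
    elim: m => [|m IH]; first by rewrite leqn0 => /eqP ->.
    rewrite leq_eqVlt => /predU1P[->//|]; rewrite ltnS => /IH[i1 i2].
    by have [j1 j2] := ws m; split; lra.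
  have ub n m : w m <= w n + s n.
    have [nm|/ltnW mn] := leqP n m.
      by have [_] := mono _ _ nm; have := s0 m; lra.
    by have [+ _] := mono _ _ mn; have := s0 n; lra.
  move=> n; apply/andP; split.
    by apply: ub_le_sup; [exists (w n + s n) => _ [m _ <-]|exists n].
  by apply: ge_sup; [exists (w 0%N); exists 0%N|move=> _ [m _ <-]].
have hx := nested x u (fun n => let: And5 p _ _ _ _ := fQ n in p)
  (fun n => let: And4 _ _ p _ := fR n in p).
have hy := nested y v (fun n => let: And5 _ p _ _ _ := fQ n in p)
  (fun n => let: And4 _ _ _ p := fR n in p).
have [u00 v00 xa ya _] := fQ 0%N.
have [d d0 loc] : exists2 d, 0 < d & forall x' y' u v, 0 < u -> 0 < v ->
      x' <= sup (range x) <= x' + u -> y' <= sup (range y) <= y' + v ->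
      a <= x' -> x' + u <= a + h -> b <= y' -> y' + v <= b + k ->
      u + v < d -> normc (I x' y' u v) <= c * (u + v) ^+ 2.
  by apply: locI => //; have /andP[? ?] := hx 0%N; have /andP[? ?] := hy 0%N; lra.
have uv n : u n + v n = (h + k) / 2 ^+ n.
  elim: n => [|n IH]; first by rewrite /u /v f0 /= divr1.
  have [-> -> _ _] := fR n; rewrite -mulrDl IH exprS; field.
  by rewrite expf_neq0.
have [n hn] : exists n, (h + k) / 2 ^+ n < d.
  have [n nP] : exists n : nat, (h + k) / d < n%:R.
    by exists (Num.truncn ((h + k) / d)).+1; exact: truncnS_gt.
  exists n; rewrite ltr_pdivrMr ?exprn_gt0// mulrC -ltr_pdivrMr//.
  apply: lt_trans nP _; rewrite -natrX ltr_nat; exact: ltn_expl.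
have [n1 n2 [n3 n4] [n5 n6] n7] := fQ n.
have := loc (x n) (y n) (u n) (v n) n1 n2 (hx n) (hy n) n3 n4 n5 n6.
by rewrite uv => /(_ hn); rewrite -uv leNgt n7.
Qed.

Definition cint (a b : R) (F : R -> C) : C :=
  (\int[mu]_(t in `[a, b]) complex.Re (F t)) +i* (\int[mu]_(t in `[a, b]) complex.Im (F t)).

Definition ccont (a b : R) (F : R -> C) := forall t, a <= t <= b -> (F : R -> C^o) @ t --> (F t : C^o).

Lemma ccont_integrable a b F : ccont a b F ->
  mu.-integrable `[a, b] (EFin \o (fun t => complex.Re (F t))) /\
  mu.-integrable `[a, b] (EFin \o (fun t => complex.Im (F t))).
Proof.
move=> cF; split; apply: continuous_compact_integrable; try exact: segment_compact;
  apply: continuous_in_subspaceT => t; rewrite inE /= in_itv /= => /cF;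
  [exact: cvgC_Re|exact: cvgC_Im].
Qed.

Lemma cint_split a b c F : a <= b <= c -> ccont a c F ->
  cint a c F = cint a b F + cint b c F.
Proof.
move=> /andP[ab bc] /ccont_integrable[i1 i2].
have split1 (g : R -> R) : mu.-integrable `[a, c] (EFin \o g) ->
    \int[mu]_(t in `[a, c]) g t = \int[mu]_(t in `[a, b]) g t + \int[mu]_(t in `[b, c]) g t.
  move=> ig; rewrite -(@Rintegral_itv_obnd_cbnd _ b (BRight c)).
    by rewrite -(@Rintegral_itvB _ g (BLeft a) (BRight c) b)// addrC subrK.
  apply: integrableS ig => //.
  by move=> t /=; rewrite !in_itv /= => /andP[t1 ->]; rewrite (le_trans ab)// ltW.
by apply: complex_ext; rewrite ?cReD ?cImD /= split1.
Qed.

Lemma cintD a b F G : ccont a b F -> ccont a b G ->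
  cint a b (fun t => F t + G t) = cint a b F + cint a b G.
Proof.
move=> /ccont_integrable[i1 i2] /ccont_integrable[j1 j2]; apply: complex_ext.
  rewrite cReD /= -RintegralD//; apply: eq_Rintegral => t _; exact: cReD.
rewrite cImD /= -RintegralD//; apply: eq_Rintegral => t _; exact: cImD.
Qed.

Lemma ccontD a b F G : ccont a b F -> ccont a b G -> ccont a b (fun t => F t + G t).
Proof. by move=> cF cG t tab; apply: cvgCD; [exact: cF|exact: cG]. Qed.

Lemma ccontB a b F G : ccont a b F -> ccont a b G -> ccont a b (fun t => F t - G t).
Proof. by move=> cF cG t tab; apply: cvgCB; [exact: cF|exact: cG]. Qed.

(** The factor 2 comes from bounding the real and imaginary parts separately. *)
Lemma cint_norm a b F (M : R) : a <= b -> ccont a b F ->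
  (forall t, a <= t <= b -> normc (F t) <= M) -> normc (cint a b F) <= 2 * M * (b - a).
Proof.
move=> ab cF FM; have [i1 i2] := ccont_integrable cF.
have bound (g : R -> R) : mu.-integrable `[a, b] (EFin \o g) ->
    (forall t, a <= t <= b -> `|g t| <= M) -> `|\int[mu]_(t in `[a, b]) g t| <= M * (b - a).
  move=> ig gM; apply: le_trans (le_normr_Rintegral _ ig) _ => //.
  apply: le_trans (@le_Rintegral _ _ _ mu `[a, b] _ (fun=> M) _ _ _ _) _ => //.
  - by apply: integrable_norm.
  - apply: continuous_compact_integrable; first exact: segment_compact.
    by move=> t; exact: cvg_cst.
  rewrite Rintegral_cst//= lebesgue_measure_itv/= lte_fin; case: ltP => [_ //=|ba /=].
  by rewrite (@le_anti _ _ a b) ?ab// subrr !mulr0.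
apply: le_trans (normc_leReIm _) _; rewrite -mulrA mulr_natl mulr2n; apply: lerD; apply: bound => //.
  by move=> t tab; apply: le_trans (ler_Re _) (FM _ tab).
by move=> t tab; apply: le_trans (ler_Im _) (FM _ tab).
Qed.

Lemma cint_cst a b (c : C) : a <= b -> cint a b (fun=> c) = c * (b - a)%:C.
Proof.
move=> ab; have h (x : R) : \int[mu]_(t in `[a, b]) x = x * (b - a).
  rewrite Rintegral_cst//= lebesgue_measure_itv/= lte_fin; case: ltP => [_ //=|ba /=].
  by rewrite (@le_anti _ _ a b) ?ab// subrr !mulr0.
by case: c => p q; rewrite /cint /= !h; apply: complex_ext => /=; ring.
Qed.

Lemma eq_cint a b F G : (forall t, a <= t <= b -> F t = G t) -> cint a b F = cint a b G.
Proof.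
by move=> FG; rewrite /cint; congr (_ +i* _); apply: eq_Rintegral => t;
  rewrite inE /= in_itv /= => /FG ->.
Qed.

(* The contour integral over the boundary of the rectangle with corner [x +i* y]
   and sides [u], [v]. *)
Definition boxI (G : C -> C) (x y u v : R) : C :=
  cint x (x + u) (fun s => G (s +i* y) - G (s +i* (y + v))) +
  'i * cint y (y + v) (fun t => G ((x + u) +i* t) - G (x +i* t)).

Lemma ccont_h (G : C -> C) a b y : (forall s, a <= s <= b -> holo G (s +i* y)) ->
  ccont a b (fun s => G (s +i* y)).
Proof.
move=> hG s sab; apply: (@cvg_comp _ _ _ (fun s => (s +i* y) : C^o) (G : C^o -> C^o) _
  (nbhs ((s +i* y) : C^o))); last exact: holo_continuous (hG _ sab).
by apply: cvgC_ReIm => /=; [exact: cvg_id|exact: cvg_cst].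
Qed.

Lemma ccont_v (G : C -> C) a b x : (forall t, a <= t <= b -> holo G (x +i* t)) ->
  ccont a b (fun t => G (x +i* t)).
Proof.
move=> hG s sab; apply: (@cvg_comp _ _ _ (fun s => (x +i* s) : C^o) (G : C^o -> C^o) _
  (nbhs ((x +i* s) : C^o))); last exact: holo_continuous (hG _ sab).
by apply: cvgC_ReIm => /=; [exact: cvg_cst|exact: cvg_id].
Qed.

Lemma ccontS a b a' b' F : a <= a' -> b' <= b -> ccont a b F -> ccont a' b' F.
Proof.
by move=> aa bb cF t /andP[t1 t2]; apply: cF; rewrite (le_trans aa t1) (le_trans t2 bb).
Qed.

Lemma goursat (G : C -> C) a b h k : 0 < h -> 0 < k ->
  (forall x y, a <= x <= a + h -> b <= y <= b + k -> holo G (x +i* y)) ->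
  boxI G a b h k = 0.
Proof.
move=> h0 k0 hG; apply: bisection_zero => //.
  move=> x y u v u0 v0 ax xh by_ yk.
  have e1 : x + u / 2 + u / 2 = x + u by field.
  have e2 : y + v / 2 + v / 2 = y + v by field.
  have xm : x <= x + u / 2 <= x + u by clear -u0; apply/andP; split; lra.
  have ym : y <= y + v / 2 <= y + v by clear -v0; apply/andP; split; lra.
  have hx s : x <= s <= x + u -> a <= s <= a + h.
    by move=> /andP[s1 s2]; rewrite (le_trans ax s1) (le_trans s2 xh).
  have hy s : y <= s <= y + v -> b <= s <= b + k.
    by move=> /andP[s1 s2]; rewrite (le_trans by_ s1) (le_trans s2 yk).
  have ch t : y <= t <= y + v -> ccont x (x + u) (fun s => G (s +i* t)).
    by move=> tb; apply: ccont_h => s sb; apply: hG; [exact: hx|exact: hy].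
  have cv s : x <= s <= x + u -> ccont y (y + v) (fun t => G (s +i* t)).
    by move=> sb; apply: ccont_v => t tb; apply: hG; [exact: hx|exact: hy].
  have [/andP[xm1 xm2] /andP[ym1 ym2]] := (xm, ym).
  have yy : y <= y <= y + v by rewrite lexx (le_trans ym1 ym2).
  have yyv : y <= y + v <= y + v by rewrite lexx (le_trans ym1 ym2).
  have xx : x <= x <= x + u by rewrite lexx (le_trans xm1 xm2).
  have xxu : x <= x + u <= x + u by rewrite lexx (le_trans xm1 xm2).
  have splitH p q : x <= p -> q <= x + u ->
      cint p q (fun s => G (s +i* y) - G (s +i* (y + v))) =
      cint p q (fun s => G (s +i* y) - G (s +i* (y + v / 2))) +
      cint p q (fun s => G (s +i* (y + v / 2)) - G (s +i* (y + v))).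
    move=> xp qx; rewrite -cintD.
    - by apply: eq_cint => t _; ring.
    - by apply: ccontS xp qx (ccontB (ch _ _) (ch _ _)).
    - by apply: ccontS xp qx (ccontB (ch _ _) (ch _ _)).
  have splitV p q : y <= p -> q <= y + v ->
      cint p q (fun t => G ((x + u) +i* t) - G (x +i* t)) =
      cint p q (fun t => G ((x + u / 2) +i* t) - G (x +i* t)) +
      cint p q (fun t => G ((x + u) +i* t) - G ((x + u / 2) +i* t)).
    move=> xp qx; rewrite -cintD.
    - by apply: eq_cint => t _; ring.
    - by apply: ccontS xp qx (ccontB (cv _ _) (cv _ _)).
    - by apply: ccontS xp qx (ccontB (cv _ _) (cv _ _)).
  rewrite /boxI e1 e2 (@cint_split x (x + u / 2) (x + u))//; last by apply: ccontB; exact: ch.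
  rewrite (@cint_split y (y + v / 2) (y + v))//; last by apply: ccontB; exact: cv.
  by rewrite !splitH// !splitV//; ring.
move=> x y xb yb e e0.
have [D /(_ (e / 4))] := holo_eps (hG _ _ xb yb).
move=> /(_ ltac:(by rewrite divr_gt0))[d d0 hD]; exists d => // x' y' u v u0 v0 xin yin ax xh by_ yk uvd.
have rho s t : x' <= s <= x' + u -> y' <= t <= y' + v ->
    normc (G (s +i* t) - G (x +i* y) - D * ((s +i* t) - (x +i* y))) <= e / 4 * (u + v).
  move=> sb tb.
  have nle : normc ((s +i* t) - (x +i* y)) <= u + v.
    apply: le_trans (normc_leReIm _) _ => /=; apply: lerD.
      by clear -sb xin; rewrite ler_norml; lra.
    by clear -tb yin; rewrite ler_norml; lra.
  apply: le_trans (hD _ (le_lt_trans nle uvd)) _.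
  by rewrite ler_wpM2l// ltW// divr_gt0.
have hx s : x' <= s <= x' + u -> a <= s <= a + h.
  by move=> /andP[s1 s2]; rewrite (le_trans ax s1) (le_trans s2 xh).
have hy s : y' <= s <= y' + v -> b <= s <= b + k.
  by move=> /andP[s1 s2]; rewrite (le_trans by_ s1) (le_trans s2 yk).
have ch t : y' <= t <= y' + v -> ccont x' (x' + u) (fun s => G (s +i* t)).
  by move=> tb; apply: ccont_h => s sb; apply: hG; [exact: hx|exact: hy].
have cv s : x' <= s <= x' + u -> ccont y' (y' + v) (fun t => G (s +i* t)).
  by move=> sb; apply: ccont_v => t tb; apply: hG; [exact: hx|exact: hy].
have xu : x' <= x' + u by rewrite lerDl ltW.
have yv : y' <= y' + v by rewrite lerDl ltW.
have yy : y' <= y' <= y' + v by rewrite lexx.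
have yyv : y' <= y' + v <= y' + v by rewrite lexx yv.
have xx : x' <= x' <= x' + u by rewrite lexx.
have xxu : x' <= x' + u <= x' + u by rewrite lexx xu.
have ccst p q (c : C) : ccont p q (fun=> c) by move=> t _; exact: cvg_cst.
(* [ph] and [pv] are the integrands without the affine approximation of [G], whose contributions
   [- D * (0 +i* v) * u] and ['i * (D * u) * v] cancel. Each is a difference of two remainders,
   hence at most [e / 2 * (u + v)]; the factor 2 of [cint_norm] then gives [e * (u + v) ^+ 2]. *)
pose ph s := G (s +i* y') - G (s +i* (y' + v)) + D * (0 +i* v).
pose pv t := G ((x' + u) +i* t) - G (x' +i* t) - D * u%:C.
have cph : ccont x' (x' + u) ph by apply: ccontD (ccontB (ch _ yy) (ch _ yyv)) (ccst _ _ _).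
have cpv : ccont y' (y' + v) pv by apply: ccontB (ccontB (cv _ xxu) (cv _ xx)) (ccst _ _ _).
have -> : boxI G x' y' u v = cint x' (x' + u) ph + 'i * cint y' (y' + v) pv.
  rewrite /boxI (@eq_cint _ _ _ (fun s => ph s + - (D * (0 +i* v)))); last by move=> t _; rewrite /ph; ring.
  rewrite (@eq_cint y' (y' + v) _ (fun s => pv s + D * u%:C)); last by move=> t _; rewrite /pv; ring.
  rewrite (cintD cph (ccst _ _ _)) (cintD cpv (ccst _ _ _)) (cint_cst _ xu) (cint_cst _ yv).
  have -> : x' + u - x' = u by ring.
  have -> : y' + v - y' = v by ring.
  have -> : (0 +i* v) = 'i * v%:C :> C by apply: complex_ext; rewrite ?cReM ?cImM /=; ring.
  ring.
have nph s : x' <= s <= x' + u -> normc (ph s) <= e / 2 * (u + v).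
  move=> sb; have -> : ph s = (G (s +i* y') - G (x +i* y) - D * ((s +i* y') - (x +i* y)))
     - (G (s +i* (y' + v)) - G (x +i* y) - D * ((s +i* (y' + v)) - (x +i* y))).
    rewrite /ph.
    have -> : (s +i* (y' + v)) = (s +i* y') + (0 +i* v) :> C by apply: complex_ext; rewrite ?cReD ?cImD /=; ring.
    ring.
  apply: le_trans (le_normcD _ _) _; rewrite normcN.
  have := rho s y' sb yy; have := rho s (y' + v) sb yyv; clear; lra.
have npv t : y' <= t <= y' + v -> normc (pv t) <= e / 2 * (u + v).
  move=> sb; have -> : pv t = (G ((x' + u) +i* t) - G (x +i* y) - D * (((x' + u) +i* t) - (x +i* y)))
     - (G (x' +i* t) - G (x +i* y) - D * ((x' +i* t) - (x +i* y))).
    rewrite /pv.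
    have -> : ((x' + u) +i* t) = (x' +i* t) + u%:C :> C by apply: complex_ext; rewrite ?cReD ?cImD /=; ring.
    ring.
  apply: le_trans (le_normcD _ _) _; rewrite normcN.
  have := rho x' t xx sb; have := rho (x' + u) t xxu sb; clear; lra.
have := cint_norm xu cph nph; have := cint_norm yv cpv npv.
have -> : x' + u - x' = u by ring.
have -> : y' + v - y' = v by ring.
move=> b1 b2; apply: le_trans (le_normcD _ _) _; rewrite normcM.
have -> : normc ('i : C) = 1 by rewrite /= expr0n expr1n add0r sqrtr1.
by rewrite mul1r; clear -b1 b2; nra.
Qed.

Lemma cvg_circle (r : R) (t : R) : (fun s => r%:C * cis s : C^o) @ t --> (r%:C * cis t : C^o).
Proof. apply: cvgCM; [exact: cvg_cst|exact: continuous_cis]. Qed.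

Lemma continuous_circle (f : C -> C) (r : R) :
  (forall z, normc z = `|r| -> holo f z) -> continuous (fun t : R => f (r%:C * cis t) : C^o).
Proof.
move=> hf t; apply: (@cvg_comp _ _ _ (fun s => r%:C * cis s : C^o) (f : C^o -> C^o) _
  (nbhs (r%:C * cis t : C^o))); first exact: cvg_circle.
by apply: holo_continuous; apply: hf; rewrite normcM normc_real normc_cis mulr1.
Qed.

Lemma L1_continuous (f : C -> C) : continuous (fun t : R => f (cis t) : C^o) -> L1 f.
Proof.
move=> cf; apply/L1P; split; [exists (fun z => complex.Re (f z))|exists (fun z => complex.Im (f z))];
  (split; last exact: aeT_all); apply: continuous_compact_integrable; try exact: segment_compact;
  apply: continuous_in_subspaceT => t _; [apply: cvgC_Re|apply: cvgC_Im]; exact: cf.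
Qed.

Lemma meanTC_cint (f : C -> C) : meanTC f = ((2 * pi)^-1)%:C * cint 0 (2 * pi) (fun t => f (cis t)).
Proof. by apply: complex_ext; rewrite ?cReM ?cImM /= ?mul0r ?subr0 ?addr0. Qed.

(* Cauchy's theorem on a rectangle for [g \o expC]: its vertical sides are the two
   circles and its horizontal sides cancel by periodicity. *)
Lemma meanTC_circles (g : C -> C) (r1 r2 : R) :
  (forall z, 0 < normc z < 1 -> holo g z) -> 0 < r1 < r2 -> r2 < 1 ->
  meanTC (fun z => g (r1%:C * z)) = meanTC (fun z => g (r2%:C * z)).
Proof.
move=> hg /andP[r10 r12] r21; have r20 := lt_trans r10 r12.
rewrite !meanTC_cint; congr (_ * _).
pose G w := g (expC w).
have hG x y : ln r1 <= x <= ln r1 + (ln r2 - ln r1) -> 0 <= y <= 0 + 2 * pi -> holo G (x +i* y).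
  rewrite [_ + (_ - _)]addrC subrK => /andP[x1 x2] _.
  apply: (@holo_comp _ expC g); first exact: holo_expC.
  apply: hg; rewrite normc_expC expR_gt0/=.
  apply: le_lt_trans r21; rewrite -(lnK (_ : r2 \in Num.pos)) ?posrE// ler_expR.
  exact: x2.
have h0 : 0 < ln r2 - ln r1 by rewrite subr_gt0 ltr_ln.
have := goursat h0 (@twopi_gt0 R) hG.
rewrite /boxI add0r [ln r1 + _]addrC subrK.
have Gr (r t : R) : 0 < r -> G (ln r +i* t) = g (r%:C * cis t).
  by move=> r0; rewrite /G /expC /= lnK.
have G0 s : G (s +i* 0) - G (s +i* (2 * pi)) = 0.
  by rewrite /G /expC /= /cis cos0 sin0 [2 * pi]mulr_natl cos2pi sin2pi subrr.
rewrite (@eq_cint _ _ _ (fun=> 0)); last by move=> t _; exact: G0.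
rewrite cint_cst; last by rewrite -subr_ge0 ltW.
rewrite mul0r add0r => /eqP; rewrite mulf_eq0 => /orP[/eqP|].
  by move/(congr1 (@complex.Im R)) => /= /eqP; rewrite oner_eq0.
have tp : 0 <= 2 * pi :> R by exact: ltW (@twopi_gt0 R).
have cG r : 0 < r -> r < 1 -> ccont 0 (2 * pi) (fun t => g (r%:C * cis t)).
  move=> r0 r1' t _; apply: continuous_circle => z; rewrite ger0_norm; last exact: ltW.
  by move=> zr; apply: hg; rewrite zr r0.
rewrite (@eq_cint _ _ _ (fun t => g (r2%:C * cis t) + (-1) * g (r1%:C * cis t))); last first.
  by move=> t _; rewrite !Gr// mulN1r.
have -> : cint 0 (2 * pi) (fun t => g (r2%:C * cis t) + -1 * g (r1%:C * cis t)) =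
   cint 0 (2 * pi) (fun t => g (r2%:C * cis t)) - cint 0 (2 * pi) (fun t => g (r1%:C * cis t)).
  have c1 := cG _ r10 (lt_trans r12 r21).
  have c1N : ccont 0 (2 * pi) (fun t => -1 * g (r1%:C * cis t)).
    by move=> t tb; apply: cvgCM (c1 t tb); exact: cvg_cst.
  have c2 := cG _ r20 r21.
  rewrite (cintD c2 c1N).
  apply/eqP; rewrite -subr_eq0 opprD opprK addrACA subrr add0r addrC -(cintD c1 c1N).
  rewrite (@eq_cint _ _ _ (fun=> 0)); last by move=> t _; ring.
  by rewrite cint_cst// mul0r.
by rewrite subr_eq0 => /eqP.
Qed.

Lemma disc_normc (z : C) : disc z <-> normc z < 1.
Proof. by rewrite /disc /= normCE -(rmorph1 (real_complex R)) ltcR. Qed.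

Lemma holomorphicD_holo (f : C -> C) z : holomorphicD f -> normc z < 1 -> holo f z.
Proof. by move=> hf z1; apply: hf; apply/disc_normc. Qed.

Lemma holo_delta (f : C -> C) z (e : R) : holo f z -> 0 < e -> exists2 d : R, 0 < d &
  forall w, normc (w - z) < d -> normc (f w - f z) < e.
Proof.
move=> /holo_eps[D h] e0; have [d d0 {}h] := h 1 ltr01.
have D1 : 0 < normc D + 1 by rewrite ltr_wpDl// normc_ge0.
exists (Num.min d (e / (normc D + 1))); first by rewrite lt_min d0 divr_gt0.
move=> w; rewrite lt_min ltr_pdivlMr// => /andP[wd we]; apply: le_lt_trans we.
have -> : f w - f z = (f w - f z - D * (w - z)) + D * (w - z) by rewrite subrK.
apply: le_trans (le_normcD _ _) _; rewrite normcM.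
by have := h w wd; clear; lra.
Qed.

(** The mean does not depend on the radius, by [meanTC_circles], and is close to [f 0] on small
    circles by continuity. A discrepancy [e] would satisfy [e <= e / 2]. *)
Lemma mean_value (f : C -> C) (r : R) : holomorphicD f -> 0 <= r < 1 ->
  meanTC (fun z => f (r%:C * z)) = f 0.
Proof.
move=> hf /andP[]; rewrite le_eqVlt => /predU1P[<- _|r0 r1].
  by rewrite -[RHS]meanTC_cst; apply: meanTC_ae; apply: aeT_all => z _; rewrite mul0r.
have hf' z : normc z < 1 -> holo f z by exact: holomorphicD_holo.
apply/eqP; rewrite -subr_eq0 -normc_eq0; apply/negPn/negP => neq.
have e0 : 0 < normc (meanTC (fun z => f (r%:C * z)) - f 0) by rewrite lt_neqAle eq_sym neq normc_ge0.
set e := normc _ in e0 neq.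
have [d d0 hd] := holo_delta (hf' 0 ltac:(by rewrite normc0)) (divr_gt0 e0 (ltr0Sn _ 1)).
pose s := Num.min (r / 2) (d / 2).
have s0 : 0 < s by rewrite lt_min !divr_gt0.
have sr : s < r by rewrite gt_min; apply/orP; left; rewrite ltr_pdivrMr// mulr_natr mulr2n ltrDl.
have sd : s < d.
  by rewrite gt_min; apply/orP; right; rewrite ltr_pdivrMr// mulr_natr mulr2n ltrDl.
have Ls : L1 (fun z => f (s%:C * z)).
  apply: L1_continuous; apply: continuous_circle => z.
  by rewrite gtr0_norm// => zs; apply: hf'; rewrite zs (lt_trans sr).
have es : e <= e / 2.
  rewrite {1}/e -(@meanTC_circles f s r) ?s0//; last by move=> z /andP[_]; exact: hf'.
  rewrite -(meanTC_cst (f 0)) -meanTCB//; last exact: L1_cst.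
  apply: le_trans (meanTC_norm (L1B Ls (L1_cst _))) _.
  rewrite -[leRHS](@meanT_cst R); apply: meanT_le.
  - by case: (L1B Ls (L1_cst (f 0))).
  - exact: aeint_cst.
  apply: aeT_all => z z1.
  have := hd (s%:C * z); rewrite subr0 normcM normc_real z1 mulr1 gtr0_norm// => /(_ sd).
  exact: ltW.
by move: es; rewrite leNgt; apply/negP/negPn; rewrite ltr_pdivrMr// mulr_natr mulr2n ltrDl.
Qed.

End goursat.

(** * Poisson integrals and Fatou's theorem *)

Section kernels.
Context {R : realType}.
Local Notation C := R[i].
Implicit Types (f g : C -> C) (z w : C).

(** On the circle this equals [zeta / (zeta - z)]. In this form the conjugate kernel is holomorphic
    in [zeta] beyond the closed disc, and the Poisson kernel is [cauchyK + cauchyK^* - 1]. *)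
Definition cauchyK z (zeta : C) : C := (1 - z * zeta^*)^-1.

Definition poisson z (zeta : C) : R := complex.Re ((zeta + z) / (zeta - z)).

Lemma circle_conj z : normc z = 1 -> z * z^* = 1.
Proof. by move=> z1; rewrite mulcJ z1 expr1n. Qed.

Lemma normc_cauchy_den z (zeta : C) : normc zeta = 1 -> 1 - normc z <= normc (1 - z * zeta^*).
Proof.
move=> h; have := lec_normc_sub 1 (z * zeta^*).
rewrite normc1 normcM normc_conj h mulr1; exact: le_trans (ler_norm _).
Qed.

Lemma cauchy_den_neq0 z (zeta : C) : normc zeta = 1 -> normc z < 1 -> 1 - z * zeta^* != 0.
Proof.
move=> h z1; rewrite -normc_gt0; apply: lt_le_trans (normc_cauchy_den z h).
by rewrite subr_gt0.
Qed.

Lemma normc_cauchyK z (zeta : C) : normc zeta = 1 -> normc z < 1 ->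
  normc (cauchyK z zeta) <= (1 - normc z)^-1.
Proof.
move=> h z1; rewrite /cauchyK normcV lef_pV2 ?posrE ?subr_gt0 ?normc_gt0 ?cauchy_den_neq0//.
exact: normc_cauchy_den.
Qed.

Lemma herglotzE z (zeta : C) : normc zeta = 1 -> normc z < 1 ->
  (zeta + z) / (zeta - z) = 2 * cauchyK z zeta - 1.
Proof.
move=> h z1; have n0 := cauchy_den_neq0 h z1.
have hz : zeta != 0 by rewrite -normc_gt0 h.
have -> : zeta - z = zeta * (1 - z * zeta^*).
  by rewrite mulrBr mulr1 mulrCA circle_conj// mulr1.
have -> : zeta + z = zeta * (1 + z * zeta^*).
  by rewrite mulrDr mulr1 mulrCA circle_conj// mulr1.
rewrite invfM mulrACA divff// mul1r /cauchyK; field.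
exact: n0.
Qed.

Lemma poissonE z (zeta : C) : normc zeta = 1 -> normc z < 1 ->
  poisson z zeta = (1 - normc z ^+ 2) / normc (zeta - z) ^+ 2.
Proof.
move=> h z1; rewrite /poisson.
have d0 : zeta - z != 0.
  rewrite -normc_gt0; have := lec_normc_sub zeta z; rewrite h.
  have := ler_norm (1 - normc z); have : 0 < 1 - normc z by rewrite subr_gt0.
  by clear; lra.
have -> : (zeta + z) / (zeta - z) = (zeta + z) * (zeta - z)^* * ((normc (zeta - z) ^+ 2)^-1)%:C.
  rewrite -mulrA; congr (_ * _); apply: (mulfI d0).
  by rewrite divff// mulrA mulcJ -rmorphM divff ?rmorph1// expf_neq0// normc_eq0.
rewrite cReM /= mulr0 subr0; congr (_ / _).
rewrite normc_sqr; move: h => /(congr1 (fun x => x ^+ 2)); rewrite normc_sqr expr1n => <-.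
by case: zeta z {z1 d0} => a b [c d] /=; ring.
Qed.

Lemma poisson_ge0 z (zeta : C) : normc zeta = 1 -> normc z < 1 -> 0 <= poisson z zeta.
Proof.
move=> h z1; rewrite poissonE//; apply: divr_ge0; last exact: sqr_ge0.
by rewrite subr_ge0 expr_le1 ?normc_ge0// ltW.
Qed.

Lemma poisson_conjE z (zeta : C) : normc zeta = 1 -> normc z < 1 ->
  (poisson z zeta)%:C = cauchyK z zeta + (cauchyK z zeta)^* - 1.
Proof.
move=> h z1; rewrite /poisson herglotzE//; set k := cauchyK _ _.
apply: complex_ext; rewrite ?cReD ?cImD ?cReN ?cImN ?cReJ ?cImJ /=.
  by rewrite mulrDl mul1r; case: k => a b /=; ring.
by case: k => a b /=; ring.
Qed.

Lemma poisson_le z (zeta : C) : normc zeta = 1 -> normc z < 1 ->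
  poisson z zeta <= 2 / (1 - normc z).
Proof.
move=> h z1; have d0 : 0 < 1 - normc z by rewrite subr_gt0.
rewrite poissonE//.
have dn : 1 - normc z <= normc (zeta - z).
  by have := lec_normc_sub zeta z; rewrite h; exact: le_trans (ler_norm _).
have dn0 := lt_le_trans d0 dn.
rewrite ler_pdivrMr ?exprn_gt0// mulrAC ler_pdivlMr//.
have : (1 - normc z) ^+ 2 <= normc (zeta - z) ^+ 2.
  by rewrite ler_sqr ?nnegrE ?normc_ge0 ?(ltW d0).
have := mulr_ge0 (sqr_ge0 (1 - normc z)) (ltW d0).
by clear; lra.
Qed.

Lemma poisson_ge z (zeta : C) : normc zeta = 1 -> normc z < 1 ->
  (1 - normc z) / 2 <= poisson z zeta.
Proof.
move=> h z1; have d0 : 0 < 1 - normc z by rewrite subr_gt0.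
rewrite poissonE//.
have dn : 1 - normc z <= normc (zeta - z).
  by have := lec_normc_sub zeta z; rewrite h; exact: le_trans (ler_norm _).
have dn0 := lt_le_trans d0 dn.
have dn2 : normc (zeta - z) <= 1 + normc z by rewrite -h -(normcN z) le_normcD.
rewrite ler_pdivlMr ?exprn_gt0//.
have : normc (zeta - z) ^+ 2 <= (1 + normc z) ^+ 2.
  by rewrite ler_sqr ?nnegrE ?addr_ge0 ?normc_ge0.
move=> /(ler_wpM2l (ltW d0)).
have := mulr_ge0 (mulr_ge0 (ltW d0) (addr_ge0 ler01 (normc_ge0 z))) (ltW d0).
by clear; lra.
Qed.

Lemma measT_cauchyK z : normc z < 1 -> measT (cauchyK z).
Proof.
move=> z1; apply: measurableT_continuous => t.
apply: cvgCV; first by apply: cauchy_den_neq0; rewrite ?normc_cis.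
apply: cvgCB; first exact: cvg_cst.
apply: cvgCM; first exact: cvg_cst.
apply: cvgC_conj; exact: continuous_cis.
Qed.

Lemma cauchyK_bound z : normc z < 1 -> aeT (fun zeta => normc (cauchyK z zeta) <= (1 - normc z)^-1).
Proof. by move=> z1; apply: aeT_all => zeta h; exact: normc_cauchyK. Qed.

Lemma measT_poisson z : normc z < 1 -> measT (fun zeta => (poisson z zeta)%:C).
Proof.
move=> z1; have mK := measT_cauchyK z1.
apply: measurableT_ae (measurableTB (measurableTD mK (measurableT_conj mK)) (measurableT_cst 1)).
by apply: aeT_all => zeta h; exact: poisson_conjE.
Qed.

Lemma poisson_bound z : normc z < 1 ->
  aeT (fun zeta => normc (poisson z zeta)%:C <= 2 / (1 - normc z)).
Proof.
move=> z1; apply: aeT_all => zeta h.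
by rewrite normc_real ger0_norm ?poisson_ge0// poisson_le.
Qed.

Lemma L1_cauchyK z g : normc z < 1 -> L1 g -> L1 (fun zeta => cauchyK z zeta * g zeta).
Proof.
move=> z1; apply: L1_bounded_mul; [exact: measT_cauchyK|exact: cauchyK_bound].
Qed.

Lemma L1_poisson z g : normc z < 1 -> L1 g -> L1 (fun zeta => (poisson z zeta)%:C * g zeta).
Proof.
move=> z1; apply: L1_bounded_mul; [exact: measT_poisson|exact: poisson_bound].
Qed.

Lemma holomorphicD_comp_scale f (rho : R) : 0 <= rho ->
  (forall z, normc z < rho -> holo f z) -> holomorphicD (fun w => f (rho%:C * w)).
Proof.
move=> r0 hf z /disc_normc z1.
have [r00|rn] := eqVneq rho 0.
  apply: (@near_eq_holo _ (fun=> f 0) _ _ 1) => //; last exact: holo_cst.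
  by move=> w _; rewrite r00 mul0r.
have {}r0 : 0 < rho by rewrite lt_neqAle eq_sym rn.
apply: (@holo_comp _ (fun w => rho%:C * w) f); first by apply: holoM; [exact: holo_cst|exact: holo_id].
by apply: hf; rewrite normcM normc_real gtr0_norm// gtr_pMr.
Qed.

Lemma mean_value_large f (rho : R) : 1 < rho -> (forall z, normc z < rho -> holo f z) ->
  meanTC f = f 0.
Proof.
move=> r1 hf; have r0 : 0 < rho := lt_trans ltr01 r1.
have := @mean_value _ _ (rho^-1) (holomorphicD_comp_scale (ltW r0) hf).
rewrite invr_ge0 ltW//= invf_lt1// mulr0 => /(_ r1) <-.
apply: meanTC_ae; apply: aeT_all => z _.
by rewrite mulrA -rmorphM divff ?gt_eqF// mul1r.
Qed.

Lemma meanTC_monomial n : meanTC (fun z : C => z ^+ n.+1) = 0.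
Proof.
rewrite (@mean_value_large _ 2) ?expr0n//; first by rewrite ltr1n.
by move=> z _; apply: holoX; exact: holo_id.
Qed.

Lemma L1_monomial n : L1 (fun z : C => z ^+ n).
Proof.
apply: (@L1_bounded _ _ 1); first exact: measurableTX measurableT_id.
by apply: aeT_all => z z1; rewrite normcX z1 expr1n.
Qed.

Lemma meanTC_cauchyK_conj z n : normc z < 1 ->
  meanTC (fun zeta => (cauchyK z zeta)^* * zeta ^+ n) = (n == 0%N)%:R.
Proof.
move=> z1.
have E : meanTC (fun zeta => (cauchyK z zeta)^* * zeta ^+ n) =
   meanTC (fun zeta => (1 - z^* * zeta)^-1 * zeta ^+ n).
  by apply: meanTC_ae; apply: aeT_all => w _; rewrite /cauchyK cconjV cconjB cconjM cconjK cconj1.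
have n0 := normc_ge0 z.
have d0 : 0 < 1 + normc z by rewrite ltr_pwDl.
(* This radius exceeds 1, while [normc z] times it stays below 1, so the denominator [1 - z^* * w]
   has no zero in the larger disc. *)
rewrite E (@mean_value_large _ (2 / (1 + normc z))).
- by rewrite mulr0 subr0 invr1 mul1r expr0n.
- by rewrite ltr_pdivlMr// mul1r; clear -z1; lra.
move=> w; rewrite ltr_pdivlMr// => w1.
apply: holoM; last by apply: holoX; exact: holo_id.
apply: holoV; last by apply: holoB; [exact: holo_cst|apply: holoM; [exact: holo_cst|exact: holo_id]].
rewrite -normc_gt0; have := lec_normc_sub 1 (z^* * w).
rewrite normc1 normcM normc_conj; have := ler_norm (1 - normc z * normc w).
have := normc_ge0 w; clear -z1 w1 n0; nra.
Qed.

(** By induction from [K zeta^(n+1) = z K zeta^n + zeta^(n+1)] on the circle, the last term having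
    mean 0; the case [n = 0] is the conjugate of the previous lemma. *)
Lemma meanTC_cauchyK z n : normc z < 1 ->
  meanTC (fun zeta => cauchyK z zeta * zeta ^+ n) = z ^+ n.
Proof.
move=> z1; elim: n => [|n IH].
  have L := L1_cauchyK z1 (L1_monomial 0).
  have e : meanTC (fun zeta => (cauchyK z zeta)^* * zeta ^+ 0) = 1 := meanTC_cauchyK_conj 0 z1.
  rewrite expr0 -[RHS]cconj1 -e.
  rewrite -meanTC_conj; first by apply: meanTC_ae; apply: aeT_all => w _; rewrite !expr0 !mulr1 cconjK.
  by apply: L1_ae (L1_conj L); apply: aeT_all => w _; rewrite !expr0 !mulr1.
rewrite exprS -IH -meanTCZ; last exact: L1_cauchyK (L1_monomial n).
rewrite -[RHS]addr0 -(meanTC_monomial n) -meanTCD; last exact: L1_monomial.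
  apply: meanTC_ae; apply: aeT_all => w w1.
  have := cauchy_den_neq0 w1 z1; rewrite /cauchyK => d0.
  have e : w - z = w * (1 - z * w^*) by rewrite mulrBr mulr1 mulrCA circle_conj// mulr1.
  have -> : (1 - z * w^*)^-1 * w ^+ n.+1 = z * ((1 - z * w^*)^-1 * w ^+ n) + (1 - z * w^*)^-1 * (w - z) * w ^+ n.
    by rewrite exprS; ring.
  by congr (_ + _); rewrite e [_^-1 * _]mulrCA mulVf// mulr1 exprS.
by apply: L1Z; exact: L1_cauchyK (L1_monomial n).
Qed.

Lemma meanTC_poisson z n : normc z < 1 ->
  meanTC (fun zeta => (poisson z zeta)%:C * zeta ^+ n) = z ^+ n.
Proof.
move=> z1.
have L1K := L1_cauchyK z1 (L1_monomial n).
have L1Kc : L1 (fun zeta => (cauchyK z zeta)^* * zeta ^+ n).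
  apply: (L1_bounded_mul (measurableT_conj (measT_cauchyK z1)) _ (L1_monomial n)).
  by apply: aeT_mono (cauchyK_bound z1) => w _; rewrite normc_conj; apply.
have -> : meanTC (fun zeta => (poisson z zeta)%:C * zeta ^+ n) =
    meanTC (fun zeta => cauchyK z zeta * zeta ^+ n + ((cauchyK z zeta)^* * zeta ^+ n - zeta ^+ n)).
  by apply: meanTC_ae; apply: aeT_all => w w1; rewrite poisson_conjE//; ring.
rewrite meanTCD//; last exact: L1B L1Kc (L1_monomial n).
rewrite meanTCB//; last exact: L1_monomial.
rewrite meanTC_cauchyK// meanTC_cauchyK_conj//.
case: n {L1K L1Kc} => [|n]; last by rewrite meanTC_monomial subrr addr0.
rewrite eqxx (_ : meanTC _ = 1) ?subrr ?addr0//.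
by rewrite -[RHS]meanTC_cst; apply: meanTC_ae; apply: aeT_all => w _; rewrite expr0.
Qed.

Lemma meanT_poisson z : normc z < 1 -> meanT (poisson z) = 1.
Proof.
move=> z1; apply: (@complexI R); rewrite -meanTC_real -[RHS](expr0 z) -(meanTC_poisson 0 z1).
by apply: meanTC_ae; apply: aeT_all => w _; rewrite expr0 mulr1.
Qed.

Lemma L1_horner (p : {poly C}) : L1 (fun z => p.[z]).
Proof.
apply: L1_ae (@L1_sum _ _ (index_enum 'I_(size p)) (fun (i : 'I_(size p)) z => p`_i * z ^+ i) _).
  by apply: aeT_all => z _; rewrite horner_coef.
by move=> i; apply: L1Z; exact: L1_monomial.
Qed.

Lemma meanTC_poisson_horner (p : {poly C}) z : normc z < 1 ->
  meanTC (fun zeta => (poisson z zeta)%:C * p.[zeta]) = p.[z].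
Proof.
move=> z1; rewrite horner_coef.
have -> : meanTC (fun zeta => (poisson z zeta)%:C * p.[zeta]) =
  meanTC (fun zeta => \sum_(i < size p) p`_i * ((poisson z zeta)%:C * zeta ^+ i)).
  apply: meanTC_ae; apply: aeT_all => w _; rewrite horner_coef mulr_sumr.
  by apply: eq_bigr => i _; ring.
rewrite meanTC_sum; last by move=> i; apply: L1Z; exact: L1_poisson (L1_monomial i).
by apply: eq_bigr => i _; rewrite meanTCZ ?meanTC_poisson//; exact: L1_poisson (L1_monomial i).
Qed.

Lemma meanTC_horner_monomial (p : {poly C}) n : meanTC (fun zeta => zeta ^+ n.+1 * p.[zeta]) = 0.
Proof.
have -> : meanTC (fun zeta => zeta ^+ n.+1 * p.[zeta]) =
  meanTC (fun zeta => \sum_(i < size p) p`_i * zeta ^+ (n + i).+1).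
  apply: meanTC_ae; apply: aeT_all => w _; rewrite horner_coef mulr_sumr.
  by apply: eq_bigr => i _; rewrite -addSn exprD; ring.
rewrite meanTC_sum; last by move=> i; apply: L1Z; exact: L1_monomial.
by apply: big1 => i _; rewrite meanTCZ ?meanTC_monomial ?mulr0//; exact: L1_monomial.
Qed.

(** With [K_w] for [cauchyK w], the remainder is exact: [K_w - K_z - (w - z) zeta^* K_z^2 = (w -
    z)^2 zeta^*^2 K_z^2 K_w]. For [w] within [m = (1 - |z|) / 2] of [z] both kernels are at most
    [1 / m]. *)
Lemma cauchy_holo g z : L1 g -> normc z < 1 ->
  holo (fun w => meanTC (fun zeta => cauchyK w zeta * g zeta)) z.
Proof.
move=> Lg z1; pose m := (1 - normc z) / 2.
have m0 : 0 < m by rewrite divr_gt0// subr_gt0.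
pose D := meanTC (fun zeta => (zeta^* * cauchyK z zeta ^+ 2) * g zeta).
apply: (@quadratic_holo _ _ _ D (m^-1 ^+ 3 * meanT (fun zeta => normc (g zeta))) m) => // w wm.
have w1 : normc w < 1.
  have -> : w = (w - z) + z by rewrite subrK.
  by apply: le_lt_trans (le_normcD _ _) _; rewrite /m in wm; clear -wm z1; lra.
have Kbound v : normc v <= 1 - m -> normc v < 1 -> aeT (fun zeta => normc (cauchyK v zeta) <= m^-1).
  move=> v1 v2; apply: aeT_mono (cauchyK_bound v2) => zeta _ /le_trans; apply.
  by rewrite lef_pV2 ?posrE ?subr_gt0//; clear -v1; lra.
have Kz : aeT (fun zeta => normc (cauchyK z zeta) <= m^-1).
  by apply: Kbound => //; rewrite /m; clear -z1; lra.
have Kw : aeT (fun zeta => normc (cauchyK w zeta) <= m^-1).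
  apply: Kbound => //.
  have -> : w = (w - z) + z by rewrite subrK.
  by apply: le_trans (le_normcD _ _) _; move: wm; rewrite /m; clear -z1; lra.
have mKz := measT_cauchyK z1; have mKw := measT_cauchyK w1.
have mc := measurableT_conj (@measurableT_id R).
have L1D' : L1 (fun zeta => (zeta^* * cauchyK z zeta ^+ 2) * g zeta).
  apply: (@L1_bounded_mul _ _ _ (m^-1 ^+ 2)) => //.
    by apply: measurableTM mc _; exact: measurableTX.
  apply: aeT_mono Kz => zeta h1 h2; rewrite normcM normc_conj h1 mul1r normcX.
  by rewrite ler_sqr ?nnegrE ?normc_ge0 ?invr_ge0 ?(ltW m0).
pose Q zeta := (w - z) ^+ 2 * (zeta^* ^+ 2 * cauchyK z zeta ^+ 2 * cauchyK w zeta).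
have mQ : measT (fun zeta => zeta^* ^+ 2 * cauchyK z zeta ^+ 2 * cauchyK w zeta).
  by apply: measurableTM => //; apply: measurableTM; apply: measurableTX.
have Qb : aeT (fun zeta => normc (zeta^* ^+ 2 * cauchyK z zeta ^+ 2 * cauchyK w zeta) <= m^-1 ^+ 3).
  apply: aeT_mono2 Kz Kw => zeta h1 h2 h3.
  rewrite 2!normcM !normcX normc_conj h1 expr1n mul1r [m^-1 ^+ 3]exprSr.
  apply: ler_pM; rewrite ?sqr_ge0 ?normc_ge0//.
  by rewrite ler_sqr ?nnegrE ?normc_ge0 ?invr_ge0 ?(ltW m0).
have L1Q := L1_bounded_mul mQ Qb Lg.
rewrite /D -meanTCB; [|exact: L1_cauchyK..].
have -> : meanTC (fun zeta => cauchyK w zeta * g zeta - cauchyK z zeta * g zeta) -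
     meanTC (fun zeta => zeta^* * cauchyK z zeta ^+ 2 * g zeta) * (w - z) =
   (w - z) ^+ 2 * meanTC (fun zeta => (zeta^* ^+ 2 * cauchyK z zeta ^+ 2 * cauchyK w zeta) * g zeta).
  rewrite mulrC -!meanTCZ// -meanTCB; last exact: L1Z.
    apply: meanTC_ae; apply: aeT_all => zeta h; rewrite /cauchyK.
    have := cauchy_den_neq0 h z1; have := cauchy_den_neq0 h w1; move=> d1 d2.
    by field; rewrite d1 d2.
  by apply: L1B; exact: L1_cauchyK.
rewrite normcM normcX mulrC ler_wpM2r ?sqr_ge0//.
apply: le_trans (meanTC_norm L1Q) _; rewrite -meanTZ; last by case: Lg.
apply: meanT_le.
- by case: L1Q.
- by apply: aeintZ; case: Lg.
by apply: aeT_mono Qb => zeta _ h; rewrite normcM ler_wpM2r ?normc_ge0.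
Qed.

End kernels.

(** * Fatou's theorem at Lebesgue points *)

Section fatou.
Context {R : realType}.
Local Notation C := R[i].
Local Notation mu := (@lebesgue_measure R).
Implicit Types (f k : C -> C) (z w : C).

Lemma near_left1 (P : R -> Prop) : (exists2 d, 0 < d & forall r, 1 - d < r < 1 -> P r) ->
  \forall r \near (1 : R)^'-, P r.
Proof.
move=> [d d0 h]; near=> r; apply: h; apply/andP; split; near: r.
  by apply: nbhs_left_gt; rewrite ltrBlDr ltrDl.
exact: nbhs_left_lt.
Unshelve. all: by end_near. Qed.

Lemma ler_xcos_sin (y : R) : 0 <= y <= pi / 2 -> y * cos y <= sin y.
Proof.
move=> /andP[]; rewrite le_eqVlt => /predU1P[<- _|y0 ypi]; first by rewrite mul0r sin0.
have [c cy] := @MVT R sin cos 0 y y0 (fun x _ => is_derive_sin x)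
  (continuous_subspaceT (@continuous_sin R)).
rewrite sin0 !subr0 => ->; rewrite mulrC ler_wpM2r ?(ltW y0)//.
move: cy; rewrite in_itv /= => /andP[c0 cy].
have pi0 := @pi_gt0 R.
rewrite ltW// ltr_cos ?in_itv//=; apply/andP; split; clear -c0 cy y0 ypi pi0; lra.
Qed.

Lemma normc_cisB (t s : R) : normc (cis t - cis s) = 2 * `|sin ((t - s) / 2)|.
Proof.
apply/eqP; rewrite -(@eqrXn2 _ 2)//; [|exact: normc_ge0].
rewrite normc_sqr exprMn real_normK ?num_real// /cis /=.
have e : t = s + ((t - s) / 2 + (t - s) / 2) by field.
set h := (t - s) / 2 in e *; rewrite e !(cosD, sinD).
have h1 : cos h ^+ 2 = 1 - sin h ^+ 2 by rewrite cos2sin2.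
have s1 : cos s ^+ 2 = 1 - sin s ^+ 2 by rewrite cos2sin2.
apply/eqP.
transitivity ((cos s ^+ 2 + sin s ^+ 2) * ((cos h * cos h - sin h * sin h - 1) ^+ 2 +
   (2 * sin h * cos h) ^+ 2)); first by ring.
rewrite cos2Dsin2 mul1r; transitivity ((cos h ^+ 2 - sin h ^+ 2 - 1) ^+ 2 + 4 * sin h ^+ 2 * cos h ^+ 2); first by ring.
by rewrite h1; ring.
Qed.

(** Chords do not control parameters across the cut at 0 and [2 * pi], so [c] depends on the
    distance [2 * eta] from [t0] to the cut. Half the parameter difference is at most [pi - eta],
    and there [sin x = 2 sin(x/2) cos(x/2)] is at least [c0 ^+ 2 * x]. *)
Lemma chord_lower (t0 : R) : 0 < t0 < 2 * pi -> exists2 c, 0 < c &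
  forall t, 0 <= t <= 2 * pi -> `|t - t0| <= c * normc (cis t - cis t0).
Proof.
move=> /andP[t00 t0pi]; have pi0 := @pi_gt0 R.
pose eta := Num.min t0 (2 * pi - t0) / 2.
have eta0 : 0 < eta by rewrite divr_gt0// lt_min t00 subr_gt0.
have etapi : eta <= pi.
  by rewrite /eta ler_pdivrMr// ge_min (_ : t0 <= _) //; clear -t0pi; lra.
pose c0 := cos ((pi - eta) / 2).
have c0_gt0 : 0 < c0 by apply: cos_gt0_pihalf; apply/andP; split; clear -eta0 etapi pi0; lra.
have key x : 0 <= x <= pi - eta -> c0 ^+ 2 * x <= sin x.
  move=> /andP[x0 xe].
  have e : x = x / 2 + x / 2 by field.
  rewrite {2}e sinD.
  have cx : c0 <= cos (x / 2).
    rewrite /c0; have [->//|xne] := eqVneq (x / 2) ((pi - eta) / 2).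
    rewrite ltW// ltr_cos ?in_itv/=; first (rewrite lt_neqAle xne /=); try apply/andP;
      clear -x0 xe eta0 etapi pi0; try split; lra.
  have sx : x / 2 * cos (x / 2) <= sin (x / 2).
    by apply: ler_xcos_sin; apply/andP; split; clear -x0 xe eta0 pi0; lra.
  have x20 : 0 <= x / 2 by clear -x0; lra.
  have : x / 2 * c0 <= sin (x / 2) by apply: le_trans sx; rewrite ler_wpM2l.
  move=> sx2.
  have : x / 2 * c0 * c0 <= sin (x / 2) * cos (x / 2).
    by apply: ler_pM => //; [rewrite mulr_ge0// ltW|exact: ltW].
  by clear; lra.
exists (c0 ^+ 2)^-1; first by rewrite invr_gt0 exprn_gt0.
move=> t /andP[t1 t2]; rewrite normc_cisB mulrC ler_pdivlMr ?exprn_gt0//.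
have xb : `|(t - t0) / 2| <= pi - eta.
  rewrite ler_norml /eta; have := ge_min t0 t0 (2 * pi - t0); rewrite lexx /= => m1.
  have := ge_min (2 * pi - t0) t0 (2 * pi - t0); rewrite lexx orbT => m2.
  by clear -m1 m2 t1 t2; apply/andP; split; lra.
have := key `|(t - t0) / 2|; rewrite normr_ge0 xb => /(_ isT).
rewrite normrM (ger0_norm (_ : 0 <= 2^-1)) ?invr_ge0//.
move=> le1; have le2 : sin (`|t - t0| / 2) <= `|sin ((t - t0) / 2)|.
  have [h|h] := leP 0 (t - t0); first by rewrite (ger0_norm h) ler_norm.
  by rewrite (ltr0_norm h) mulNr sinN -normrN ler_norm.
by clear -le1 le2; lra.
Qed.

(* Lebesgue points, with chordal distance to [z0] in place of arc length. *)
Definition lebesgueT (k : C -> C) (z0 : C) := forall e : R, 0 < e -> exists2 d : R, 0 < d &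
  forall s, 0 < s < d ->
    meanT (fun z => if normc (z - z0) < s then normc (k z - k z0) else 0) <= e * s.

(** Discards the point where the circle is cut open, so that [chord_lower] applies. *)
Lemma aeT_neq1 : @aeT R (fun z => z != 1).
Proof.
have h (a : R) : {ae mu, forall t : measurableTypeR R, t != a}.
  exists [set a]; split; [exact: measurable_set1|exact: lebesgue_measure_set1|].
  by move=> t /= /negP; rewrite negbK => /eqP.
rewrite /aeT; move: (h 0) (h (2 * pi)); apply: filterS2 => t t0 t2.
rewrite /arcT /= in_itv /= => /andP[t00 t2p]; apply/negP => /eqP e.
have : normc (cis t - cis (0 : R)) = 0 by rewrite {2}/cis cos0 sin0 e subrr normc0.
rewrite normc_cisB subr0 => /eqP; rewrite mulf_eq0 pnatr_eq0 /= normr_eq0 => /eqP.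
have : 0 < sin (t / 2).
  have t2' : t < 2 * pi by rewrite lt_neqAle t2.
  have t0' : 0 < t by rewrite lt_neqAle eq_sym t0.
  by apply: sin_gt0_pi; apply/andP; split; clear -t2' t0'; lra.
by move=> /gt_eqF /eqP.
Qed.

(** Lebesgue differentiation on the line, applied to [g] along [cis] extended by 0: points at
    chordal distance less than [s] from [cis t0] have their parameters in the ball of radius [c * s]
    around [t0]. *)
Lemma lebesgueT_real (k : C -> R) : aeint k -> aeT (lebesgueT (fun z => (k z)%:C)).
Proof.
move=> [g [ig kg]].
pose G := (fun t : R => g (cis t)) \_ (arcT : set R).
have := lebesgue_differentiation (integrable_locally_restrict (@measurable_arcT R) ig).
move: (@aeT_neq1) (kg); rewrite /aeT; apply: filterS3 => t0 n1 k1 lebG Dt0.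
have t0in : 0 < t0 < 2 * pi.
  have := Dt0; rewrite /arcT /= in_itv /= => /andP[t00 t2p].
  rewrite !lt_neqAle t00 t2p !andbT; apply/andP; split.
    by apply/negP => /eqP e; move: (n1 Dt0); rewrite -e /cis cos0 sin0 eqxx.
  by apply/negP => /eqP e; move: (n1 Dt0); rewrite e /cis [2 * _]mulr_natl cos2pi sin2pi eqxx.
have [c c0 chord] := chord_lower t0in.
have Gt0 : G t0 = g (cis t0) by rewrite /G patchE mem_set.
(* Chosen so that the integral bound [e' * (2 * (c * s))] divided by [2 * pi] is [e * s]. *)
move=> e e0; pose e' := e * pi / c.
have e'0 : 0 < e' by rewrite divr_gt0// mulr_gt0// pi_gt0.
move: lebG; rewrite /lebesgue_pt => /fine_cvgP[finG /cvgrPdist_le /(_ _ e'0)].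
move=> near1; have : \forall s \near (0 : R)^'+, davg G t0 s \is a fin_num /\
    `|0 - fine (davg G t0 s)| <= e'.
  by move: finG near1; apply: filterS2.
rewrite near_withinE => /nbhs_ballP[d d0 hd]; rewrite /= in d0.
exists (d / c); first by rewrite divr_gt0.
move=> s /andP[s0 sd].
have cs0 : 0 < c * s by rewrite mulr_gt0.
have csd : ball (0 : R) d (c * s).
  by rewrite /ball /= sub0r normrN gtr0_norm// mulrC -ltr_pdivlMr.
have [f1 f2] := hd _ csd cs0; rewrite sub0r normrN in f2.
have davg_le : (davg G t0 (c * s) <= e'%:E)%E.
  by rewrite -(fineK f1) lee_fin; apply: le_trans (ler_norm _) f2.
have int_le : (\int[mu]_(y in ball t0 (c * s)) `|(G y - G t0)%:E| <= (e' * (2 * (c * s)))%:E)%E.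
  move: davg_le; rewrite /davg /iavg lebesgue_measure_ball; last exact: ltW.
  rewrite inver mulrn_eq0 /= gt_eqF// => davg_le.
  rewrite EFinM -[leLHS]mule1.
  have -> : (1 = ((c * s) *+ 2)^-1%:E * (2 * (c * s))%:E :> \bar R)%E.
    by rewrite -EFinM mulr_natl mulVf// mulrn_eq0 /= gt_eqF.
  rewrite muleA lee_pmul2r//; first by rewrite muleC.
  by rewrite lte_fin mulr_gt0.
rewrite (@meanT_ae _ _ (fun z => if normc (z - cis t0) < s then `|g z - g (cis t0)| else 0)); last first.
  by apply: aeT_mono kg => z _ ->; rewrite k1// -rmorphB normc_real.
rewrite /meanT mulrC ler_pdivrMr; last exact: twopi_gt0.
have le1 : (\int[mu]_(t in arcT) (if normc (cis t - cis t0) < s then `|g (cis t) - g (cis t0)| else 0)%:E <=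
   \int[mu]_(y in ball t0 (c * s)) `|(G y - G t0)%:E|)%E.
  rewrite [leLHS]integral_mkcond [leRHS]integral_mkcond; apply: ge0_ae_le_integral.
  - by move=> x _; rewrite patchE; case: ifP => // _; rewrite lee_fin; case: ifP.
  - by move=> x _; rewrite patchE; case: ifP => // _; rewrite lee_fin.
  apply: aeW => t _; rewrite !patchE; case: ifPn => tA; last by case: ifP => // _; rewrite lee_fin.
  have [ts|ts] := ltP (normc (cis t - cis t0)) s; last first.
    by case: ifP => // _; rewrite lee_fin.
  rewrite ifT; last first.
    rewrite inE /ball /= distrC; apply: le_lt_trans (chord _ _) _.
      by move: tA; rewrite inE /arcT /= in_itv.
    by rewrite ltr_pM2l.
  by rewrite Gt0 /G patchE tA lee_fin.
have le2 := le_trans le1 int_le.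
rewrite -lee_fin; apply: le_trans (_ : (\int[mu]_(t in arcT) (if normc (cis t - cis t0) < s then `|g (cis t) - g (cis t0)| else 0)%:E <= _)%E).
  rewrite /Rintegral fineK// ge0_fin_numE; first by apply: le_lt_trans le2 _; rewrite ltry.
  by apply: integral_ge0 => t _; rewrite lee_fin; case: ifP.
apply: le_trans le2 _; rewrite lee_fin /e' le_eqVlt; apply/orP; left; apply/eqP; field.
by rewrite gt_eqF.
Qed.

Lemma aemeas_near (z0 : C) (s : R) (l : C -> R) : aemeas l ->
  aemeas (fun z : C => if normc (z - z0) < s then l z else 0).
Proof.
move=> [g [mg lg]]; exists (fun z : C => if normc (z - z0) < s then g z else 0); split.
  apply: measurable_fun_if => //.
  - exact: measurable_arcT.
  - apply: (@measurable_fun_ltr _ (measurableTypeR R) R _ (fun t => normc (cis t - z0)) (fun=> s)) => //.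
    apply: measurable_funTS; apply: continuous_measurable_fun => t.
    apply: cvgC_norm; apply: cvgCB; [exact: continuous_cis|exact: cvg_cst].
  - by apply: (measurable_funS (@measurable_arcT R) _ mg) => x [].
by apply: aeT_mono lg => z _ ->.
Qed.

Lemma lebesgueT_L1 (k : C -> C) : L1 k -> aeT (lebesgueT k).
Proof.
move=> Lk; have /L1P[i1 i2] := Lk.
apply: aeT_mono2 (lebesgueT_real i1) (lebesgueT_real i2) => z0 _ h1 h2 e e0.
have [d1 d10 {}h1] := h1 (e / 2) ltac:(by rewrite divr_gt0).
have [d2 d20 {}h2] := h2 (e / 2) ltac:(by rewrite divr_gt0).
exists (Num.min d1 d2); first by rewrite lt_min d10.
move=> s /andP[s0]; rewrite lt_min => /andP[s1 s2].
have := h1 s; rewrite s0 s1 => /(_ isT) {}h1; have := h2 s; rewrite s0 s2 => /(_ isT) {}h2.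
have ia (l : C -> R) : aeint l ->
    aeint (fun z => if normc (z - z0) < s then normc ((l z)%:C - (l z0)%:C) else 0).
  move=> il; have il' := aeint_norm (aeintB il (aeint_cst (l z0))).
  have il2 : aeint (fun z => normc ((l z)%:C - (l z0)%:C)).
    by apply: aeint_ae il'; apply: aeT_all => z _; rewrite -rmorphB normc_real.
  apply: aeint_le (aemeas_near _ _ (aeint_aemeas il2)) il2 _.
  by apply: aeT_all => z _; case: ifP => _; rewrite ?normr0 ?ger0_norm ?normc_ge0.
apply: le_trans (_ : meanT (fun z => (if normc (z - z0) < s then normc ((complex.Re (k z))%:C - (complex.Re (k z0))%:C) else 0) + (if normc (z - z0) < s then normc ((complex.Im (k z))%:C - (complex.Im (k z0))%:C) else 0)) <= _).
  apply: meanT_le.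
  - have [_ il] := L1B Lk (L1_cst (k z0)).
    apply: aeint_le (aemeas_near _ _ (aeint_aemeas il)) il _.
    by apply: aeT_all => z _; case: ifP => _; rewrite ?normr0 ?ger0_norm ?normc_ge0.
  - by apply: aeintD; apply: ia.
  apply: aeT_all => z _; case: ifP => _; last by rewrite addr0.
  by rewrite -!rmorphB !normc_real -cReN -cReD -cImN -cImD normc_leReIm.
by rewrite meanTD; [clear -h1 h2; lra|exact: ia|exact: ia].
Qed.

(** Majorizes the kernel by a combination of indicators of dyadic arcs, which Lebesgue points can
    handle. Outside the arc of radius [2 ^+ N * (1 - r)] the kernel is at most
    [8 / (4 ^+ N * (1 - r))], because [|zeta - z0| <= 2 |zeta - r z0|] and [1 + r <= 2]; the shift
    to [N.+1] turns 8 into 32. *)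
Lemma poisson_dyadic (z0 : C) (r : R) (zeta : C) (N : nat) : normc z0 = 1 -> normc zeta = 1 ->
  0 <= r < 1 -> poisson (r%:C * z0) zeta <=
  \sum_(j < N) (if normc (zeta - z0) < 2 ^+ j * (1 - r) then 32 / (4 ^+ j * (1 - r)) else 0) +
    32 / (4 ^+ N * (1 - r)).
Proof.
move=> z01 zeta1 /andP[r0 r1]; have d0 : 0 < 1 - r by rewrite subr_gt0.
have nrz : normc (r%:C * z0) = r by rewrite normcM z01 mulr1 normc_real ger0_norm.
rewrite poissonE ?nrz//; set n := normc (zeta - r%:C * z0); set s := normc (zeta - z0).
have nd : 1 - r <= n.
  by have := lec_normc_sub zeta (r%:C * z0); rewrite zeta1 nrz; apply: le_trans (ler_norm _).
have n0 : 0 < n := lt_le_trans d0 nd.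
have sn : s <= 2 * n.
  have : s <= n + (1 - r).
    rewrite /s (_ : zeta - z0 = (zeta - r%:C * z0) + (r%:C - 1) * z0); last by ring.
    apply: le_trans (le_normcD _ _) _; rewrite lerD2l normcM z01 mulr1.
    by rewrite -(rmorph1 (real_complex R)) -rmorphB normc_real distrC gtr0_norm.
  by clear -nd; lra.
have s0 : 0 <= s := normc_ge0 _.
elim: N => [|N IH].
  rewrite big_ord0 add0r expr0 mul1r ler_pdivrMr ?exprn_gt0//.
  rewrite mulrAC ler_pdivlMr//.
  have : (1 - r) ^+ 2 <= n ^+ 2 by rewrite ler_sqr ?nnegrE ?(ltW d0) ?(ltW n0).
  by have := mulr_ge0 (sqr_ge0 (1 - r)) (ltW d0); have := sqr_ge0 n; clear; lra.
have [sN|sN] := ltP s (2 ^+ N * (1 - r)).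
  apply: le_trans IH _; rewrite big_ord_recr /= sN -addrA lerD2l lerDl.
  by rewrite divr_ge0// mulr_ge0 ?exprn_ge0 ?(ltW d0).
apply: le_trans (_ : 32 / (4 ^+ N.+1 * (1 - r)) <= _); last first.
  rewrite lerDr; apply: sumr_ge0 => j _; case: ifP => // _.
  by rewrite divr_ge0// mulr_ge0 ?exprn_ge0 ?(ltW d0).
have p4 : 0 < 4 ^+ N :> R by rewrite exprn_gt0.
have s2 : 4 ^+ N * (1 - r) ^+ 2 <= s ^+ 2.
  have -> : 4 ^+ N * (1 - r) ^+ 2 = (2 ^+ N * (1 - r)) ^+ 2.
    by rewrite exprMn -exprM mulnC exprM (_ : 2 ^+ 2 = 4 :> R)// -natrX.
  by rewrite ler_sqr ?nnegrE// mulr_ge0 ?exprn_ge0 ?(ltW d0).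
have s3 : s ^+ 2 <= 4 * n ^+ 2.
  have -> : 4 * n ^+ 2 = (2 * n) ^+ 2 by ring.
  by rewrite ler_sqr ?nnegrE ?mulr_ge0 ?(ltW n0).
rewrite ler_pdivrMr ?exprn_gt0// mulrAC ler_pdivlMr ?mulr_gt0 ?exprn_gt0//.
rewrite [4 ^+ N.+1]exprS; set q := 4 ^+ N in p4 s2 *.
have h1 : (1 + r) <= 2 by clear -r1; lra.
have -> : (1 - r ^+ 2) * (4 * q * (1 - r)) = (1 + r) * (4 * (q * (1 - r) ^+ 2)) by ring.
have h2 : 0 <= q * (1 - r) ^+ 2 by rewrite mulr_ge0 ?sqr_ge0 ?(ltW p4).
by clear -h1 h2 s2 s3; nra.
Qed.

(** On the arc of radius [2 ^+ j * (1 - r)] the Lebesgue point condition gains that radius against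
    the weight [32 / (4 ^+ j * (1 - r))], which leaves a geometric series. Beyond the last arc the
    kernel is of size [(1 - r) / d ^+ 2]. *)
Lemma fatou_poisson (k : C -> C) (z0 : C) : normc z0 = 1 -> L1 k -> lebesgueT k z0 ->
  (fun r : R => meanTC (fun z => (poisson (r%:C * z0) z)%:C * k z) : C^o) @ (1 : R)^'- -->
    (k z0 : C^o).
Proof.
move=> z01 Lk leb; apply/cvgC_normc/cvgrPdist_le => e e0.
(* Each arc then contributes at most [32 * (e / 128) = e / 4] times [2^-j], in total [e / 2]. *)
have e128 : 0 < e / 128 by rewrite divr_gt0.
have [d d0 hd] := leb _ e128.
have Ld := L1B Lk (L1_cst (k z0)); have [mD iD] := Ld.
pose A := meanT (fun z => normc (k z - k z0)).
have A0 : 0 <= A by apply: meanT_ge0; apply: aeT_all => z _; exact: normc_ge0.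
apply: near_left1; exists (Num.min 1 (Num.min d (e * d ^+ 2 / (64 * (A + 1))))).
  by rewrite !lt_min ltr01 d0 divr_gt0 ?mulr_gt0 ?exprn_gt0// ltr_wpDl.
move=> r /andP[]; rewrite ltrBlDr -ltrBlDl !lt_min => /andP[rd1 /andP[rd rdA]] r1.
have r0 : 0 <= r by clear -rd1; lra.
have del0 : 0 < 1 - r by rewrite subr_gt0.
have nrz : normc (r%:C * z0) < 1 by rewrite normcM z01 mulr1 normc_real ger0_norm.
rewrite sub0r normrN ger0_norm ?normc_ge0//.
(* The least such [N]: all earlier arcs have radius below [d], where the Lebesgue point condition is
   available, while the tail coefficient is at most [32 * (1 - r) / d ^+ 2]. *)
have exN : exists N, d <= 2 ^+ N * (1 - r).
  have [n nP] : exists n : nat, d / (1 - r) < n%:R.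
    by exists (Num.truncn (d / (1 - r))).+1; exact: truncnS_gt.
  exists n; rewrite -ler_pdivrMr//; apply: ltW; apply: lt_trans nP _.
  by rewrite -natrX ltr_nat; exact: ltn_expl.
have [N hN minN] := ex_minnP exN.
have small j : (j < N)%N -> 2 ^+ j * (1 - r) < d.
  by move=> jN; rewrite ltNge; apply/negP => /minN; rewrite leqNgt jN.
have -> : meanTC (fun z => (poisson (r%:C * z0) z)%:C * k z) - k z0 =
    meanTC (fun z => (poisson (r%:C * z0) z)%:C * (k z - k z0)).
  have e1 : meanTC (fun z => (poisson (r%:C * z0) z)%:C * k z0) = k z0.
    rewrite (@meanTC_ae _ _ (fun z => k z0 * (poisson (r%:C * z0) z)%:C)); last first.
      by apply: aeT_all => z _; rewrite mulrC.
    rewrite meanTCZ; first by rewrite meanTC_real meanT_poisson// mulr1.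
    apply: L1_ae (L1_poisson nrz (L1_cst 1)).
    by apply: aeT_all => z _; rewrite mulr1.
  transitivity (meanTC (fun z => (poisson (r%:C * z0) z)%:C * k z) -
    meanTC (fun z => (poisson (r%:C * z0) z)%:C * k z0)); first by rewrite e1.
  rewrite -meanTCB; [|exact: L1_poisson|exact: L1_poisson (L1_cst _)].
  by apply: meanTC_ae; apply: aeT_all => z _; rewrite mulrBr.
apply: le_trans (meanTC_norm (L1_poisson nrz Ld)) _.
pose ind j z := if normc (z - z0) < 2 ^+ j * (1 - r) then normc (k z - k z0) else 0.
have iind j : aeint (ind j).
  apply: aeint_le (aemeas_near _ _ (aeint_aemeas iD)) iD _.
  by apply: aeT_all => z _; case: ifP => _; rewrite ?normr0 ?ger0_norm ?normc_ge0.
have isum M : aeint (fun z => \sum_(j < M) 32 / (4 ^+ j * (1 - r)) * ind j z) /\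
   meanT (fun z => \sum_(j < M) 32 / (4 ^+ j * (1 - r)) * ind j z) =
   \sum_(j < M) 32 / (4 ^+ j * (1 - r)) * meanT (ind j).
  elim: M => [|M [IH1 IH2]].
    split; first by apply: aeint_ae (aeint_cst 0); apply: aeT_all => z _; rewrite big_ord0.
    rewrite big_ord0 -[RHS](@meanT_cst R); apply: meanT_ae; apply: aeT_all => z _; by rewrite big_ord0.
  have eM : aeT (fun z => \sum_(j < M.+1) 32 / (4 ^+ j * (1 - r)) * ind j z =
    \sum_(j < M) 32 / (4 ^+ j * (1 - r)) * ind j z + 32 / (4 ^+ M * (1 - r)) * ind M z).
    by apply: aeT_all => z _; rewrite big_ord_recr.
  have iM := aeintZ (32 / (4 ^+ M * (1 - r))) (iind M).
  split; first by apply: aeint_ae eM (aeintD IH1 iM).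
  by rewrite (meanT_ae eM) meanTD// IH2 meanTZ// big_ord_recr.
have [is1 is2] := isum N.
apply: le_trans (_ : meanT (fun z => \sum_(j < N) 32 / (4 ^+ j * (1 - r)) * ind j z +
    32 / (4 ^+ N * (1 - r)) * normc (k z - k z0)) <= _).
  apply: meanT_le; [by case: (L1_poisson nrz Ld)|by apply: aeintD => //; exact: aeintZ|].
  apply: aeT_all => z z1; rewrite normcM normc_real ger0_norm ?poisson_ge0//.
  have := @poisson_dyadic z0 r z N z01 z1; rewrite r0 r1 => /(_ isT).
  move=> /(ler_wpM2r (normc_ge0 (k z - k z0)))/le_trans; apply.
  rewrite mulrDl lerD2r mulr_suml; apply: ler_sum => j _.
  by rewrite /ind; case: ifP => _; rewrite ?mul0r ?mulr0.
rewrite meanTD//; last exact: aeintZ.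
rewrite is2 meanTZ// -/A.
have part1 : \sum_(j < N) 32 / (4 ^+ j * (1 - r)) * meanT (ind j) <= e / 2.
  apply: le_trans (_ : \sum_(j < N) e / 4 * 2^-1 ^+ j <= _).
    apply: ler_sum => j _.
    have jd : 0 < 2 ^+ j * (1 - r) < d by rewrite small// mulr_gt0// exprn_gt0.
    apply: le_trans (ler_wpM2l _ (hd _ jd)) _.
      by rewrite divr_ge0// mulr_ge0 ?exprn_ge0 ?(ltW del0).
    rewrite le_eqVlt; apply/orP; left; apply/eqP.
    have -> : 4 ^+ j = 2 ^+ j * 2 ^+ j :> R by rewrite -exprMn -natrM.
    rewrite exprVn; field.
    by rewrite expf_neq0// gt_eqF.
  rewrite -mulr_sumr.
  have : \sum_(j < N) 2^-1 ^+ j <= 2 :> R.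
    have -> : \sum_(j < N) 2^-1 ^+ j = 2 - 2 * 2^-1 ^+ N :> R.
      elim: (N) => [|M IH]; first by rewrite big_ord0 expr0; ring.
      by rewrite big_ord_recr /= IH exprS; field.
    by rewrite gerBl mulr_ge0// exprn_ge0// invr_ge0.
  by move=> h; have := ler_wpM2l (ltW e0) h; clear; lra.
have part2 : 32 / (4 ^+ N * (1 - r)) * A <= e / 2.
  rewrite mulrAC ler_pdivrMr; last by rewrite mulr_gt0// exprn_gt0.
  have d2 : d ^+ 2 <= 4 ^+ N * (1 - r) ^+ 2.
    have -> : 4 ^+ N * (1 - r) ^+ 2 = (2 ^+ N * (1 - r)) ^+ 2.
      by rewrite exprMn -exprM mulnC exprM (_ : 2 ^+ 2 = 4 :> R)// -natrX.
    by rewrite ler_sqr ?nnegrE ?(ltW d0) ?(le_trans (ltW d0) hN).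
  have A1 : 0 < A + 1 by rewrite ltr_wpDl.
  move: rdA; rewrite ltr_pdivlMr ?mulr_gt0// => rdA.
  rewrite -(ler_pM2r del0).
  have h2 := ler_wpM2l (ltW e0) d2.
  have h3 : A * (1 - r) <= (A + 1) * (1 - r) by rewrite ler_wpM2r ?(ltW del0)// lerDl.
  by clear -h2 h3 rdA; lra.
by clear -part1 part2; lra.
Qed.

End fatou.

Lemma half01 (R : realType) : 0 < (2^-1 : R) < 1.
Proof. by apply/andP; split; rewrite ?invr_gt0 ?invf_lt1 ?ltr1n. Qed.

(** * Boundary functions of H^2 *)

Section taylor_expansion.
Context {R : realType}.
Local Notation C := R[i].
Implicit Types (f g k : C -> C) (z w : C).

(** A version valid at a prescribed point of continuity, whereas Fatou's theorem leaves out an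
    unknown null set. At distance at least [eta] from [z0] the kernel is at most
    [8 * (1 - r) / eta ^+ 2]. *)
Lemma poisson_continuous k (z0 : C) : normc z0 = 1 -> L1 k ->
  (forall e : R, 0 < e -> exists2 eta : R, 0 < eta &
    forall z, normc z = 1 -> normc (z - z0) < eta -> normc (k z - k z0) <= e) ->
  (fun r : R => meanTC (fun z => (poisson (r%:C * z0) z)%:C * k z) : C^o) @ (1 : R)^'- -->
    (k z0 : C^o).
Proof.
move=> z01 Lk ck; apply/cvgC_normc/cvgrPdist_le => e e0.
have [eta eta0 hk] := ck _ (divr_gt0 e0 (ltr0Sn _ 1)).
have Ld := L1B Lk (L1_cst (k z0)); have [mD iD] := Ld.
pose A := meanT (fun z => normc (k z - k z0)).
have A0 : 0 <= A by apply: meanT_ge0; apply: aeT_all => z _; exact: normc_ge0.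
have A1 : 0 < A + 1 by rewrite ltr_wpDl.
apply: near_left1; exists (Num.min 1 (e * eta ^+ 2 / (16 * (A + 1)))).
  by rewrite lt_min ltr01 divr_gt0 ?mulr_gt0 ?exprn_gt0.
move=> r /andP[]; rewrite ltrBlDr -ltrBlDl !lt_min => /andP[rd1 rdA] r1.
have r0 : 0 <= r by clear -rd1; lra.
have del0 : 0 < 1 - r by rewrite subr_gt0.
have nrz : normc (r%:C * z0) = r by rewrite normcM z01 mulr1 normc_real ger0_norm.
have nrz1 : normc (r%:C * z0) < 1 by rewrite nrz.
rewrite sub0r normrN ger0_norm ?normc_ge0//.
have -> : meanTC (fun z => (poisson (r%:C * z0) z)%:C * k z) - k z0 =
    meanTC (fun z => (poisson (r%:C * z0) z)%:C * (k z - k z0)).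
  have e1 : meanTC (fun z => (poisson (r%:C * z0) z)%:C * k z0) = k z0.
    rewrite (@meanTC_ae _ _ (fun z => k z0 * (poisson (r%:C * z0) z)%:C)); last first.
      by apply: aeT_all => z _; rewrite mulrC.
    rewrite meanTCZ; first by rewrite meanTC_real meanT_poisson// mulr1.
    apply: L1_ae (L1_poisson nrz1 (L1_cst 1)).
    by apply: aeT_all => z _; rewrite mulr1.
  transitivity (meanTC (fun z => (poisson (r%:C * z0) z)%:C * k z) -
    meanTC (fun z => (poisson (r%:C * z0) z)%:C * k z0)); first by rewrite e1.
  rewrite -meanTCB; [|exact: L1_poisson|exact: L1_poisson (L1_cst _)].
  by apply: meanTC_ae; apply: aeT_all => z _; rewrite mulrBr.
have LP := L1_poisson nrz1 Ld.
apply: le_trans (meanTC_norm LP) _.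
have iP : aeint (poisson (r%:C * z0)).
  have /L1P[+ _] := L1_poisson nrz1 (L1_cst 1).
  by apply: aeint_ae; apply: aeT_all => z _; rewrite mulr1.
apply: le_trans (_ : meanT (fun z => e / 2 * poisson (r%:C * z0) z +
   8 * (1 - r) / eta ^+ 2 * normc (k z - k z0)) <= _).
  apply: meanT_le; [by case: LP|by apply: aeintD; apply: aeintZ|].
  apply: aeT_all => z z1; have p0 := poisson_ge0 z1 nrz1.
  rewrite normcM normc_real ger0_norm//.
  have [near|far] := ltP (normc (z - z0)) eta.
    apply: (@le_trans _ _ (e / 2 * poisson (r%:C * z0) z)).
      by rewrite mulrC ler_wpM2r// hk.
    by rewrite lerDl mulr_ge0 ?normc_ge0// divr_ge0 ?sqr_ge0// mulr_ge0 ?(ltW del0).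
  apply: (@le_trans _ _ (8 * (1 - r) / eta ^+ 2 * normc (k z - k z0))); last first.
    by rewrite lerDr mulr_ge0// ltW// divr_gt0.
  rewrite ler_wpM2r ?normc_ge0// poissonE// nrz.
  set n := normc (z - r%:C * z0).
  have nd : 1 - r <= n.
    by have := lec_normc_sub z (r%:C * z0); rewrite z1 nrz; apply: le_trans (ler_norm _).
  have n0 : 0 < n := lt_le_trans del0 nd.
  have sn : eta <= 2 * n.
    apply: le_trans far _.
    have : normc (z - z0) <= n + (1 - r).
      rewrite (_ : z - z0 = (z - r%:C * z0) + (r%:C - 1) * z0); last by ring.
      apply: le_trans (le_normcD _ _) _; rewrite lerD2l normcM z01 mulr1.
      by rewrite -(rmorph1 (real_complex R)) -rmorphB normc_real distrC gtr0_norm.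
    by clear -nd; lra.
  have s3 : eta ^+ 2 <= 4 * n ^+ 2.
    have -> : 4 * n ^+ 2 = (2 * n) ^+ 2 by ring.
    by rewrite ler_sqr ?nnegrE ?mulr_ge0 ?(ltW n0) ?(ltW eta0).
  rewrite ler_pdivrMr ?exprn_gt0// mulrAC ler_pdivlMr ?exprn_gt0//.
  have -> : (1 - r ^+ 2) = (1 - r) * (1 + r) by ring.
  have := ler_wpM2l (mulr_ge0 (ltW del0) (addr_ge0 ler01 r0)) s3.
  have : (1 - r) * (1 + r) * (4 * n ^+ 2) <= 8 * (1 - r) * n ^+ 2.
    rewrite -subr_ge0; have -> : 8 * (1 - r) * n ^+ 2 - (1 - r) * (1 + r) * (4 * n ^+ 2) = 4 * n ^+ 2 * ((1 - r) * (1 - r)) by ring.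
    apply: mulr_ge0; first exact: mulr_ge0 (ler0n _ 4) (sqr_ge0 _).
    by apply: mulr_ge0; exact: ltW.
  by move=> h1 h2; exact: le_trans h2 h1.
rewrite meanTD; [|exact: aeintZ|exact: aeintZ].
rewrite !meanTZ// meanT_poisson// mulr1 -/A.
have : 8 * (1 - r) / eta ^+ 2 * A <= e / 2.
  rewrite mulrAC ler_pdivrMr ?exprn_gt0//.
  move: rdA; rewrite ltr_pdivlMr ?mulr_gt0// => rdA.
  have : A * (1 - r) <= (A + 1) * (1 - r) by rewrite ler_wpM2r ?(ltW del0)// lerDl.
  by clear -rdA; lra.
by clear; lra.
Qed.

Lemma cauchyK_geometric w (zeta : C) N : normc zeta = 1 -> normc w < 1 ->
  cauchyK w zeta = \sum_(m < N) w ^+ m * zeta^* ^+ m + w ^+ N * (zeta^* ^+ N * cauchyK w zeta).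
Proof.
move=> z1 w1; have d0 := cauchy_den_neq0 z1 w1.
have kk : cauchyK w zeta * (1 - w * zeta^*) = 1 by rewrite mulVf.
apply: (mulIf d0); rewrite mulrDl kk -!mulrA kk mulr1 -exprMn.
under eq_bigr do rewrite -exprMn.
rewrite -[LHS](subrK ((w * zeta^*) ^+ N)); congr (_ + _).
by rewrite -opprB subrX1 -mulNr opprB mulrC.
Qed.

Lemma L1_circle f (r : R) : 0 <= r < 1 -> holomorphicD f -> L1 (fun z => f (r%:C * z)).
Proof.
move=> /andP[r0 r1] hf; apply: L1_continuous; apply: continuous_circle => z.
by rewrite ger0_norm// => zr; apply: holomorphicD_holo => //; rewrite zr.
Qed.

Lemma measT_conjX n : measT (fun z : C => z^* ^+ n).
Proof. by apply: measurableTX; apply: measurableT_conj; exact: measurableT_id. Qed.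

Lemma conjX_bound n : aeT (fun z : C => normc (z^* ^+ n) <= 1).
Proof. by apply: aeT_all => z z1; rewrite normcX normc_conj z1 expr1n. Qed.

Lemma L1_conjX n g : L1 g -> L1 (fun z => z^* ^+ n * g z).
Proof. by apply: L1_bounded_mul; [exact: measT_conjX|exact: conjX_bound]. Qed.

Lemma L1_X n g : L1 g -> L1 (fun z => z ^+ n * g z).
Proof.
apply: (@L1_bounded_mul _ _ _ 1); first exact: measurableTX measurableT_id.
by apply: aeT_all => z z1; rewrite normcX z1 expr1n.
Qed.

Lemma geometric_cvg0 (x c : R) : 0 <= x < 1 -> (fun n : nat => x ^+ n * c) @ \oo --> (0 : R).
Proof.
move=> /andP[x0 x1]; rewrite -(mul0r c); apply: cvgMl; apply: cvg_expr.
by rewrite ger0_norm.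
Qed.

Lemma meanTC_conj_cauchy f (r : R) (v : C) : holomorphicD f -> 0 < r < 1 -> normc v < 1 ->
  meanTC (fun w => (1 - v^* * w)^-1 * f (r%:C * w)) = f 0.
Proof.
move=> hf /andP[r0 r1] v1; have v0 := normc_ge0 v.
have dv0 : 0 < 1 + normc v by rewrite ltr_pwDl.
have b1 : 1 < Num.min r^-1 (2 / (1 + normc v)).
  by rewrite lt_min invf_gt1// r1 ltr_pdivlMr// mul1r; move: v1; clear; lra.
rewrite (mean_value_large b1); first by rewrite !mulr0 subr0 invr1 mul1r.
move=> w; rewrite lt_min => /andP[wr1 w1].
have {}wr1 : normc w * r < 1 by rewrite -ltr_pdivlMr ?div1r.
have {}w1 : normc w * (1 + normc v) < 2 by rewrite -ltr_pdivlMr.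
apply: holoM.
  apply: holoV; last by apply: holoB; [exact: holo_cst|apply: holoM; [exact: holo_cst|exact: holo_id]].
  rewrite -normc_gt0; have := lec_normc_sub 1 (v^* * w).
  rewrite normc1 normcM normc_conj; have := ler_norm (1 - normc v * normc w).
  by have := normc_ge0 w; move: v1 w1 v0; clear; nra.
apply: (@holo_comp _ (fun w => r%:C * w) f); first by apply: holoM; [exact: holo_cst|exact: holo_id].
by apply: holomorphicD_holo => //; rewrite normcM normc_real gtr0_norm// mulrC.
Qed.

Lemma cvg_radial (w : C) : (fun s : R => s%:C * w : C^o) @ (1 : R)^'- --> (w : C^o).
Proof.
rewrite -[X in _ --> X](mul1r w); apply: cvgCM; last exact: cvg_cst.
by apply: cvgC_real; apply: cvg_at_left_filter; exact: cvg_id.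
Qed.

Lemma holo_radial f (w : C) : holo f w ->
  (fun s : R => f (s%:C * w) : C^o) @ (1 : R)^'- --> (f w : C^o).
Proof.
move=> /holo_continuous cf; apply: (cvg_comp (fun s : R => s%:C * w : C^o) (f : C^o -> C^o)); last exact: cf.
exact: cvg_radial.
Qed.

(** The coefficients are Fourier coefficients on the circle of radius 1/2; any radius gives the same
    ones, since [f w / w ^+ n] is holomorphic off 0. Expanding the kernel shows that the power
    series sums to a Cauchy integral [Phi]. That [Phi] reproduces [f] follows by comparing two
    limits along a radius: Poisson integrals over the circle through [z] tend to [f z], and they
    agree with values of the continuous function [Phi]. *)
Lemma taylor f : holomorphicD f -> exists a : nat -> C,
  [/\ forall r n, 0 < r < 1 -> meanTC (fun z => z^* ^+ n * f (r%:C * z)) = a n * r%:C ^+ n,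
      forall r n, 0 < r < 1 -> meanTC (fun z => z ^+ n.+1 * f (r%:C * z)) = 0 &
      forall z, normc z < 1 -> (fun N => \sum_(i < N) a i * z ^+ i : C^o) @ \oo --> (f z : C^o)].
Proof.
move=> hf.
pose a n := meanTC (fun z => f ((2^-1)%:C * z) * ((2^-1)%:C * z) ^- n).
have aE r n : 0 < r < 1 -> meanTC (fun z => z^* ^+ n * f (r%:C * z)) = a n * r%:C ^+ n.
  move=> /andP[r0 r1].
  pose g w := f w * w ^- n.
  have hg z : 0 < normc z < 1 -> holo g z.
    move=> /andP[z0 z1]; apply: holoM; first exact: holomorphicD_holo.
    apply: holoV; first by rewrite expf_neq0// -normc_gt0.
    by apply: holoX; exact: holo_id.
  have half := half01 R.
  have -> : a n = meanTC (fun z => g (r%:C * z)).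
    move: half => /andP[h0 h1].
    have [rh|hr|->] := ltgtP r 2^-1.
    - by rewrite (@meanTC_circles _ g r 2^-1) ?r0.
    - by rewrite -(@meanTC_circles _ g 2^-1 r) ?h0.
    - by [].
  have rn : r%:C ^+ n != 0 :> C by rewrite expf_neq0// -normc_gt0 normc_real normr_gt0 gt_eqF.
  have Lf : L1 (fun z => f (r%:C * z)) by apply: L1_circle; rewrite ?(ltW r0).
  have eg : aeT (fun z => g (r%:C * z) = (r%:C ^+ n)^-1 * (z^* ^+ n * f (r%:C * z))).
    apply: aeT_all => z z1; rewrite /g exprMn invfM.
    have -> : z ^- n = z^* ^+ n.
      rewrite -exprVn; congr (_ ^+ _); have z0 : z != 0 by rewrite -normc_gt0 z1.
      by apply: (mulfI z0); rewrite divff// circle_conj.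
    by ring.
  rewrite (meanTC_ae eg) meanTCZ; last exact: L1_conjX.
  by rewrite mulrAC mulVf// mul1r.
have a0 r n : 0 < r < 1 -> meanTC (fun z => z ^+ n.+1 * f (r%:C * z)) = 0.
  move=> /andP[r0 r1].
  have hg : holomorphicD (fun w => w ^+ n.+1 * f w).
    move=> z /disc_normc z1; apply: holoM; first by apply: holoX; exact: holo_id.
    exact: holomorphicD_holo.
  have := mean_value hg; move=> /(_ r); rewrite (ltW r0) r1 => /(_ isT).
  rewrite expr0n /= mul0r => h.
  have rn : r%:C ^+ n.+1 != 0 :> C by rewrite expf_neq0// -normc_gt0 normc_real normr_gt0 gt_eqF.
  apply: (mulfI rn); rewrite mulr0 -h -meanTCZ.
    by apply: meanTC_ae; apply: aeT_all => z _; rewrite exprMn mulrA.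
  by apply: L1_X; apply: L1_circle; rewrite ?(ltW r0).
exists a; split => //.
have expand r w : 0 < r < 1 -> normc w < 1 ->
   (fun N => \sum_(i < N) a i * (r%:C * w) ^+ i : C^o) @ \oo -->
     (meanTC (fun z => cauchyK w z * f (r%:C * z)) : C^o).
  move=> r01 w1; have /andP[r0 r1] := r01.
  have Lf : L1 (fun z => f (r%:C * z)) by apply: L1_circle; rewrite ?(ltW r0).
  have LK := L1_cauchyK w1 Lf.
  apply: (@cvgC_dist_le _ _ _ _ _ (fun N => normc w ^+ N * meanT (fun z => normc (cauchyK w z * f (r%:C * z))))); last first.
    by apply: geometric_cvg0; rewrite normc_ge0.
  apply: nearW => N.
  have eK : meanTC (fun z => cauchyK w z * f (r%:C * z)) =
     \sum_(i < N) a i * (r%:C * w) ^+ i + w ^+ N * meanTC (fun z => z^* ^+ N * (cauchyK w z * f (r%:C * z))).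
    rewrite (@meanTC_ae _ _ (fun z => \sum_(i < N) (w ^+ i * (z^* ^+ i * f (r%:C * z))) +
        w ^+ N * (z^* ^+ N * (cauchyK w z * f (r%:C * z))))); last first.
      apply: aeT_all => z z1; rewrite [in LHS](cauchyK_geometric N z1 w1) mulrDl mulr_suml; congr (_ + _).
        by apply: eq_bigr => i _; ring.
      by ring.
    rewrite meanTCD; last by apply: L1Z; exact: L1_conjX.
      rewrite meanTC_sum; last by move=> i; apply: L1Z; exact: L1_conjX.
      rewrite meanTCZ; last exact: L1_conjX.
      congr (_ + _); apply: eq_bigr => i _; rewrite meanTCZ; last exact: L1_conjX.
      by rewrite aE// exprMn; ring.
    by apply: L1_sum => i; apply: L1Z; exact: L1_conjX.
  rewrite eK opprD addrA subrr sub0r normcN normcM normcX ler_wpM2l ?exprn_ge0 ?normc_ge0//.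
  apply: le_trans (meanTC_norm (L1_conjX N LK)) _.
  rewrite le_eqVlt; apply/orP; left; apply/eqP; apply: meanT_ae.
  by apply: aeT_all => z z1; rewrite [LHS]normcM normcX normc_conj z1 expr1n mul1r.
move=> z z1.
have [->|z0] := eqVneq z 0.
  have h01 := half01 R.
  have n01 : normc (0 : C) < 1 by rewrite normc0.
  have := expand 2^-1 0 h01 n01; rewrite mulr0.
  rewrite (@meanTC_ae _ _ (fun z => f ((2^-1)%:C * z))); last first.
    by apply: aeT_all => w _; rewrite /cauchyK mul0r subr0 invr1 mul1r.
  by rewrite mean_value//; move: h01 => /andP[? ?]; apply/andP; split => //; exact: ltW.
pose r1 := normc z; have r10 : 0 < r1 by rewrite normc_gt0.
pose r := (1 + r1) / 2.
have r1r : r1 < r by rewrite /r; move: z1; rewrite -/r1; clear; lra.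
have r_1 : r < 1 by rewrite /r; move: z1; rewrite -/r1; clear; lra.
have r_0 : 0 < r := lt_trans r10 r1r.
pose z0' := z / r1%:C.
have r1C : r1%:C != 0 :> C by rewrite -normc_gt0 normc_real normr_gt0 gt_eqF.
have z0'1 : normc z0' = 1.
  by rewrite /z0' normcM normcV normc_real gtr0_norm// divff// gt_eqF.
have zE : z = r1%:C * z0' by rewrite mulrC divfK.
have Lf1 : L1 (fun z => f (r1%:C * z)) by apply: L1_circle; rewrite ?(ltW r10).
have Lfr : L1 (fun z => f (r%:C * z)) by apply: L1_circle; rewrite ?(ltW r_0).
have rC : r%:C != 0 :> C by rewrite -normc_gt0 normc_real normr_gt0 gt_eqF.
pose Phi w := meanTC (fun z => cauchyK w z * f (r%:C * z)).
have zr1 : normc (z / r%:C) < 1.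
  by rewrite normcM normcV normc_real gtr0_norm// ltr_pdivrMr// mul1r.
have lim1 : (fun s : R => meanTC (fun w => (poisson (s%:C * z0') w)%:C * f (r1%:C * w)) : C^o) @ (1 : R)^'- --> (f z : C^o).
  rewrite zE; apply: (@poisson_continuous (fun w => f (r1%:C * w))) => // e e0.
  have [d d0 hd] := holo_delta (holomorphicD_holo hf z1) e0.
  exists (d / r1); first by rewrite divr_gt0.
  move=> w w1; rewrite ltr_pdivlMr// => wd; rewrite -zE ltW// hd//.
  by rewrite zE -mulrBr normcM normc_real gtr0_norm// mulrC.
(* The conjugate kernel yields [f 0], which cancels the mean of [f], so the Poisson integral is a
   Cauchy integral. Both sides are then sums of the series with terms [a i * (s * z) ^+ i], obtained
   from two different radii. *)
have eqP s : 0 < s < 1 -> meanTC (fun w => (poisson (s%:C * z0') w)%:C * f (r1%:C * w)) =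
   Phi (s%:C * (z / r%:C)).
  move=> /andP[s0 s1].
  have ns : normc (s%:C * z0') < 1 by rewrite normcM z0'1 mulr1 normc_real gtr0_norm.
  have ns2 : normc (s%:C * (z / r%:C)) < 1.
    rewrite normcM normc_real gtr0_norm//.
    by have := normc_ge0 (z / r%:C); move: zr1 s0 s1; clear; nra.
  have LK := L1_cauchyK ns Lf1.
  have LKc : L1 (fun w => (cauchyK (s%:C * z0') w)^* * f (r1%:C * w)).
    apply: (L1_bounded_mul (measurableT_conj (measT_cauchyK ns)) _ Lf1).
    by apply: aeT_mono (cauchyK_bound ns) => w _; rewrite normc_conj; apply.
  rewrite (@meanTC_ae _ _ (fun w => cauchyK (s%:C * z0') w * f (r1%:C * w) +
     ((cauchyK (s%:C * z0') w)^* * f (r1%:C * w) - f (r1%:C * w)))); last first.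
    by apply: aeT_all => w w1; rewrite poisson_conjE//; ring.
  rewrite meanTCD//; last exact: L1B.
  rewrite meanTCB//.
  have -> : meanTC (fun w => (cauchyK (s%:C * z0') w)^* * f (r1%:C * w)) = f 0.
    rewrite (@meanTC_ae _ _ (fun w => (1 - (s%:C * z0')^* * w)^-1 * f (r1%:C * w))).
      by rewrite meanTC_conj_cauchy// r10.
    by apply: aeT_all => w _; rewrite /cauchyK cconjV cconjB cconjM cconjK cconj1.
  rewrite mean_value//; last by rewrite (ltW r10).
  rewrite subrr addr0.
  apply: (@cvgC_unique _ _ \oo _ (fun N => \sum_(i < N) a i * (s%:C * z) ^+ i)).
    have := expand r1 (s%:C * z0'); rewrite r10 => /(_ z1 ns).
    by rewrite mulrCA -zE.
  have := expand r (s%:C * (z / r%:C)); rewrite r_0 => /(_ r_1 ns2).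
  by rewrite mulrCA [r%:C * _]mulrC divfK.
have lim2 : (fun s : R => Phi (s%:C * (z / r%:C)) : C^o) @ (1 : R)^'- --> (Phi (z / r%:C) : C^o).
  by apply: holo_radial; exact: cauchy_holo.
have rz : r%:C * (z / r%:C) = z by rewrite mulrC divfK.
have := expand r (z / r%:C); rewrite r_0 => /(_ r_1 zr1); rewrite rz -/(Phi _).
suff -> : f z = Phi (z / r%:C) by [].
apply: (@cvgC_unique _ _ (1 : R)^'- _ (fun s : R => Phi (s%:C * (z / r%:C))) _ _ _ lim2).
apply: cvg_trans lim1; apply: near_eq_cvg; apply: near_left1; exists 1 => //.
by move=> s; rewrite subrr => s01; exact: eqP.
Qed.

End taylor_expansion.

(** * Orthonormality of the monomials and Bessel's inequality *)

Section hardy_boundary.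
Context {R : realType}.
Local Notation C := R[i].
Implicit Types (f g k : C -> C) (z w : C) (p : {poly C}).

Lemma meanTC_orthonormal i j : meanTC (fun z : C => z^* ^+ i * z ^+ j) = (i == j)%:R.
Proof.
have cancel m n : aeT (fun z : C => z^* ^+ m * z ^+ (m + n) = z ^+ n).
  apply: aeT_all => z z1.
  by rewrite exprD mulrA -exprMn [_ * z]mulrC circle_conj// expr1n mul1r.
have mono n : meanTC (fun z : C => z ^+ n) = (n == 0%N)%:R.
  case: n => [|n]; last by rewrite meanTC_monomial.
  by rewrite (@meanTC_ae _ _ (fun=> 1)) ?meanTC_cst//; apply: aeT_all => z _; rewrite expr0.
have [ij|/ltnW ji] := leqP i j.
  have -> : j = (i + (j - i))%N by rewrite subnKC.
  by rewrite (meanTC_ae (cancel _ _)) mono -[X in _ = (X == _)%:R](addn0 i) eqn_add2l eq_sym.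
rewrite (@meanTC_ae _ _ (fun z => (z ^+ (i - j))^*)); last first.
  apply: aeT_mono (cancel j (i - j)%N) => z _; rewrite subnKC// => <-.
  by rewrite cconjM !cconjX cconjK mulrC.
rewrite meanTC_conj ?mono; last exact: L1_monomial.
rewrite rmorph_nat; congr (nat_of_bool _)%:R.
by rewrite subn_eq0 eqn_leq ji andbT.
Qed.

Lemma L2_horner p : L2 (fun z => p.[z]).
Proof.
apply: (@L2_bounded _ _ (\sum_(i < size p) normc p`_i)); first by case: (L1_horner p).
apply: aeT_all => z z1; rewrite horner_coef.
have ns (I : Type) (r : seq I) (F : I -> C) :
    normc (\sum_(i <- r) F i) <= \sum_(i <- r) normc (F i).
  elim/big_rec2: _ => [|i y x _ h]; first by rewrite normc0.
  exact: le_trans (le_normcD _ _) (lerD (lexx _) h).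
apply: le_trans (ns _ _ _) _; apply: ler_sum => i _.
by rewrite normcM normcX z1 expr1n mulr1.
Qed.

Lemma meanTC_conj_horner p g n : (size p <= n)%N -> L1 g ->
  meanTC (fun z => (p.[z])^* * g z) = \sum_(i < n) (p`_i)^* * meanTC (fun z => z^* ^+ i * g z).
Proof.
move=> pn Lg; rewrite (@meanTC_ae _ _ (fun z => \sum_(i < n) ((p`_i)^* * (z^* ^+ i * g z)))).
  rewrite meanTC_sum; last by move=> i; apply: L1Z; exact: L1_conjX.
  by apply: eq_bigr => i _; rewrite meanTCZ//; exact: L1_conjX.
apply: aeT_all => z _; rewrite (horner_coef_wide z pn) rmorph_sum mulr_suml.
by apply: eq_bigr => i _; rewrite -[X in X * _]/((p`_i * z ^+ i)^*) cconjM cconjX mulrA.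
Qed.

Lemma meanTC_conjX_horner p i : meanTC (fun z => z^* ^+ i * p.[z]) = p`_i.
Proof.
pose n := maxn (size p) i.+1.
rewrite (@meanTC_ae _ _ (fun z => \sum_(j < n) (p`_j * (z^* ^+ i * z ^+ j)))); last first.
  apply: aeT_all => z _; rewrite (@horner_coef_wide _ n) ?leq_maxl// mulr_sumr.
  by apply: eq_bigr => j _; ring.
rewrite meanTC_sum; last by move=> j; apply: L1Z; apply: L1_conjX; exact: L1_monomial.
rewrite (eq_bigr (fun j : 'I_n => p`_j * (i == j)%:R)); last first.
  by move=> j _; rewrite meanTCZ ?meanTC_orthonormal//; apply: L1_conjX; exact: L1_monomial.
have ni : (i < n)%N by rewrite leq_max ltnSn orbT.
rewrite (bigD1 (Ordinal ni))//= eqxx mulr1 big1 ?addr0// => j ji.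
by rewrite (_ : (i == j) = false) ?mulr0//; apply: contra_neqF ji => /eqP ij; apply: val_inj.
Qed.

Lemma normcB_sqr (x y : C) :
  normc (x - y) ^+ 2 = normc x ^+ 2 + normc y ^+ 2 - 2 * complex.Re (y^* * x).
Proof. by rewrite !normc_sqr cReD cImD cReN cImN cReM cReJ cImJ; ring. Qed.

Lemma sqnorm2_horner p n : (size p <= n)%N ->
  sqnorm2 (fun z => p.[z]) = \sum_(i < n) normc p`_i ^+ 2.
Proof.
move=> pn; suff : (sqnorm2 (fun z => p.[z]))%:C = (\sum_(i < n) normc p`_i ^+ 2)%:C.
  by move=> /(congr1 (@complex.Re R)).
rewrite /sqnorm2 -meanTC_real (@meanTC_ae _ _ (fun z => (p.[z])^* * p.[z])); last first.
  by apply: aeT_all => z _; rewrite mulrC mulcJ.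
rewrite (meanTC_conj_horner pn (L1_horner p)) rmorph_sum/=; apply: eq_bigr => i _.
by rewrite meanTC_conjX_horner mulrC mulcJ.
Qed.

(** [p] is the orthogonal projection of [f] on the first [n] monomials; the inequality is
    [0 <= sqnorm2 (f - p)] with the cross term evaluated. *)
Lemma bessel f (M : R) p n : (size p <= n)%N -> L2 f ->
  (forall i, (i < n)%N -> meanTC (fun z => z^* ^+ i * f z) = p`_i) ->
  sqnorm2 f <= M -> \sum_(i < n) normc p`_i ^+ 2 <= M.
Proof.
move=> pn Lf fp fM; rewrite -(sqnorm2_horner pn); have Lp := L2_horner p.
have Lpf := L1_L2M (L2_conj Lp) Lf.
have ce : meanT (fun z => complex.Re ((p.[z])^* * f z)) = sqnorm2 (fun z => p.[z]).
  rewrite -Re_meanTC (meanTC_conj_horner pn (L2_L1 Lf)) (sqnorm2_horner pn).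
  rewrite (eq_bigr (fun i : 'I_n => (normc p`_i ^+ 2)%:C)); last first.
    by move=> i _; rewrite fp// mulrC mulcJ.
  by rewrite -rmorph_sum.
have := sqnorm2_ge0 (fun z => f z - p.[z]); rewrite {1}/sqnorm2.
rewrite (@meanT_ae _ _ (fun z => (normc (f z) ^+ 2 + normc p.[z] ^+ 2) +
   - 2 * complex.Re ((p.[z])^* * f z))); last first.
  by apply: aeT_all => z _; rewrite normcB_sqr mulNr.
have /L1P[ir _] := Lpf; have i1 := L2_int Lf; have i2 := L2_int Lp.
rewrite meanTD; [|exact: aeintD|exact: aeintZ].
rewrite meanTD// meanTZ// ce.
rewrite -/(sqnorm2 f) -/(sqnorm2 (fun z => p.[z])).
by move: fM; clear; lra.
Qed.

Lemma L2_circle f (r : R) : 0 <= r < 1 -> holomorphicD f -> L2 (fun z => f (r%:C * z)).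
Proof.
move=> r01 hf; have [mf _] := L1_circle r01 hf.
have h2 : holomorphicD (fun w => f w * f w).
  by move=> w wd; apply: holoM; exact: hf.
have [_ i2] := L1_circle r01 h2.
apply: (L2_le mf i2); apply: aeT_all => z _.
by rewrite normcM expr2.
Qed.

Lemma H2_bessel f a (M : R) : holomorphicD f ->
  (forall r : R, 0 <= r < 1 -> sqnorm2 (fun z => f (r%:C * z)) <= M) ->
  (forall (r : R) n, 0 < r < 1 -> meanTC (fun z => z^* ^+ n * f (r%:C * z)) = a n * r%:C ^+ n) ->
  forall n, \sum_(i < n) normc (a i) ^+ 2 <= M.
Proof.
move=> hf fM fa n.
have le_r r : 0 < r < 1 -> \sum_(i < n) normc (a i) ^+ 2 * r ^+ i ^+ 2 <= M.
  move=> /andP[r0 r1].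
  have r01 : 0 <= r < 1 by rewrite (ltW r0).
  have r01' : 0 < r < 1 by rewrite r0.
  have := @bessel _ M (\poly_(i < n) (a i * r%:C ^+ i)) n (size_poly _ _) (L2_circle r01 hf) _ (fM _ r01).
  rewrite (eq_bigr (fun i : 'I_n => normc (a i) ^+ 2 * r ^+ i ^+ 2)).
    by apply => i ni; rewrite fa// coef_poly ni.
  by move=> i _; rewrite coef_poly ltn_ord normcM normcX normc_real (ger0_norm (ltW r0)) exprMn.
have cl : \sum_(i < n) normc (a i) ^+ 2 * r ^+ i ^+ 2 @[r --> (1 : R)^'-] -->
    \sum_(i < n) normc (a i) ^+ 2 * 1 ^+ i ^+ 2.
  elim: n {le_r} => [|n IHn]; first by under eq_fun do rewrite big_ord0; rewrite big_ord0; exact: cvg_cst.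
  under eq_fun do rewrite big_ord_recr; rewrite big_ord_recr; apply: cvgD => //.
  apply: cvgMr; under eq_fun do rewrite -exprM; rewrite -exprM.
  by apply: cvg_at_left_filter; exact: exprn_continuous.
rewrite (eq_bigr (fun i : 'I_n => normc (a i) ^+ 2 * 1 ^+ i ^+ 2)); last first.
  by move=> i _; rewrite !expr1n mulr1.
rewrite -(cvg_lim _ cl)//; apply: limr_le; first by apply/cvg_ex; eexists; exact: cl.
apply: near_left1; exists 1 => // r; rewrite subrr; exact: le_r.
Qed.

Lemma meanT_normc_le g (c : R) : L2 g -> 0 <= c -> sqnorm2 g <= c ^+ 2 -> meanT (fun z => normc (g z)) <= c.
Proof.
move=> Lg c0 gc; have := meanT_CauchySchwarz Lg (L2_cst 1).
rewrite (@meanT_ae _ (fun z => normc (g z) * normc (1 : C)) (fun z => normc (g z))); last first.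
  by apply: aeT_all => z _; rewrite normc1 mulr1.
have -> : sqnorm2 (fun=> 1 : C) = 1.
  by rewrite /sqnorm2 (@meanT_ae _ _ (fun=> 1)) ?meanT_cst//; apply: aeT_all => z _; rewrite normc1 expr1n.
rewrite sqrtr1 mulr1 => /le_trans; apply.
by rewrite -(ger0_norm c0) -sqrtr_sqr ler_wsqrtr.
Qed.

Lemma cvg_telescope (u : nat -> C) : cvgn (series (fun n => normc (u n.+1 - u n))) ->
  exists l : C, (u : nat -> C^o) @ \oo --> (l : C^o).
Proof.
move=> cu.
have part (h : C -> R) : (forall x y, h (x - y) = h x - h y) -> (forall x, `|h x| <= normc x) ->
    exists l : R, (fun n => h (u n)) @ \oo --> l.
  move=> hB hle.
  have /normed_cvg/cvg_ex[l hl] : cvgn [normed series (fun n => h (u n.+1) - h (u n))].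
    apply: (@series_le_cvg _ _ _ _ _ _ cu) => n; rewrite /= ?normr_ge0 ?normc_ge0// -hB; exact: hle.
  exists (h (u 0%N) + l).
  have -> : (fun n => h (u n)) = (fun n => h (u 0%N) + series (fun n => h (u n.+1) - h (u n)) n).
    apply/funext => n; rewrite seriesEnat/= telescope_sumr//.
      by rewrite addrC subrK.
  by apply: cvgD; [exact: cvg_cst|exact: hl].
have [x hx] := part (@complex.Re R) (fun x y => etrans (cReD _ _) (f_equal _ (cReN _))) (@ler_Re R).
have [y hy] := part (@complex.Im R) (fun x y => etrans (cImD _ _) (f_equal _ (cImN _))) (@ler_Im R).
by exists (x +i* y); apply: cvgC_ReIm.
Qed.

End hardy_boundary.

(** * The Riesz-Fischer theorem for power series *)

Section riesz_fischer.
Context {R : realType}.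
Local Notation C := R[i].
Variables (a : nat -> C) (M : R).
Hypothesis aM : forall n, \sum_(i < n) normc (a i) ^+ 2 <= M.
Let S n : {poly C} := \poly_(i < n) a i.
Let s n : R := \sum_(i < n) normc (a i) ^+ 2.

Lemma sqnorm2_poly_sub m n : sqnorm2 (fun z => (S m).[z] - (S n).[z]) = `|s m - s n|.
Proof.
wlog nm : m n / (n <= m)%N => [h|].
  have [/h//|/ltnW mn] := leqP n m.
  rewrite distrC -h//; apply: meanT_ae; apply: aeT_all => z _; by rewrite normcB.
have sz : (size (S m - S n)%R <= m)%N.
  apply: leq_trans (size_polyD _ _) _; rewrite size_polyN geq_max size_poly /=.
  exact: leq_trans (size_poly _ _) nm.
have -> : sqnorm2 (fun z => (S m).[z] - (S n).[z]) = sqnorm2 (fun z => (S m - S n).[z]).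
  by apply: meanT_ae; apply: aeT_all => z _; rewrite hornerD hornerN.
rewrite (sqnorm2_horner sz) /s -!(big_mkord xpredT (fun i => normc (_ i) ^+ 2)).
rewrite !(@big_cat_nat _ _ _ n 0 m)//= addrAC subrr add0r ger0_norm; last first.
  by apply: sumr_ge0 => i _; exact: sqr_ge0.
rewrite big_nat big1 ?add0r => [|i /andP[_ ni]]; last first.
  by rewrite coefB !coef_poly ni (leq_trans ni nm) subrr normc0 expr0n.
rewrite !big_nat; apply: eq_bigr => i /andP[ni im].
by rewrite coefB !coef_poly im ltnNge ni subr0.
Qed.

Lemma riesz_fischer : exists (N : nat -> nat) (g : C -> C),
  [/\ forall k, (k <= N k)%N, L2 g,
      sqnorm2 (fun z => (S (N k)).[z] - g z) @[k --> \oo] --> (0 : R) &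
      aeT (fun z => (fun k => (S (N k)).[z] : C^o) @ \oo --> (g z : C^o))].
Proof.
have nds : nondecreasing_seq s.
  apply/nondecreasing_seqP => n; rewrite /s big_ord_recr/= lerDl; exact: sqr_ge0.
have /cvg_ex[l sl] : cvgn s.
  apply: nondecreasing_is_cvgn => //; exists M => _ [n _ <-]; exact: aM.
have sle n : s n <= l.
  rewrite -(cvg_lim _ sl)//; apply: nondecreasing_cvgn_le => //.
  by apply/cvg_ex; exists l.
(* The square is there because [s] measures squared norms: the L^2 distances themselves become at
   most [2^-k]. *)
have /choice[N hN] (k : nat) : exists n, (k <= n)%N /\ l - s n <= 2^-1 ^+ k ^+ 2.
  have e0 : 0 < (2^-1 : R) ^+ k ^+ 2 by rewrite !exprn_gt0// invr_gt0.
  move/cvgrPdist_le : sl => /(_ _ e0)[n0 _ h0].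
  exists (maxn k n0); rewrite leq_maxl; split => //.
  have := h0 (maxn k n0) (leq_maxr _ _); exact: le_trans (ler_norm _).
have Nk k : (k <= N k)%N by case: (hN k).
have N2 k : l - s (N k) <= 2^-1 ^+ k ^+ 2 by case: (hN k).
pose T k := S (N k).
have LT k : L2 (fun z => (T k).[z]) := L2_horner _.
have half0 : 0 <= (2^-1 : R) by rewrite invr_ge0.
have dT j k : (j <= k)%N -> sqnorm2 (fun z => (T k).[z] - (T j).[z]) <= 2^-1 ^+ j ^+ 2.
  move=> jk; rewrite sqnorm2_poly_sub ler_norml.
  have : (2^-1 : R) ^+ k ^+ 2 <= 2^-1 ^+ j ^+ 2.
    rewrite ler_sqr ?nnegrE ?exprn_ge0//; apply: ler_wiXn2l => //.
    by rewrite invf_le1// ler1n.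
  by have := sle (N k); have := sle (N j); have := N2 k; have := N2 j; clear; lra.
have cvT : aeT (fun z => exists l : C, (fun k => (T k).[z] : C^o) @ \oo --> (l : C^o)).
  have ik k : aeint (fun z => normc ((T k.+1).[z] - (T k).[z])).
    by have [] := L2_L1 (L2B (LT k.+1) (LT k)).
  have : aeT (fun z => cvgn (series (fun n => normc ((T n.+1).[z] - (T n).[z])))).
    apply: (@meanT_series _ _ 2) => [//|n|n].
      by apply: aeT_all => z _; exact: normc_ge0.
    apply: (@le_trans _ _ (\sum_(k < n) (2^-1 : R) ^+ k)).
      apply: ler_sum => k _; apply: meanT_normc_le; [exact: L2B|exact: exprn_ge0|exact: dT].
    have h : (1 - 2^-1) * \sum_(k < n) (2^-1 : R) ^+ k = 1 - 2^-1 ^+ n.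
      by rewrite -opprB mulNr -subrX1 opprB.
    have : 0 <= (2^-1 : R) ^+ n by exact: exprn_ge0.
    by move: h; lra.
  by apply: aeT_mono => z _; exact: cvg_telescope.
pose g z : C := xget 0 [set l : C | (fun k => (T k).[z] : C^o) @ \oo --> (l : C^o)].
have Tg : aeT (fun z => (fun k => (T k).[z] : C^o) @ \oo --> (g z : C^o)).
  apply: aeT_mono cvT => z _ [x hx]; rewrite /g; case: xgetP => [y _//|/(_ x)].
  by case.
have mg : measT g.
  by apply: (@measurableT_cvg _ (fun k z => (T k).[z])) => // n; case/L2P: (LT n).
(* Fatou's lemma as the second index tends to infinity turns the Cauchy estimate [dT] into an
   estimate for the distance to [g]. *)
have fat j : aeint (fun z => normc ((T j).[z] - g z) ^+ 2) /\
    sqnorm2 (fun z => (T j).[z] - g z) <= 2^-1 ^+ j ^+ 2.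
  apply: (@meanT_fatou _ (fun k z => normc ((T j).[z] - (T (k + j)%N).[z]) ^+ 2)).
  - by move=> k; apply: L2_int; exact: L2B.
  - by move=> k; apply: aeT_all => z _; exact: sqr_ge0.
  - move=> k; apply: le_trans (dT j (k + j)%N (leq_addl _ _)).
    by rewrite le_eqVlt; apply/orP; left; apply/eqP; apply: meanT_ae; apply: aeT_all => z _; rewrite normcB.
  apply: aeT_mono Tg => z _ hz; rewrite expr2; under eq_fun do rewrite expr2.
  have h1 : (fun k => normc ((T j).[z] - (T (k + j)%N).[z])) @ \oo --> normc ((T j).[z] - g z).
    apply: cvgC_norm; apply: cvgCB; first exact: cvg_cst.
    by rewrite (cvg_shiftn j (fun k => (T k).[z] : C^o)).
  exact: cvgM.
exists N, g; split => //.
- have LB := fat 0%N; have L0 : L2 (fun z => (T 0%N).[z] - g z).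
    by apply/L2P; split; [apply: measurableTB => //; case/L2P: (LT 0%N)|case: LB].
  apply: L2_ae (L2B (LT 0%N) L0); apply: aeT_all => z _.
  by rewrite opprB addrC subrK.
- apply: (@squeeze_cvgr _ _ _ _ (fun=> 0) (fun j => 2^-1 ^+ j ^+ 2)).
  + by apply: nearW => j; rewrite sqnorm2_ge0; case: (fat j).
  + exact: cvg_cst.
  + have h : (fun j => (2^-1 : R) ^+ j) @ \oo --> (0 : R).
      by apply: cvg_expr; rewrite ger0_norm// invf_lt1// ltr1n.
    by have := cvgM h h; rewrite mulr0; apply.
Qed.

End riesz_fischer.

(** * Radial limits and the Poisson formula in H^2 *)

Section hardy_representation.
Context {R : realType}.
Local Notation C := R[i].
Implicit Types (f g : C -> C) (z w : C) (p : {poly C}).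

Lemma sqnorm2_cst0 f : sqnorm2 (fun z => f z - f z) = 0.
Proof.
rewrite /sqnorm2 (@meanT_ae _ _ (fun=> 0)) ?meanT_cst//.
by apply: aeT_all => z _; rewrite subrr normc0 expr0n.
Qed.

Lemma cvg_sqnorm2_cst f : (fun=> sqnorm2 (fun z => f z - f z)) @ \oo --> (0 : R).
Proof. by rewrite sqnorm2_cst0; exact: cvg_cst. Qed.

Lemma meanTC_L2_cvg (g_ : nat -> C -> C) g h (c : R) :
  (forall n, L2 (g_ n)) -> L2 g -> sqnorm2 (fun z => g_ n z - g z) @[n --> \oo] --> (0 : R) ->
  measT h -> aeT (fun z => normc (h z) <= c) ->
  (fun n => meanTC (fun z => h z * g_ n z) : C^o) @ \oo --> (meanTC (fun z => h z * g z) : C^o).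
Proof.
move=> L_ L gg mh hc.
have := meanTC_L2M_cvg L_ (fun=> L2_cst 1) L (L2_cst 1) gg (@cvg_sqnorm2_cst (fun=> 1)) mh hc.
rewrite (@meanTC_ae _ _ (fun z => h z * g z)); last by apply: aeT_all => z _; rewrite mulr1.
suff -> : (fun n => meanTC (fun z => h z * (g_ n z * 1))) = (fun n => meanTC (fun z => h z * g_ n z)) by [].
by apply/funext => n; apply: meanTC_ae; apply: aeT_all => z _; rewrite mulr1.
Qed.

Lemma bvE f z (l : C^o) :
  (fun r : R => f (r%:C * z) : C^o) @ (1 : R)^'- --> l -> bv f z = l.
Proof. by move=> h; apply: (@cvg_lim C^o) h; exact: norm_hausdorff. Qed.

(** The Poisson formula is exact for polynomials, so in the L^2 limit [f] is the Poisson integral of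
    the Riesz-Fischer function [g]. Fatou's theorem then identifies [g] with the radial limit. The
    polynomials [T] are kept in the conclusion: they converge in L^2, almost everywhere on the
    circle and pointwise in the disc. *)
Lemma H2_boundary f : H2 f -> [/\ L2 (bv f),
  aeT (fun z => (fun r : R => f (r%:C * z) : C^o) @ (1 : R)^'- --> (bv f z : C^o)) &
  exists T : nat -> {poly C},
    [/\ sqnorm2 (fun z => (T n).[z] - bv f z) @[n --> \oo] --> (0 : R),
        aeT (fun z => (fun n => (T n).[z] : C^o) @ \oo --> (bv f z : C^o)) &
        forall z, normc z < 1 -> (fun n => (T n).[z] : C^o) @ \oo --> (f z : C^o)]].
Proof.
move=> [hf [M fM]]; have [a [fa _ a_f]] := taylor hf.
have [N [g [Nk Lg gg gae]]] := riesz_fischer (H2_bessel hf fM fa).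
pose T (j : nat) : {poly C} := \poly_(i < N j) a i.
have Nmo : N @ \oo --> \oo.
  by apply/cvgnyPge => A; near=> n; apply: leq_trans (Nk n); near: n; exact: nbhs_infty_ge.
have Tf z : normc z < 1 -> (fun n => (T n).[z] : C^o) @ \oo --> (f z : C^o).
  move=> z1; have -> : (fun n => (T n).[z]) = (fun n => \sum_(i < n) a i * z ^+ i) \o N.
    by apply/funext => n /=; rewrite /T horner_poly.
  by apply: (cvg_comp N (fun n => \sum_(i < n) a i * z ^+ i : C^o) Nmo); exact: a_f.
have LT j : L2 (fun z => (T j).[z]) := L2_horner _.
have fP z : normc z < 1 -> f z = meanTC (fun zeta => (poisson z zeta)%:C * g zeta).
  move=> z1; apply: (@cvgC_unique _ _ \oo _ (fun n => (T n).[z])); first exact: Tf.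
  have := meanTC_L2_cvg LT Lg gg (measT_poisson z1) (poisson_bound z1).
  suff -> : (fun n => meanTC (fun zeta => (poisson z zeta)%:C * (T n).[zeta])) = (fun n => (T n).[z]) by [].
  by apply/funext => n; rewrite meanTC_poisson_horner.
have rad : aeT (fun z => (fun r : R => f (r%:C * z) : C^o) @ (1 : R)^'- --> (g z : C^o)).
  apply: aeT_mono (lebesgueT_L1 (L2_L1 Lg)) => z z1 Lz.
  have := fatou_poisson z1 (L2_L1 Lg) Lz; apply: cvg_trans; apply: near_eq_cvg.
  apply: near_left1; exists 1 => // r; rewrite subrr => /andP[r0 r1].
  by rewrite -fP// normcM z1 mulr1 normc_real ger0_norm// ltW.
have bvg : aeT (fun z => bv f z = g z).
  by apply: aeT_mono rad => z _; exact: bvE.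
split.
- exact: L2_ae bvg Lg.
- by apply: aeT_mono2 rad bvg => z _ + ->.
exists T; split; [| |exact: Tf].
- suff -> : (fun n => sqnorm2 (fun z => (T n).[z] - bv f z)) = (fun n => sqnorm2 (fun z => (T n).[z] - g z)) by [].
  by apply/funext => n; apply: meanT_ae; apply: aeT_mono bvg => z _ ->.
- by apply: aeT_mono2 gae bvg => z _ + ->.
Unshelve. all: by end_near. Qed.

Lemma H2_L2 f : H2 f -> L2 (bv f).
Proof. by move=> /H2_boundary[]. Qed.

Lemma H2_radial f : H2 f ->
  aeT (fun z => (fun r : R => f (r%:C * z) : C^o) @ (1 : R)^'- --> (bv f z : C^o)).
Proof. by move=> /H2_boundary[]. Qed.

(** Clear for polynomials, whose product is a polynomial; the general case is the limit of products
    of two L^2 approximations. *)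
Lemma H2_mul_analytic f g n : H2 f -> H2 g -> meanTC (fun z => z ^+ n.+1 * (bv f z * bv g z)) = 0.
Proof.
move=> Hf Hg; have [Lf _ [T [Tf _ _]]] := H2_boundary Hf; have [Lg _ [S [Sg _ _]]] := H2_boundary Hg.
have mX : measT (fun z : C => z ^+ n.+1) by apply: measurableTX; exact: measurableT_id.
have bX : aeT (fun z : C => normc (z ^+ n.+1) <= 1).
  by apply: aeT_all => z z1; rewrite normcX z1 expr1n.
have h := meanTC_L2M_cvg (fun k => L2_horner (T k)) (fun k => L2_horner (S k)) Lf Lg Tf Sg mX bX.
apply: (@cvgC_unique _ _ \oo _ _ _ _ h).
suff -> : (fun k => meanTC (fun z => z ^+ n.+1 * ((T k).[z] * (S k).[z]))) = fun=> 0 by exact: cvg_cst.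
apply/funext => k; rewrite -(meanTC_horner_monomial (T k * S k) n).
by apply: meanTC_ae; apply: aeT_all => z _; rewrite hornerM.
Qed.

Lemma H2_mul_poisson f g z : H2 f -> H2 g -> normc z < 1 ->
  meanTC (fun zeta => (poisson z zeta)%:C * (bv f zeta * bv g zeta)) = f z * g z.
Proof.
move=> Hf Hg z1; have [Lf _ [T [Tf _ Tz]]] := H2_boundary Hf; have [Lg _ [S [Sg _ Sz]]] := H2_boundary Hg.
have h := meanTC_L2M_cvg (fun k => L2_horner (T k)) (fun k => L2_horner (S k)) Lf Lg Tf Sg (measT_poisson z1) (poisson_bound z1).
apply: (@cvgC_unique _ _ \oo _ _ _ _ h).
suff -> : (fun k => meanTC (fun zeta => (poisson z zeta)%:C * ((T k).[zeta] * (S k).[zeta]))) =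
    fun k => (T k).[z] * (S k).[z] by apply: cvgCM; [exact: Tz|exact: Sz].
apply/funext => k; rewrite -hornerM -(meanTC_poisson_horner _ z1).
by apply: meanTC_ae; apply: aeT_all => zeta _; rewrite hornerM.
Qed.

Lemma H2_bounded f (M : R) : holomorphicD f -> (forall z, normc z < 1 -> normc (f z) <= M) -> H2 f.
Proof.
move=> hf fM; split => //; exists (M ^+ 2) => r /andP[r0 r1].
have r01 : 0 <= r < 1 by rewrite r0.
rewrite -[leRHS](@meanT_cst R); apply: meanT_le; [|exact: aeint_cst|].
  exact: L2_int (L2_circle r01 hf).
apply: aeT_all => z z1; rewrite ler_sqr ?nnegrE ?normc_ge0//.
  by apply: fM; rewrite normcM z1 mulr1 normc_real ger0_norm.
by apply: le_trans (normc_ge0 _) (fM 0 _); rewrite normc0.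
Qed.

Lemma holomorphicD_cst (c : C) : holomorphicD (fun=> c).
Proof. by move=> z _; exact: holo_cst. Qed.

Lemma bv_cst (c : C) z : bv (fun=> c) z = c.
Proof. by apply: bvE; exact: cvg_cst. Qed.

Lemma H2_cst (c : C) : H2 (fun=> c).
Proof. by apply: (@H2_bounded _ (normc c)) => //; exact: holomorphicD_cst. Qed.

Lemma H2_poisson f z : H2 f -> normc z < 1 ->
  meanTC (fun zeta => (poisson z zeta)%:C * bv f zeta) = f z.
Proof.
move=> Hf z1; rewrite -[RHS]mulr1 -(H2_mul_poisson Hf (H2_cst 1) z1).
by apply: meanTC_ae; apply: aeT_all => zeta _; rewrite bv_cst mulr1.
Qed.

End hardy_representation.

(** * Herglotz integrals and H^2 functions with given boundary values *)

Section hardy_converse.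
Context {R : realType}.
Local Notation C := R[i].
Implicit Types (f g : C -> C) (z w : C) (k : C -> R).

Lemma cconj_sum (I : Type) (r : seq I) (F : I -> C) : (\sum_(i <- r) F i)^* = \sum_(i <- r) (F i)^*.
Proof. exact: rmorph_sum. Qed.

Lemma holomorphicD_eq f g : (forall z, normc z < 1 -> f z = g z) -> holomorphicD f -> holomorphicD g.
Proof.
move=> fg hf z /disc_normc z1.
apply: (@near_eq_holo _ f _ _ (1 - normc z)); first by rewrite subr_gt0.
  move=> w wz; apply: fg.
  have := le_normcD z (w - z); rewrite addrC subrK => /le_lt_trans; apply.
  by rewrite addrC -ltrBrDr.
exact: holomorphicD_holo.
Qed.

Lemma normc_circle_scale (r : R) z : 0 <= r -> normc z = 1 -> normc (r%:C * z) = r.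
Proof. by move=> r0 z1; rewrite normcM z1 mulr1 normc_real ger0_norm. Qed.

Lemma H2_eq f g : (forall z, normc z < 1 -> f z = g z) -> H2 f -> H2 g.
Proof.
move=> fg [hf [M fM]]; split; first exact: holomorphicD_eq hf.
exists M => r r01; rewrite -(@meanT_ae _ (fun z => normc (f (r%:C * z)) ^+ 2)); first exact: fM.
apply: aeT_all => z z1; rewrite fg//; case/andP: r01 => r0 r1.
by rewrite normc_circle_scale.
Qed.

Lemma cvg_radial_eq f g z (l : C^o) : normc z = 1 -> (forall z, normc z < 1 -> f z = g z) ->
  (fun r : R => f (r%:C * z) : C^o) @ (1 : R)^'- --> l ->
  (fun r : R => g (r%:C * z) : C^o) @ (1 : R)^'- --> l.
Proof.
move=> z1 fg; apply: cvg_trans; apply: near_eq_cvg; apply: near_left1; exists 1 => // r.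
by rewrite subrr => /andP[r0 r1]; rewrite fg// normc_circle_scale// ltW.
Qed.

Lemma bv_eq f g : (forall z, normc z < 1 -> f z = g z) -> H2 f -> aeT (fun z => bv g z = bv f z).
Proof.
move=> fg Hf; apply: aeT_mono (H2_radial Hf) => z z1 h.
by apply: bvE; exact: cvg_radial_eq h.
Qed.

Lemma H2_bv_inj f g z : H2 f -> H2 g -> aeT (fun z => bv f z = bv g z) -> normc z < 1 -> f z = g z.
Proof.
move=> Hf Hg fg z1; rewrite -(H2_poisson Hf z1) -(H2_poisson Hg z1).
by apply: meanTC_ae; apply: aeT_mono fg => w _ ->.
Qed.

Definition herglotz k z : C := meanTC (fun zeta => (zeta + z) / (zeta - z) * (k zeta)%:C).

Lemma L1_herglotz k z : aeint k -> normc z < 1 -> L1 (fun zeta => (zeta + z) / (zeta - z) * (k zeta)%:C).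
Proof.
move=> ik z1; have Lk := L1_real ik.
apply: (L1_ae _ (L1B (L1Z 2 (L1_cauchyK z1 Lk)) Lk)).
by apply: aeT_all => w w1; rewrite herglotzE//; ring.
Qed.

Lemma herglotz_holo k : aeint k -> holomorphicD (herglotz k).
Proof.
move=> ik; have Lk := L1_real ik.
apply: (@holomorphicD_eq (fun z => 2 * meanTC (fun zeta => cauchyK z zeta * (k zeta)%:C) - meanTC (fun zeta => (k zeta)%:C))).
  move=> z z1; have LK := L1_cauchyK z1 Lk.
  rewrite -meanTCZ// -meanTCB//; last exact: L1Z.
  by apply: meanTC_ae; apply: aeT_all => w w1; rewrite herglotzE//; ring.
move=> z /disc_normc z1; apply: holoB; last exact: holo_cst.
by apply: holoM; [exact: holo_cst|exact: cauchy_holo].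
Qed.

Lemma aeint_poisson k z : aeint k -> normc z < 1 -> aeint (fun zeta => poisson z zeta * k zeta).
Proof.
move=> ik z1; have /L1P[+ _] := L1_poisson z1 (L1_real ik).
by apply: aeint_ae; apply: aeT_all => w _; rewrite /= mul0r subr0.
Qed.

Lemma herglotz_Re k z : aeint k -> normc z < 1 ->
  complex.Re (herglotz k z) = meanT (fun zeta => poisson z zeta * k zeta).
Proof.
move=> ik z1; rewrite Re_meanTC; apply: meanT_ae; apply: aeT_all => w _.
by rewrite cReM /= mulr0 subr0.
Qed.

Lemma herglotz0 k : aeint k -> herglotz k 0 = (meanT k)%:C.
Proof.
move=> ik; rewrite -meanTC_real; apply: meanTC_ae; apply: aeT_all => w w1.
by rewrite addr0 subr0 divff ?mul1r// -normc_gt0 w1.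
Qed.

Lemma meanT_herglotz k (r : R) : aeint k -> 0 <= r < 1 ->
  meanT (fun z => complex.Re (herglotz k (r%:C * z))) = meanT k.
Proof.
by move=> ik r01; rewrite -Re_meanTC mean_value ?herglotz0//; exact: herglotz_holo.
Qed.

Lemma herglotz_radial k : aeint k ->
  aeT (fun z => complex.Re (herglotz k (r%:C * z)) @[r --> (1 : R)^'-] --> k z).
Proof.
move=> ik; have Lk := L1_real ik; apply: aeT_mono (lebesgueT_L1 Lk) => z z1 Lz.
have /cvgC_Re /= := fatou_poisson z1 Lk Lz; apply: cvg_trans; apply: near_eq_cvg.
apply: near_left1; exists 1 => // r; rewrite subrr => /andP[r0 r1].
have zr1 : normc (r%:C * z) < 1 by rewrite normc_circle_scale// ltW.
apply: meanT_ae; apply: aeT_all => w _.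
by rewrite [RHS]cReM /= !mulr0.
Qed.

(** Jensen's inequality for the probability density [poisson z], obtained by integrating
    [poisson z * (t - |g|)^2 >= 0] with [t] the Poisson mean of [|g|]. *)
Lemma poisson_sqr g z : L2 g -> normc z < 1 ->
  normc (meanTC (fun zeta => (poisson z zeta)%:C * g zeta)) ^+ 2 <=
  meanT (fun zeta => poisson z zeta * normc (g zeta) ^+ 2).
Proof.
move=> Lg z1; have LP := L1_poisson z1 (L2_L1 Lg).
have [_ in1] := L2_L1 Lg; have in2 := L2_int Lg.
have iP : aeint (poisson z).
  have := aeint_poisson (aeint_cst 1) z1; apply: aeint_ae.
  by apply: aeT_all => w _; rewrite mulr1.
set t := meanT (fun zeta => poisson z zeta * normc (g zeta)).
have ht : normc (meanTC (fun zeta => (poisson z zeta)%:C * g zeta)) <= t.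
  apply: le_trans (meanTC_norm LP) _; rewrite le_eqVlt; apply/orP; left; apply/eqP.
  apply: meanT_ae; apply: aeT_all => w w1.
  by rewrite normcM normc_real ger0_norm// poisson_ge0.
have t0 : 0 <= t := le_trans (normc_ge0 _) ht.
apply: (@le_trans _ _ (t ^+ 2)); first by rewrite ler_sqr ?nnegrE ?normc_ge0.
have i1 := aeint_poisson in1 z1; have i2 := aeint_poisson in2 z1.
have : meanT (fun zeta => (2 * t) * (poisson z zeta * normc (g zeta))) <=
  meanT (fun zeta => t ^+ 2 * poisson z zeta + poisson z zeta * normc (g zeta) ^+ 2).
  apply: meanT_le; [exact: aeintZ|by apply: aeintD => //; exact: aeintZ|].
  apply: aeT_all => w w1; rewrite -subr_ge0.
  have -> : t ^+ 2 * poisson z w + poisson z w * normc (g w) ^+ 2 - 2 * t * (poisson z w * normc (g w)) =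
    poisson z w * (t - normc (g w)) ^+ 2 by ring.
  by rewrite mulr_ge0 ?sqr_ge0// poisson_ge0.
rewrite meanTZ// meanTD//; last exact: aeintZ.
rewrite meanTZ// meanT_poisson// mulr1 -/t; clear; lra.
Qed.

(** The conjugate kernel is a geometric series in powers of [zeta]; only its constant term survives,
    and the remainder is of order [normc z ^+ N]. *)
Lemma analytic_cauchyK_conj g z : L1 g -> (forall n, meanTC (fun zeta => zeta ^+ n.+1 * g zeta) = 0) ->
  normc z < 1 -> meanTC (fun zeta => (cauchyK z zeta)^* * g zeta) = meanTC g.
Proof.
move=> Lg g0 z1.
have LK : L1 (fun zeta => (cauchyK z zeta)^* * g zeta).
  apply: (L1_bounded_mul (measurableT_conj (measT_cauchyK z1)) _ Lg).
  by apply: aeT_mono (cauchyK_bound z1) => w _; rewrite normc_conj; apply.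
apply: (@cvgC_unique _ _ \oo _ (fun=> meanTC (fun zeta => (cauchyK z zeta)^* * g zeta))).
  exact: cvg_cst.
apply: (@cvgC_dist_le _ _ _ _ _ (fun N => normc z ^+ N * meanT (fun zeta => normc ((cauchyK z zeta)^* * g zeta)))); last first.
  by apply: geometric_cvg0; rewrite normc_ge0.
apply: nearW => N.
have eK : meanTC (fun zeta => (cauchyK z zeta)^* * g zeta) =
    meanTC g + z^* ^+ N.+1 * meanTC (fun zeta => zeta ^+ N.+1 * ((cauchyK z zeta)^* * g zeta)).
  rewrite (@meanTC_ae _ _ (fun zeta => \sum_(i < N.+1) (z^* ^+ i * (zeta ^+ i * g zeta)) +
      z^* ^+ N.+1 * (zeta ^+ N.+1 * ((cauchyK z zeta)^* * g zeta)))); last first.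
    apply: aeT_all => w w1; rewrite [in LHS](cauchyK_geometric N.+1 w1 z1).
    rewrite cconjD cconjM cconj_sum mulrDl mulr_suml; congr (_ + _).
      by apply: eq_bigr => i _; rewrite cconjM !cconjX cconjK; ring.
    by rewrite !(cconjM, cconjX) cconjK; ring.
  rewrite meanTCD; last by apply: L1Z; exact: L1_X.
    rewrite meanTC_sum; last by move=> i; apply: L1Z; exact: L1_X.
    rewrite meanTCZ; last exact: L1_X.
    congr (_ + _); rewrite big_ord_recl big1 ?addr0.
      by apply: meanTC_ae; apply: aeT_all => w _; rewrite !expr0 !mul1r.
    by move=> i _; rewrite meanTCZ; [rewrite g0 mulr0|exact: L1_X].
  by apply: L1_sum => i; apply: L1Z; exact: L1_X.
rewrite eK [X in normc X](_ : _ = z^* ^+ N.+1 * meanTC (fun zeta => zeta ^+ N.+1 * ((cauchyK z zeta)^* * g zeta))); last by ring.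
rewrite normcM normcX normc_conj.
apply: ler_pM; rewrite ?exprn_ge0 ?normc_ge0//.
  by rewrite exprS ler_piMl ?exprn_ge0 ?normc_ge0// ltW.
apply: le_trans (meanTC_norm (L1_X _ LK)) _.
rewrite le_eqVlt; apply/orP; left; apply/eqP; apply: meanT_ae.
by apply: aeT_all => w w1; rewrite [LHS]normcM normcX w1 expr1n mul1r.
Qed.

(** The Cauchy integral of [g] is holomorphic and its Poisson integral has boundary values [g];
    under the moment condition the two coincide. The H^2 bound uses the harmonic majorant of [|G|^2]
    given by the Herglotz integral of [|g|^2]. *)
Lemma H2_of_L2 g : L2 g -> (forall n, meanTC (fun zeta => zeta ^+ n.+1 * g zeta) = 0) ->
  exists2 G, H2 G & aeT (fun z => bv G z = g z).
Proof.
move=> Lg g0; have L1g := L2_L1 Lg.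
pose G z := meanTC (fun zeta => cauchyK z zeta * g zeta).
have GP z : normc z < 1 -> G z = meanTC (fun zeta => (poisson z zeta)%:C * g zeta).
  move=> z1; have LK := L1_cauchyK z1 L1g.
  have LKc : L1 (fun zeta => (cauchyK z zeta)^* * g zeta).
    apply: (L1_bounded_mul (measurableT_conj (measT_cauchyK z1)) _ L1g).
    by apply: aeT_mono (cauchyK_bound z1) => w _; rewrite normc_conj; apply.
  rewrite (@meanTC_ae _ _ (fun w => cauchyK z w * g w + ((cauchyK z w)^* * g w - g w))); last first.
    by apply: aeT_all => w w1; rewrite poisson_conjE//; ring.
  rewrite meanTCD//; last exact: L1B.
  by rewrite meanTCB// analytic_cauchyK_conj// subrr addr0.
have hG : holomorphicD G by move=> z /disc_normc z1; exact: cauchy_holo.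
have i2 := L2_int Lg.
exists G.
  split => //; exists (sqnorm2 g) => r r01; have /andP[r0 r1] := r01.
  rewrite -[leRHS](meanT_herglotz i2 r01).
  have /L1P[iH _] := L1_circle r01 (herglotz_holo i2).
  apply: meanT_le => //; first exact: L2_int (L2_circle r01 hG).
  apply: aeT_all => z z1; have zr1 : normc (r%:C * z) < 1 by rewrite normc_circle_scale.
  by rewrite herglotz_Re// GP//; exact: poisson_sqr.
apply: aeT_mono (lebesgueT_L1 L1g) => z z1 Lz; apply: bvE.
have := fatou_poisson z1 L1g Lz; apply: cvg_trans; apply: near_eq_cvg.
apply: near_left1; exists 1 => // r; rewrite subrr => /andP[r0 r1].
by rewrite -GP// normc_circle_scale// ltW.
Qed.

Lemma radialM f g : H2 f -> H2 g ->
  aeT (fun z => (fun r : R => f (r%:C * z) * g (r%:C * z) : C^o) @ (1 : R)^'- --> (bv f z * bv g z : C^o)).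
Proof.
move=> Hf Hg; apply: aeT_mono2 (H2_radial Hf) (H2_radial Hg) => z _; exact: cvgCM.
Qed.

Lemma bvM f g : H2 f -> H2 g -> aeT (fun z => bv (fun w => f w * g w) z = bv f z * bv g z).
Proof. by move=> Hf Hg; apply: aeT_mono (radialM Hf Hg) => z _; exact: bvE. Qed.

(** Square integrability of the boundary product yields some [G] in H^2 with these boundary values;
    it equals [f g] in the disc because the Poisson formula also holds for products. *)
Lemma H2M f g : H2 f -> H2 g -> L2 (fun z => bv f z * bv g z) -> H2 (fun z => f z * g z).
Proof.
move=> Hf Hg Lfg; have [G HG bG] := H2_of_L2 Lfg (fun n => H2_mul_analytic n Hf Hg).
apply: (H2_eq _ HG) => z z1; rewrite -(H2_mul_poisson Hf Hg z1) -(H2_poisson HG z1).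
by apply: meanTC_ae; apply: aeT_mono bG => w _ ->.
Qed.

Lemma bv_bounded f (M : R) : H2 f -> (forall z, normc z < 1 -> normc (f z) <= M) ->
  aeT (fun z => normc (bv f z) <= M).
Proof.
move=> Hf fM; apply: aeT_mono (H2_radial Hf) => z z1 /cvgC_norm h.
rewrite -(cvg_lim _ h)//; apply: limr_le; first by apply/cvg_ex; eexists; exact: h.
apply: near_left1; exists 1 => // r; rewrite subrr => /andP[r0 r1]; apply: fM.
by rewrite normc_circle_scale// ltW.
Qed.

Lemma H2_bounded_mul f g (M : R) : H2 f -> (forall z, normc z < 1 -> normc (f z) <= M) -> H2 g ->
  H2 (fun z => f z * g z).
Proof.
move=> Hf fM Hg; apply: H2M => //; apply: L2_bounded_mul (bv_bounded Hf fM) (H2_L2 Hg).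
exact: L2_measT (H2_L2 Hf).
Qed.

End hardy_converse.

(** * Outer functions and inner-outer factorization *)

Section outer.
Context {R : realType}.
Local Notation C := R[i].
Implicit Types (f g p q s : C -> C) (z w : C) (k : C -> R).

(* A sequential form of outerness, stable under products and under composition
   with self-maps of the disc. *)
Definition approx_invertible o := exists r : nat -> C -> C,
  [/\ forall n, holomorphicD (r n),
      forall n, exists M : R, forall z, normc z < 1 -> normc (r n z) <= M,
      forall n z, normc z < 1 -> normc (r n z * o z) <= 1 &
      forall z, normc z < 1 -> (fun n => r n z * o z : C^o) @ \oo --> (1 : C^o)].

Lemma approx_invertible_neq0 o z : approx_invertible o -> normc z < 1 -> o z != 0.
Proof.
move=> [r [_ _ _ r1]] z1; apply/eqP => oz; have := r1 z z1; rewrite oz.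
under eq_fun do rewrite mulr0.
move=> h; have e : (1 : C) = 0 by apply: (@cvgC_unique _ _ \oo _ (fun=> 0)) h _; exact: cvg_cst.
by move/eqP : e; rewrite oner_eq0.
Qed.

Lemma approx_invertibleM o1 o2 : approx_invertible o1 -> approx_invertible o2 ->
  approx_invertible (fun z => o1 z * o2 z).
Proof.
move=> [r [hr br nr cr]] [t [ht bt nt ct]].
have mulE n z : r n z * t n z * (o1 z * o2 z) = (r n z * o1 z) * (t n z * o2 z) by ring.
exists (fun n z => r n z * t n z); split.
- by move=> n z zd; apply: holoM; [exact: hr|exact: ht].
- move=> n; have [M rM] := br n; have [N tN] := bt n; exists (M * N) => z z1.
  by rewrite normcM ler_pM ?normc_ge0 ?rM ?tN.
- move=> n z z1; rewrite mulE normcM -(mulr1 1).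
  by apply: ler_pM; rewrite ?normc_ge0 ?nr ?nt.
- move=> z z1; under eq_fun do rewrite mulE.
  rewrite -[1](mulr1 1); by apply: cvgCM; [exact: cr|exact: ct].
Qed.

Lemma holomorphicD_compD f psi : holomorphicD psi -> (forall z, normc z < 1 -> normc (psi z) < 1) ->
  holomorphicD f -> holomorphicD (f \o psi).
Proof.
move=> hp p1 hf z zd; apply: holo_comp; first exact: hp.
by apply: holomorphicD_holo => //; apply: p1; apply/disc_normc.
Qed.

Lemma approx_invertible_comp o psi : holomorphicD psi -> (forall z, normc z < 1 -> normc (psi z) < 1) ->
  approx_invertible o -> approx_invertible (o \o psi).
Proof.
move=> hp p1 [r [hr br nr cr]]; exists (fun n => r n \o psi); split.
- by move=> n; exact: holomorphicD_compD hp p1 (hr n).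
- by move=> n; have [M rM] := br n; exists M => z z1; apply: rM; exact: p1.
- by move=> n z z1; apply: nr; exact: p1.
- by move=> z z1; apply: cr; exact: p1.
Qed.

(** Since [|g - 1|^2 <= 2 - 2 Re g] when [|g| <= 1], convergence to 1 at the single point 0 forces
    convergence to 1 in L^2 on the circle. *)
Lemma sqnorm2_sub1 g : H2 g -> (forall z, normc z < 1 -> normc (g z) <= 1) ->
  sqnorm2 (fun z => bv g z - 1) <= 2 - 2 * complex.Re (g 0).
Proof.
move=> Hg g1; have Lg := H2_L2 Hg; have i2 := L2_int Lg.
have /L1P[iRe _] := L2_L1 Lg.
have g0 : meanT (fun z => complex.Re (bv g z)) = complex.Re (g 0).
  have n0 : normc (0 : C) < 1 by rewrite normc0.
  rewrite -(H2_poisson Hg n0) -Re_meanTC; congr (complex.Re _); apply: meanTC_ae.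
  apply: aeT_all => z z1; rewrite poissonE// normc0 expr0n subr0 subr0 z1 expr1n divr1.
  by rewrite mul1r.
have -> : 2 - 2 * complex.Re (g 0) = meanT (fun z => 2 - 2 * complex.Re (bv g z)).
  by rewrite meanTB ?meanT_cst ?meanTZ ?g0//; [exact: aeint_cst|exact: aeintZ].
apply: meanT_le.
- by apply: L2_int; apply: L2B => //; exact: L2_cst.
- by apply: aeintB; [exact: aeint_cst|exact: aeintZ].
apply: aeT_mono (bv_bounded Hg g1) => z _ h.
rewrite normcB_sqr normc1 cconj1 mul1r expr1n.
have := normc_ge0 (bv g z); move: h; clear; nra.
Qed.

(* [w (r_n p)* = (r_n s)* q*] is orthogonal to the negative frequencies, and
   [(r_n p)*] tends to 1 in L^2. *)
Lemma division_analytic (w p s q : C -> C) n : L2 w -> H2 p -> H2 s -> H2 q -> approx_invertible p ->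
  aeT (fun z => w z * bv p z = bv s z * bv q z) ->
  meanTC (fun z => z ^+ n.+1 * w z) = 0.
Proof.
move=> Lw Hp Hs Hq [r [hr br nr cr]] wpsq.
have Hr m : H2 (r m) by have [M rM] := br m; exact: H2_bounded (hr m) rM.
have Hrp m : H2 (fun z => r m z * p z) by have [M rM] := br m; exact: H2_bounded_mul rM Hp.
have Hrs m : H2 (fun z => r m z * s z) by have [M rM] := br m; exact: H2_bounded_mul rM Hs.
have mX : measT (fun z : C => z ^+ n.+1) by apply: measurableTX; exact: measurableT_id.
have bX : aeT (fun z : C => normc (z ^+ n.+1) <= 1).
  by apply: aeT_all => z z1; rewrite normcX z1 expr1n.
have n0 : normc (0 : C) < 1 by rewrite normc0.
have cv : sqnorm2 (fun z => bv (fun z => r m z * p z) z - 1) @[m --> \oo] --> (0 : R).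
  apply: (@squeeze_cvgr _ _ _ _ (fun=> 0) (fun m => 2 - 2 * complex.Re (r m 0 * p 0))).
  - apply: nearW => m; rewrite sqnorm2_ge0; apply: sqnorm2_sub1; first exact: Hrp.
    exact: nr.
  - exact: cvg_cst.
  - rewrite [X in _ --> X](_ : 0 = 2 - 2 * complex.Re (1 : C)); last by rewrite /= mulr1 subrr.
    apply: cvgB; first exact: cvg_cst.
    by apply: cvgMr; apply: cvgC_Re; exact: cr.
have h := meanTC_L2M_cvg (fun m => H2_L2 (Hrp m)) (fun=> Lw) (L2_cst 1) Lw cv (@cvg_sqnorm2_cst _ w) mX bX.
apply: (@cvgC_unique _ _ \oo _ (fun=> 0)); last exact: cvg_cst.
rewrite (@meanTC_ae _ _ (fun z => z ^+ n.+1 * (1 * w z))); last first.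
  by apply: aeT_all => z _; rewrite mul1r.
move: h; suff -> : (fun m => meanTC (fun z => z ^+ n.+1 * (bv (fun z => r m z * p z) z * w z))) = fun=> 0 by [].
apply/funext => m; rewrite -(H2_mul_analytic n (Hrs m) Hq); apply: meanTC_ae.
have e1 := bvM (Hr m) Hp; have e2 := bvM (Hr m) Hs.
apply: aeT_mono2 (aeT_mono2 (fun z _ => @conj _ _) e1 e2) wpsq => z _ [-> ->] e.
by congr (_ * _); rewrite -mulrA [bv p z * _]mulrC e mulrA.
Qed.

Lemma division (w p s q : C -> C) : L2 w -> H2 p -> H2 s -> H2 q -> approx_invertible p ->
  aeT (fun z => w z * bv p z = bv s z * bv q z) ->
  exists2 G, H2 G & aeT (fun z => bv G z = w z).
Proof.
by move=> Lw Hp Hs Hq op e; apply: H2_of_L2 => // n; exact: (division_analytic n Lw Hp Hs Hq op e).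
Qed.

Lemma herglotzB k l z : aeint k -> aeint l -> normc z < 1 ->
  herglotz (fun w => k w - l w) z = herglotz k z - herglotz l z.
Proof.
move=> ik il z1; rewrite /herglotz -meanTCB; [|exact: L1_herglotz|exact: L1_herglotz].
by apply: meanTC_ae; apply: aeT_all => w _; rewrite rmorphB /= mulrBr.
Qed.

Lemma herglotz_cvg (k_ : nat -> C -> R) k l z : (forall n, aemeas (k_ n)) -> aeint l ->
  (forall n, aeT (fun w => `|k_ n w| <= l w)) -> aeT (fun w => k_ ^~ w @ \oo --> k w) -> normc z < 1 ->
  (fun n => herglotz (k_ n) z : C^o) @ \oo --> (herglotz k z : C^o).
Proof.
move=> mk il kl kk z1; pose c := 2 * (1 - normc z)^-1 + 1.
have Kb w : normc w = 1 -> normc ((w + z) / (w - z)) <= c.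
  move=> w1; rewrite herglotzE//; apply: le_trans (le_normcD _ _) _.
  rewrite normcM normcN normc1 lerD2r.
  have -> : normc (2 : C) = 2 by rewrite -(rmorph_nat (real_complex R)) normc_real normr_nat.
  by rewrite ler_wpM2l// normc_cauchyK.
have mK : measT (fun w => (w + z) / (w - z)).
  apply: (measurableT_ae _ (measurableTB (measurableTM (measurableT_cst 2) (measT_cauchyK z1)) (measurableT_cst 1))).
  by apply: aeT_all => w w1; rewrite herglotzE.
have := @meanTC_dominated _ (fun n w => (w + z) / (w - z) * (k_ n w)%:C) (fun w => (w + z) / (w - z) * (k w)%:C)
  (fun w => c * l w).
case.
- by move=> n; apply: measurableTM => //; exact: measurableT_real.
- exact: aeintZ.
- move=> n; apply: aeT_mono (kl n) => w w1 h.
  by rewrite normcM normc_real; apply: ler_pM; rewrite ?normc_ge0 ?normr_ge0 ?Kb.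
- by apply: aeT_mono kk => w _ h; apply: cvgCM; [exact: cvg_cst|exact: cvgC_real].
by [].
Qed.

Lemma aeint_max k c : aeint k -> aeint (fun z => Num.max (k z) c).
Proof.
move=> ik; apply: (@aeint_le _ _ (fun z => `|k z| + `|c|)).
- apply: (@aemeas_comp _ (fun x => Num.max x c) k); last exact: aeint_aemeas.
  by apply: measurable_maxr => //; exact: measurable_cst.
- by apply: aeintD; [exact: aeint_norm|exact: aeint_cst].
- apply: aeT_all => z _; case: (leP (k z) c) => _; first by rewrite lerDr.
  by rewrite lerDl.
Qed.

Lemma holomorphicD_expC f : holomorphicD f -> holomorphicD (fun z => expC (f z)).
Proof. by move=> hf z zd; apply: (@holo_comp _ f expC); [exact: hf|exact: holo_expC]. Qed.

Lemma cvgC_expC {T} {F : set_system T} {FF : Filter F} (f : T -> C) (l : C) :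
  (f : T -> C^o) @ F --> (l : C^o) -> (fun x => expC (f x) : C^o) @ F --> (expC l : C^o).
Proof.
move=> fl; have /holo_continuous ce := @holo_expC R l.
by apply: (cvg_comp (f : T -> C^o) (expC : C^o -> C^o) fl); exact: ce.
Qed.

(* Truncating [k] below at [-n] gives a bounded reciprocal. *)
Lemma outer_approx_invertible (lam : C) k f : normc lam = 1 -> aeint k ->
  (forall z, normc z < 1 -> f z = lam * expC (herglotz k z)) -> approx_invertible f.
Proof.
move=> lam1 ik fE; pose kn (n : nat) z : R := Num.max (k z) (- n%:R).
have ikn n : aeint (kn n) := aeint_max _ ik.
have rE n z : normc z < 1 -> lam^* * expC (- herglotz (kn n) z) * f z = expC (herglotz (fun w => k w - kn n w) z).
  move=> z1; rewrite herglotzB// fE// expCD mulrACA [lam^* * _]mulrC circle_conj// mul1r.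
  by rewrite mulrC.
have np (n : nat) w : k w - kn n w <= 0 by rewrite subr_le0 /kn le_max lexx.
exists (fun n z => lam^* * expC (- herglotz (kn n) z)); split.
- move=> n z zd; apply: holoM; first exact: holo_cst.
  by apply: holomorphicD_expC => // w wd; apply: holoN; exact: herglotz_holo.
- move=> n; exists (expR n%:R) => z z1.
  rewrite normcM normc_conj lam1 mul1r normc_expC ler_expR cReN herglotz_Re// lerNl.
  have i1 := aeint_poisson (aeint_cst 1) z1.
  have : meanT (fun w => - n%:R * (poisson z w * 1)) <= meanT (fun w => poisson z w * kn n w).
    apply: meanT_le; [exact: aeintZ|exact: aeint_poisson|].
    apply: aeT_all => w w1; rewrite mulr1 mulrC ler_wpM2l ?poisson_ge0//.
    by rewrite /kn le_max lexx orbT.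
  rewrite meanTZ//; suff -> : meanT (fun w => poisson z w * 1) = 1 by rewrite mulr1.
  by rewrite -[RHS](meanT_poisson z1); apply: meanT_ae; apply: aeT_all => w _; rewrite mulr1.
- move=> n z z1; rewrite rE// normc_expC -expR0 ler_expR herglotz_Re//; last exact: aeintB.
  rewrite -oppr_ge0 -meanTN; last by apply: aeint_poisson => //; exact: aeintB.
  by apply: meanT_ge0; apply: aeT_all => w w1; rewrite -mulrN mulr_ge0 ?poisson_ge0// oppr_ge0.
- move=> z z1.
  have e : (fun n => lam^* * expC (- herglotz (kn n) z) * f z) = fun n => expC (herglotz (fun w => k w - kn n w) z).
    by apply/funext => n; exact: rE.
  rewrite e -expC0.
  have -> : 0 = herglotz (fun=> 0) z :> C.
    rewrite /herglotz (@meanTC_ae _ _ (fun=> 0)) ?meanTC_cst//.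
    by apply: aeT_all => w _; rewrite mulr0.
  apply: cvgC_expC; apply: (@herglotz_cvg _ _ (fun w => `|k w|)) => //.
  - by move=> n; apply: aeint_aemeas; exact: aeintB.
  - exact: aeint_norm.
  - move=> n; apply: aeT_all => w _; rewrite ler0_norm// opprB /kn.
    case: (leP (k w) (- n%:R)) => h; last by rewrite subrr.
    have : (0 : R) <= n%:R by []. have := ler_norm (- k w); rewrite normrN; lra.
  - apply: aeT_all => w _; apply: cvg_near_cst.
    near=> n; rewrite /kn max_l ?subrr// lerNl.
    by apply: le_trans (ler_norm _) _; rewrite normrN; near: n; exact: nbhs_infty_ger.
Unshelve. all: by end_near. Qed.

Lemma outer_fun_approx_invertible f : outer_fun f -> approx_invertible f.
Proof.
move=> [lam [k [lam1 ik fE]]]; apply: (@outer_approx_invertible lam k).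
- by move: lam1 => [].
- by exists k; split => //; exact: aeT_all.
- by move=> z z1; rewrite fE//; apply/disc_normc.
Qed.

End outer.

(** * Logarithmic integrability and inner-outer factorization *)

Section inner_outer.
Context {R : realType}.
Local Notation C := R[i].
Implicit Types (f g p q s : C -> C) (z w : C) (k : C -> R).

Lemma meanT_poissonM_cst z (c : R) : normc z < 1 -> meanT (fun w => poisson z w * c) = c.
Proof.
move=> z1; have i1 := aeint_poisson (aeint_cst c) z1.
rewrite (@meanT_ae _ _ (fun w => c * poisson z w)); last by apply: aeT_all => w _; rewrite mulrC.
rewrite meanTZ ?meanT_poisson ?mulr1//.
apply: aeint_ae (aeint_poisson (aeint_cst 1) z1); apply: aeT_all => w _; by rewrite mulr1.
Qed.

Lemma meanT_poisson_le k l z : aeint k -> aeint l -> aeT (fun w => k w <= l w) -> normc z < 1 ->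
  meanT (fun w => poisson z w * k w) <= meanT (fun w => poisson z w * l w).
Proof.
move=> ik il kl z1; apply: meanT_le; [exact: aeint_poisson|exact: aeint_poisson|].
by apply: aeT_mono kl => w w1 h; rewrite ler_wpM2l// poisson_ge0.
Qed.

Lemma maximum_principle g (M : R) z : H2 g -> aeT (fun w => normc (bv g w) <= M) -> normc z < 1 ->
  normc (g z) <= M.
Proof.
move=> Hg gM z1; have [_ iN] := L2_L1 (H2_L2 Hg).
rewrite -(H2_poisson Hg z1).
apply: le_trans (meanTC_norm (L1_poisson z1 (L2_L1 (H2_L2 Hg)))) _.
rewrite -(meanT_poissonM_cst M z1).
apply: le_trans (meanT_poisson_le iN (aeint_cst M) gM z1).
rewrite le_eqVlt; apply/orP; left; apply/eqP; apply: meanT_ae.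
by apply: aeT_all => w w1; rewrite normcM normc_real ger0_norm// poisson_ge0.
Qed.

Lemma outer_boundary k : aeint k -> H2 (fun z => expC (herglotz k z)) ->
  aeT (fun z => normc (bv (fun z => expC (herglotz k z)) z) = expR (k z)).
Proof.
move=> ik HE; apply: aeT_mono2 (H2_radial HE) (herglotz_radial ik) => z z1 /cvgC_norm h1 h2.
have h3 : expR (complex.Re (herglotz k (r%:C * z))) @[r --> (1 : R)^'-] --> expR (k z).
  by apply: (cvg_comp (fun r : R => complex.Re (herglotz k (r%:C * z))) (@expR R) h2); exact: continuous_expR.
rewrite -(cvg_lim _ h1)// -(cvg_lim _ h3)//.
by congr (lim _); under eq_fun do rewrite normc_expC.
Qed.

Lemma ln_shift_bound (x e : R) : 0 <= x -> 0 < e -> `|ln (x + e)| <= `|ln e| + (x + e).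
Proof.
move=> x0 e0; have xe : 0 < x + e by rewrite ltr_wpDl.
have h1 : ln e <= ln (x + e) by rewrite ler_ln ?posrE// lerDr.
have h2 : ln (x + e) < x + e by exact: ln_sublinear.
have := ler_norm (- ln e); rewrite normrN => h3.
have := normr_ge0 (ln e); rewrite ler_norml => h4.
by apply/andP; split; move: h1 h2 h3 h4 xe; clear; lra.
Qed.

(** The logarithm of [sqrt (|p|^2 + e)] on the circle: the shift bounds it below, so it is
    integrable before anything is known about the zeros of the boundary function. *)
Definition shifted_log (p : C -> C) (e : R) : C -> R :=
  fun z => 2^-1 * ln (normc (bv p z) ^+ 2 + e).

Lemma aeint_shifted_log p (e : R) : H2 p -> 0 < e -> aeint (shifted_log p e).
Proof.
move=> Hp e0; apply: aeintZ; have i2 := L2_int (H2_L2 Hp).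
apply: (@aeint_le _ _ (fun z => `|ln e| + (normc (bv p z) ^+ 2 + e))).
- apply: (@aemeas_comp _ (fun x => ln (x + e)) (fun z => normc (bv p z) ^+ 2)).
    apply: (measurableT_comp (@measurable_ln R)).
    by apply: measurable_funD => //; exact: measurable_cst.
  exact: aeint_aemeas.
- by apply: aeintD; [exact: aeint_cst|apply: aeintD => //; exact: aeint_cst].
- by apply: aeT_all => z _; rewrite ln_shift_bound// sqr_ge0.
Qed.

(* The H^2 function [p exp(- herglotz k)] has boundary modulus at most 1. *)
Lemma shifted_log_upper p (e : R) z : H2 p -> 0 < e -> normc z < 1 ->
  normc (p z) <= expR (complex.Re (herglotz (shifted_log p e) z)).
Proof.
move=> Hp e0 z1; set k := shifted_log p e.
have ik : aeint k by exact: aeint_shifted_log.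
have ikN := aeintN ik.
pose E := fun z => expC (herglotz (fun w => - k w) z).
have EB w : normc w < 1 -> normc (E w) <= expR (- (2^-1 * ln e)).
  move=> w1; rewrite /E normc_expC ler_expR herglotz_Re//.
  rewrite -(meanT_poissonM_cst (- (2^-1 * ln e)) w1).
  apply: meanT_poisson_le => //; first exact: aeint_cst.
  apply: aeT_all => x _; rewrite lerN2 ler_wpM2l// ?invr_ge0//.
  by rewrite ler_ln ?posrE ?ltr_wpDl ?sqr_ge0// lerDr sqr_ge0.
have hE : holomorphicD E by apply: holomorphicD_expC; exact: herglotz_holo.
have HE : H2 E := H2_bounded hE EB.
have HEp := H2_bounded_mul HE EB Hp.
have : normc (E z * p z) <= 1.
  apply: (maximum_principle HEp _ z1).
  apply: aeT_mono2 (bvM HE Hp) (outer_boundary ikN HE) => w w1 -> hw.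
  rewrite normcM hw -[leRHS]expR0 -(@ler_pXn2r _ 2)// ?nnegrE ?expR_ge0 ?mulr_ge0 ?normc_ge0 ?expR_ge0//.
  have k2 : 2 * k w = ln (normc (bv p w) ^+ 2 + e) by rewrite /k /shifted_log mulrA divff ?mul1r.
  rewrite exprMn -!expRM_natl mulr0 mulrN k2 expR0.
  have pe : 0 < normc (bv p w) ^+ 2 + e by rewrite ltr_wpDl ?sqr_ge0.
  by rewrite expRN lnK ?posrE// ler_pdivrMl// mulr1 lerDl ltW.
rewrite normcM /E normc_expC.
have -> : complex.Re (herglotz (fun w => - k w) z) = - complex.Re (herglotz k z).
  rewrite !herglotz_Re// -meanTN; last exact: aeint_poisson.
  by apply: meanT_ae; apply: aeT_all => w _; rewrite mulrN.
by rewrite expRN ler_pdivrMl ?expR_gt0// mulr1.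
Qed.

Lemma shifted_log_cvg p z : bv p z != 0 ->
  (fun n => shifted_log p n.+1%:R^-1 z) @ \oo --> ln (normc (bv p z)).
Proof.
rewrite -normc_gt0 => p0.
have -> : ln (normc (bv p z)) = 2^-1 * ln (normc (bv p z) ^+ 2 + 0).
  by rewrite addr0 lnXn// -[ln _ *+ 2]mulr_natl mulrA mulVf ?mul1r.
apply: cvgMr; apply: (cvg_comp (fun n : nat => normc (bv p z) ^+ 2 + n.+1%:R^-1) (@ln R)).
  by apply: cvgD; [exact: cvg_cst|exact: cvg_harmonic].
by apply: continuous_ln; rewrite addr0 exprn_gt0.
Qed.

Lemma shifted_log_le p (e e' : R) z : 0 < e -> e <= e' -> shifted_log p e z <= shifted_log p e' z.
Proof.
move=> e0 ee'; rewrite ler_wpM2l ?invr_ge0// ler_ln ?posrE ?lerD2l// ltr_wpDl ?sqr_ge0//.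
exact: lt_le_trans ee'.
Qed.

(** At a point [z0] with [p z0 != 0], [shifted_log_upper] bounds the Poisson means of [k 0 - k n]
    uniformly in [n]. The Poisson kernel at [z0] is at least [d], so ordinary means are bounded too,
    and this increasing sequence converges almost everywhere. Where [bv p] vanishes it would diverge
    like half of [ln n.+1]. *)
Lemma log_integrable p : H2 p -> nonzeroD p ->
  aeT (fun z => bv p z != 0) /\ aeint (fun z => ln (normc (bv p z))).
Proof.
move=> Hp [z0 /disc_normc z01 pz0].
pose k n := shifted_log p n.+1%:R^-1.
have e0 (n : nat) : 0 < (n.+1%:R^-1 : R) by rewrite invr_gt0.
have ik n : aeint (k n) := aeint_shifted_log Hp (e0 n).
have kle m n z : (m <= n)%N -> k n z <= k m z.
  by move=> mn; apply: shifted_log_le => //; rewrite lef_pV2 ?posrE ?ltr0n// ler_nat ltnS.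
pose d := (1 - normc z0) / 2; have d0 : 0 < d by rewrite divr_gt0// subr_gt0.
pose c := (complex.Re (herglotz (k 0%N) z0) - ln (normc (p z0))) / d.
have kb n : meanT (fun z => k 0%N z - k n z) <= c.
  have id := aeintB (ik 0%N) (ik n).
  rewrite ler_pdivlMr// mulrC -meanTZ//.
  apply: (@le_trans _ _ (meanT (fun z => poisson z0 z * (k 0%N z - k n z)))).
    apply: meanT_le; [exact: aeintZ|exact: aeint_poisson|].
    apply: aeT_all => z z1; rewrite ler_wpM2r ?subr_ge0 ?kle//.
    exact: poisson_ge.
  rewrite -herglotz_Re// herglotzB// cReD cReN lerD2l lerN2.
  by rewrite -ler_expR lnK ?posrE ?normc_gt0//; exact: shifted_log_upper.
have sE N z : series (fun n => k n z - k n.+1 z) N = k 0%N z - k N z.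
  rewrite seriesEnat /= -(opprB (k N z)) -(telescope_sumr (fun n => k n z))// -sumrN.
  by apply: eq_bigr => i _; rewrite opprB.
have cs : aeT (fun z => cvgn (series (fun n => k n z - k n.+1 z))).
  apply: (@meanT_series _ _ c) => [n|n|n].
  - exact: aeintB.
  - by apply: aeT_all => z _; rewrite subr_ge0 kle.
  apply: le_trans (kb n); rewrite le_eqVlt; apply/orP; left; apply/eqP.
  elim: n => [|n IHn].
    rewrite big_ord0 (@meanT_ae _ _ (fun=> 0)) ?meanT_cst//.
    by apply: aeT_all => z _; rewrite subrr.
  rewrite big_ord_recr /= IHn -meanTD; [|exact: aeintB|exact: aeintB].
  by apply: meanT_ae; apply: aeT_all => z _; rewrite addrA subrK.
have p0 : aeT (fun z => bv p z != 0).
  apply: aeT_mono cs => z _ /cvg_seq_bounded/bounded_fun_has_ubound[M hM].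
  apply/negP => /eqP pz.
  have lM n : ln n.+1%:R <= 2 * (M - k 0%N z).
    have /hM : range (series (fun n => k n z - k n.+1 z)) (k 0%N z - k n z).
      by exists n => //; exact: sE.
    rewrite {2}/k /shifted_log pz normc0 expr0n add0r lnV ?posrE ?ltr0n//.
    by clear; lra.
  have [n hn] : exists n : nat, expR (2 * (M - k 0%N z)) < n%:R.
    exists (Num.bound (expR (2 * (M - k 0%N z)))).
    by apply: archi_boundP; exact: expR_ge0.
  have := lM n; rewrite -ler_expR lnK ?posrE ?ltr0n// leNgt => /negP; apply.
  by apply: lt_le_trans hn _; rewrite ler_nat.
split => //.
have [iF _] : aeint (fun z => k 0%N z - ln (normc (bv p z))) /\
    meanT (fun z => k 0%N z - ln (normc (bv p z))) <= c.
  apply: (@meanT_fatou _ (fun n z => k 0%N z - k n z)) => [n|n|//|].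
  - exact: aeintB.
  - by apply: aeT_all => z _; rewrite subr_ge0 kle.
  - apply: aeT_mono p0 => z _ /shifted_log_cvg h.
    by apply: cvgB; [exact: cvg_cst|exact: h].
apply: aeint_ae (aeintB (ik 0%N) iF); apply: aeT_all => z _.
by rewrite opprB addrC subrK.
Qed.

Lemma log_upper p z : H2 p -> nonzeroD p -> normc z < 1 ->
  normc (p z) <= expR (complex.Re (herglotz (fun w => ln (normc (bv p w))) z)).
Proof.
move=> Hp pn z1; have [p0 il] := log_integrable Hp pn.
pose k n := shifted_log p n.+1%:R^-1.
have e0 (n : nat) : 0 < (n.+1%:R^-1 : R) by rewrite invr_gt0.
have ik n : aeint (k n) := aeint_shifted_log Hp (e0 n).
have h1 : (fun n => herglotz (k n) z : C^o) @ \oo --> (herglotz (fun w => ln (normc (bv p w))) z : C^o).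
  apply: (@herglotz_cvg _ _ _ (fun w => `|k 0%N w| + `|ln (normc (bv p w))|)) => //.
  - by move=> n; exact: aeint_aemeas.
  - by apply: aeintD; apply: aeint_norm.
  - move=> n; apply: aeT_mono p0 => w _ pw.
    have h1 : k n w <= k 0%N w.
      by apply: shifted_log_le => //; rewrite lef_pV2 ?posrE ?ltr0n// ler_nat.
    have h2 : ln (normc (bv p w)) <= k n w.
      have := shifted_log_cvg pw; move=> h; rewrite -(cvg_lim _ h)//.
      apply: limr_le; first by apply/cvg_ex; eexists; exact: h.
      exists n => // m /= nm; apply: shifted_log_le => //.
      by rewrite lef_pV2 ?posrE ?ltr0n// ler_nat.
    have := ler_norm (- ln (normc (bv p w))); rewrite normrN.
    have := ler_norm (k 0%N w); have := normr_ge0 (k 0%N w).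
    have := normr_ge0 (ln (normc (bv p w))); rewrite ler_norml.
    by move: h1 h2; clear => *; apply/andP; split; lra.
  - by apply: aeT_mono p0 => w _; exact: shifted_log_cvg.
have h2 : expR (complex.Re (herglotz (k n) z)) @[n --> \oo] -->
    expR (complex.Re (herglotz (fun w => ln (normc (bv p w))) z)).
  by apply: (cvg_comp _ _ (cvgC_Re h1)); exact: continuous_expR.
rewrite -(cvg_lim _ h2)//; apply: limr_ge; first by apply/cvg_ex; eexists; exact: h2.
by apply: nearW => n; exact: shifted_log_upper.
Qed.

(** Jensen's inequality for the exponential: its tangent line at [a], the Poisson mean of [2 * k],
    lies below its graph. The square of the modulus is thus dominated by the Poisson integral of
    [expR (2 * k)]. *)
Lemma outer_H2 k : aeint k -> aeint (fun z => expR (2 * k z)) ->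
  H2 (fun z => expC (herglotz k z)).
Proof.
move=> ik ie; have hE : holomorphicD (fun z => expC (herglotz k z)).
  by apply: holomorphicD_expC; exact: herglotz_holo.
split => //; exists (meanT (fun z => expR (2 * k z))) => r r01; have /andP[r0 r1] := r01.
rewrite -(meanT_herglotz ie r01).
have /L1P[iH _] := L1_circle r01 (herglotz_holo ie).
apply: meanT_le => //; first exact: L2_int (L2_circle r01 hE).
apply: aeT_all => x x1; have z1 : normc (r%:C * x) < 1 by rewrite normc_circle_scale.
move: (r%:C * x) z1 => z z1 {x x1}.
rewrite normc_expC -expRM_natl herglotz_Re// [leRHS]herglotz_Re//.
set a := 2 * _; have aE : a = meanT (fun w => poisson z w * (2 * k w)).
  rewrite /a -meanTZ; last exact: aeint_poisson.
  by apply: meanT_ae; apply: aeT_all => w _; rewrite mulrCA.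
have ib : aeint (fun w => expR a * (1 - a + 2 * k w)).
  by apply: aeintZ; apply: aeintD; [exact: aeint_cst|exact: aeintZ].
apply: le_trans (meanT_poisson_le ib ie _ z1); last first.
  apply: aeT_all => w _; rewrite -[2 * k w](subrK a) expRD mulrC ler_wpM2r ?expR_ge0//.
  by rewrite subrK -addrA [- a + _]addrC; exact: expR_ge1Dx.
have i2 := aeintZ 2 ik.
rewrite (@meanT_ae _ _ (fun w => expR a * (poisson z w * (1 - a)) + expR a * (poisson z w * (2 * k w)))); last first.
  by apply: aeT_all => w _; ring.
have i3 := aeint_poisson (aeint_cst (1 - a)) z1; have i4 := aeint_poisson i2 z1.
rewrite meanTD; [|exact: aeintZ|exact: aeintZ].
rewrite !meanTZ// meanT_poissonM_cst// -aE -mulrDr subrK mulr1.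
exact: lexx.
Qed.

(** The outer factor is the exponential of the Herglotz integral of [ln |p|]; by [log_upper] the
    quotient is at most 1 in the disc, and both moduli agree on the circle. *)
Lemma inner_outer p : H2 p -> nonzeroD p -> exists po pi,
  [/\ H2 po, approx_invertible po, inner_fun pi & forall z, normc z < 1 -> p z = pi z * po z].
Proof.
move=> Hp pn; have [p0 il] := log_integrable Hp pn.
pose k w := ln (normc (bv p w)).
have ke : aeT (fun z => expR (k z) = normc (bv p z)).
  by apply: aeT_mono p0 => z _ h; rewrite lnK// posrE normc_gt0.
have ie : aeint (fun z => expR (2 * k z)).
  apply: aeint_ae (L2_int (H2_L2 Hp)); apply: aeT_mono ke => z _ <-.
  by rewrite expRM_natl.
have Ho := outer_H2 il ie; pose po z := expC (herglotz k z).
have Hpo : H2 po := Ho.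
have po0 z : po z != 0 by exact: expC_neq0.
pose pi z := p z / po z.
have hpi : holomorphicD pi.
  move=> z zd; apply: holoM; first by case: Hp => hp _; exact: hp.
  by apply: holoV => //; case: Hpo => ho _; exact: ho.
have pi1 z : normc z < 1 -> normc (pi z) <= 1.
  move=> z1; rewrite /pi normcM normcV -ler_pdivlMr ?invr_gt0 ?normc_gt0// div1r invrK.
  by rewrite /po normc_expC; exact: log_upper.
have Hpi := H2_bounded hpi pi1.
have pE z : p z = pi z * po z by rewrite /pi divfK.
exists po, pi; split => //.
  apply: (@outer_approx_invertible _ 1 k) => //; first by rewrite normc1.
  by move=> z _; rewrite mul1r.
split => //.
  by exists 1 => z /disc_normc; exact: pi1.
have e1 := bvM Hpi Hpo.
have e2 : aeT (fun z => bv p z = bv pi z * bv po z).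
  have e3 : aeT (fun z => bv (fun w => pi w * po w) z = bv p z) by apply: bv_eq => // z _; exact: pE.
  by apply: aeT_mono2 e1 e3 => z _ <- <-.
have e3 := outer_boundary il Ho.
apply: aeT_mono2 (aeT_mono2 (fun z _ => @conj _ _) e2 e3) (aeT_mono2 (fun z _ => @conj _ _) ke p0) => z _.
move=> [h1 h2] [h3]; rewrite -normc_gt0 => h4.
apply: (mulIf (lt0r_neq0 h4)); rewrite mul1r {2}h1 normcM.
by rewrite -[in X in _ * X = _]h3 -h2.
Qed.

End inner_outer.

(** * Composition with an inner function *)

Section circle_cover.
Context {R : realType}.
Local Notation C := R[i].
Local Notation mu := (@lebesgue_measure R).

Lemma cis_surj (z : C) : normc z = 1 -> exists2 t : R, arcT t & cis t = z.
Proof.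
move=> z1; have := normc_sqr z; rewrite z1 expr1n; case: z z1 => x y /= _ xy.
have x1 : -1 <= x <= 1.
  by apply/andP; split; move: xy; clear; nra.
have cx : cos (acos x) = x by rewrite acosK// in_itv.
have sx : sin (acos x) = `|y|.
  by rewrite sin_acos// (_ : 1 - x ^+ 2 = y ^+ 2) ?sqrtr_sqr// xy addrC addKr.
have a0 := acos_ge0 x1; have api := acos_lepi x1.
have [y0|y0] := leP 0 y.
  exists (acos x); last by rewrite /cis cx sx ger0_norm.
  by rewrite /arcT /= in_itv /= a0 /=; move: a0 api; clear; lra.
exists (2 * pi - acos x).
  by rewrite /arcT /= in_itv /=; apply/andP; split; move: a0 api; clear; lra.
rewrite /cis mulr_natl cosB sinB cos2pi sin2pi cx sx ltr0_norm//.
by rewrite !mul1r !mul0r addr0 sub0r opprK.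
Qed.

Lemma normc_cisB_le (t s : R) : normc (cis t - cis s) <= `|t - s|.
Proof.
have sin_le (x : R) : 0 <= x -> sin x <= x.
  rewrite le_eqVlt => /predU1P[<-|x0]; first by rewrite sin0.
  have [c _] := @MVT R sin cos 0 x x0 (fun x _ => is_derive_sin x) (continuous_subspaceT (@continuous_sin R)).
  by rewrite sin0 !subr0 => ->; rewrite ler_piMl ?cos_le1// ltW.
have abs (x : R) : `|sin x| <= `|x|.
  wlog x0 : x / 0 <= x.
    move=> h; have [/h//|x0] := leP 0 x.
    by rewrite -normrN -sinN -[leRHS]normrN h// oppr_ge0 ltW.
  rewrite (ger0_norm x0) ler_norml sin_le// andbT lerNl -sinN.
  have [x2|x2] := leP x 1; last by apply: le_trans (sin_le1 _) _; exact: ltW.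
  rewrite sinN lerNl; apply: (@le_trans _ _ 0); first by rewrite oppr_le0.
  apply: sin_ge0_pi; rewrite x0 /=; apply: le_trans x2 _.
  by apply: le_trans (pi_ge2 R); rewrite ler1n.
rewrite normc_cisB; apply: (@le_trans _ _ (2 * `|(t - s) / 2|)).
  by rewrite ler_wpM2l.
by rewrite normrM (ger0_norm (_ : 0 <= 2^-1)) ?invr_ge0// mulrCA divff ?mulr1.
Qed.

(** Outer regularity of Lebesgue measure covers the exceptional parameters by open intervals of
    total length at most [e]; an arc is no longer than its parameter interval, so midpoints serve as
    centers. *)
Lemma aeT_cover (P : C -> Prop) (e : R) : aeT P -> 0 < e ->
  exists (c : nat -> C) (d : nat -> R),
  [/\ forall k, normc (c k) = 1, forall k, 0 <= d k, forall N, \sum_(k < N) d k <= e &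
      forall z, normc z = 1 -> ~ P z -> exists2 k, normc (z - c k) <= d k & 0 < d k].
Proof.
move=> [B [mB B0 PB]] e0.
have oB : ((@wlength R idfun)^* B)%mu = 0%E by exact: B0.
have : ((@wlength R idfun)^* B)%mu \is a fin_num by rewrite oB.
rewrite outer_measure_open_itv_cover => /lb_ereal_inf_adherent-/(_ _ e0)[_/= [F]] [Fitv BF] <-.
rewrite -outer_measure_open_itv_cover oB add0e => Fe.
have /choice[ab Fab] (k : nat) : exists ab : R * R, F k = `]ab.1, ab.2[%classic by exact: Fitv.
(* Empty intervals get radius 0; an interval that contains a point has positive radius, as the last
   clause records. *)
pose d k := Num.max 0 ((ab k).2 - (ab k).1).
have d0 k : 0 <= d k by rewrite le_max lexx.
have ld k : wlength idfun (F k) = (d k)%:E.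
  rewrite Fab wlength_itv /= lte_fin /d; case: ltP => h.
    by rewrite max_r -?EFinB// subr_ge0 ltW.
  by rewrite max_l// subr_le0.
exists (fun k => cis (((ab k).1 + (ab k).2) / 2)), d; split => //.
- by move=> k; exact: normc_cis.
- move=> N; rewrite -lee_fin; apply: le_trans (ltW Fe).
  rewrite -sumEFin -(big_mkord xpredT (fun k => (d k)%:E)).
  under eq_bigr do rewrite -ld.
  by apply: nneseries_lim_ge => k _ _; rewrite ld lee_fin.
move=> z z1 nP; have [t tT tz] := cis_surj z1.
have tB : B t by apply: PB => /= h; apply: nP; rewrite -tz; exact: h.
have [k _] := BF _ tB; rewrite Fab /= in_itv /= => /andP[at_ tb].
have dE : d k = (ab k).2 - (ab k).1 by rewrite /d max_r// subr_ge0 ltW// (lt_trans at_).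
exists k; last by rewrite dE subr_gt0 (lt_trans at_).
rewrite -tz; apply: le_trans (normc_cisB_le _ _) _; rewrite dE.
by rewrite ler_norml; apply/andP; split; move: at_ tb; clear; lra.
Qed.

End circle_cover.

(** * Inner functions as self-maps of the disc and of the circle *)

Section inner_composition.
Context {R : realType}.
Local Notation C := R[i].
Implicit Types (f g : C -> C) (z w : C).
Variable psi : C -> C.
Hypothesis psi_inner : inner_fun psi.
Hypothesis psi_nonconstant : nonconstantD psi.

Lemma inner_H2 : H2 psi.
Proof.
have [hp [M pM] _] := psi_inner.
by apply: (@H2_bounded _ _ M) => // z z1; apply: pM; apply/disc_normc.
Qed.

Lemma inner_bv1 : aeT (fun z => normc (bv psi z) = 1).
Proof. by have [] := psi_inner. Qed.

Lemma inner_le1 z : normc z < 1 -> normc (psi z) <= 1.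
Proof.
move=> z1; apply: maximum_principle inner_H2 _ z1.
by apply: aeT_mono inner_bv1 => w _ ->.
Qed.

Lemma inner_holo : holomorphicD psi.
Proof. by have [] := psi_inner. Qed.

(** If [c = psi z] had modulus 1, the nonnegative function [1 - Re (c^* psi)] on the circle would
    have Poisson mean 0 at [z]. The kernel is positive, so [psi] would equal [c] almost everywhere
    on the circle, hence in the disc. *)
Lemma inner_lt1 z : normc z < 1 -> normc (psi z) < 1.
Proof.
move=> z1; rewrite lt_neqAle inner_le1// andbT; apply/eqP => c1.
apply: psi_nonconstant; exists (psi z) => w /disc_normc w1.
set c := psi z in c1 *.
have H := inner_H2; have Lp := L2_L1 (H2_L2 H).
have cc : c * c^* = 1 by rewrite mulcJ c1 expr1n.
have /L1P[iRe _] := L1Z c^* Lp.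
have i1 := aeintB (aeint_cst 1) iRe.
have le1 x : normc (bv psi x) = 1 -> complex.Re (c^* * bv psi x) <= 1.
  move=> x1; apply: le_trans (ler_norm _) _; apply: le_trans (ler_Re _) _.
  by rewrite normcM normc_conj c1 x1 mulr1.
have k0 : aeT (fun x => poisson z x * (1 - complex.Re (c^* * bv psi x)) = 0).
  apply: meanT_eq0.
  - exact: aeint_poisson.
  - by apply: aeT_mono inner_bv1 => x x1 /le1 h; rewrite mulr_ge0 ?poisson_ge0 ?subr_ge0.
  - have LP := L1_poisson z1 Lp.
    have /L1P[iR2 _] := L1Z c^* LP.
    have iP : aeint (fun x => poisson z x * 1) by apply: aeint_poisson => //; exact: aeint_cst.
    rewrite (@meanT_ae _ _ (fun x => poisson z x * 1 - complex.Re (c^* * ((poisson z x)%:C * bv psi x)))); last first.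
      apply: aeT_all => x _; rewrite mulrBr mulr1; congr (_ - _).
      by rewrite mulrCA [RHS]cReM /= mul0r subr0.
    rewrite meanTB// meanT_poissonM_cst// -Re_meanTC meanTCZ// (H2_poisson H z1).
    by rewrite -/c mulrC cc subrr.
apply: (H2_bv_inj H (H2_cst c) _ w1).
apply: aeT_mono2 inner_bv1 k0 => x x1 px /eqP; rewrite bv_cst mulf_eq0 => /orP[/eqP p0|].
  have := poisson_ge x1 z1; rewrite p0 leNgt => /negP; case.
  by rewrite divr_gt0// subr_gt0.
rewrite subr_eq0 => /eqP e.
have n1 : normc (c^* * bv psi x) = 1 by rewrite normcM normc_conj c1 px mulr1.
have e1 : c^* * bv psi x = 1.
  apply: complex_ext => //=; apply/eqP; rewrite -sqrf_eq0; apply/eqP.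
  have := normc_sqr (c^* * bv psi x); rewrite n1 -e expr1n => /eqP.
  by rewrite -subr_eq0 opprD addrA subrr sub0r oppr_eq0 => /eqP.
by rewrite -[LHS]mul1r -cc -mulrA e1 mulr1.
Qed.

(* [|f|^2] is dominated by the real part of the Herglotz integral of [|f*|^2], whose
   composition with [psi] has the mean value property. *)
Lemma H2_comp_bound f (r : R) : H2 f -> 0 <= r < 1 ->
  sqnorm2 (fun z => f (psi (r%:C * z))) <= 2 / (1 - normc (psi 0)) * sqnorm2 (bv f).
Proof.
move=> Hf r01; have /andP[r0 r1] := r01; have Lf := H2_L2 Hf; have i2 := L2_int Lf.
have n0 : normc (0 : C) < 1 by rewrite normc0.
have hG : holomorphicD (herglotz (fun z => normc (bv f z) ^+ 2) \o psi).
  by apply: holomorphicD_compD inner_lt1 _; [exact: inner_holo|exact: herglotz_holo].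
have hf : holomorphicD (f \o psi).
  by apply: holomorphicD_compD inner_lt1 _; [exact: inner_holo|case: Hf].
have /L1P[iG _] := L1_circle r01 hG.
apply: (@le_trans _ _ (meanT (fun z => complex.Re ((herglotz (fun z => normc (bv f z) ^+ 2) \o psi) (r%:C * z))))).
  apply: meanT_le => //; first exact: L2_int (L2_circle r01 hf).
  apply: aeT_all => z z1.
  have p1 : normc (psi (r%:C * z)) < 1 by apply: inner_lt1; rewrite normc_circle_scale.
  by rewrite [leRHS]herglotz_Re// -(H2_poisson Hf p1); exact: poisson_sqr.
rewrite -Re_meanTC mean_value// [leLHS]herglotz_Re//; last exact: inner_lt1.
have p0 : normc (psi 0) < 1 := inner_lt1 n0.
rewrite /sqnorm2 -meanTZ//; apply: meanT_le; [exact: aeint_poisson|exact: aeintZ|].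
by apply: aeT_all => z z1; rewrite ler_wpM2r ?sqr_ge0// poisson_le.
Qed.

Lemma H2_comp f : H2 f -> H2 (f \o psi).
Proof.
move=> Hf; split.
  by apply: holomorphicD_compD inner_lt1 _; [exact: inner_holo|case: Hf].
by exists (2 / (1 - normc (psi 0)) * sqnorm2 (bv f)) => r; exact: H2_comp_bound.
Qed.

Lemma bv_comp_continuous g (d : R) : 1 < d -> (forall z, normc z < d -> holo g z) ->
  aeT (fun z => bv (g \o psi) z = g (bv psi z)).
Proof.
move=> d1 hg; apply: aeT_mono2 (H2_radial inner_H2) inner_bv1 => z _ h p1; apply: bvE.
have /holo_continuous cg : holo g (bv psi z) by apply: hg; rewrite p1.
by apply: (cvg_comp (fun r : R => psi (r%:C * z) : C^o) (g : C^o -> C^o) h); exact: cg.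
Qed.

(** On the circle [poisson v] is the real part of [G], which is holomorphic beyond the closed disc.
    So the mean of its composition with [bv psi] is [Re (G (psi 0))], bounded uniformly as [v]
    approaches the circle because [|psi 0| < 1]. *)
Lemma meanT_poisson_comp c (s : R) : normc c = 1 -> 0 <= s < 1 ->
  aeint (fun z => poisson (s%:C * c) (bv psi z)) /\
  meanT (fun z => poisson (s%:C * c) (bv psi z)) <= 2 / (1 - normc (psi 0)).
Proof.
move=> c1 /andP[s0 s1]; pose v := s%:C * c.
have v1 : normc v = s by rewrite normc_circle_scale.
pose G w : C := 2 * (1 - v^* * w)^-1 - 1.
have n0 : normc (0 : C) < 1 by rewrite normc0.
have p0 : normc (psi 0) < 1 := inner_lt1 n0.
pose d := 2 / (1 + s).
have s2 : 0 < 1 + s by rewrite ltr_pwDl.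
have d1 : 1 < d by rewrite ltr_pdivlMr// mul1r; move: s1; lra.
have den w : normc w < d -> 1 - s * normc w <= normc (1 - v^* * w).
  move=> _; have := lec_normc_sub 1 (v^* * w); rewrite normc1 normcM normc_conj v1.
  exact: le_trans (ler_norm _).
have den0 w : normc w < d -> 0 < 1 - s * normc w.
  rewrite ltr_pdivlMr// => wd; have := normc_ge0 w; move: wd s0 s1; nra.
have hG w : normc w < d -> holo G w.
  move=> wd; apply: holoB; last exact: holo_cst.
  apply: holoM; first exact: holo_cst.
  apply: holoV; last by apply: holoB; [exact: holo_cst|apply: holoM; [exact: holo_cst|exact: holo_id]].
  by rewrite -normc_gt0; apply: lt_le_trans (den0 _ wd) (den _ wd).
have n2 : normc (2 : C) = 2 by rewrite -(rmorph_nat (real_complex R)) normc_real normr_nat.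
have Gb w : normc w < 1 -> normc (G w) <= 2 / (1 - s) + 1.
  move=> w1; apply: le_trans (le_normcD _ _) _.
  rewrite normcN normc1 lerD2r normcM normcV n2 ler_wpM2l//.
  have wd := lt_trans w1 d1.
  rewrite lef_pV2 ?posrE ?subr_gt0//; last exact: lt_le_trans (den0 _ wd) (den _ wd).
  by apply: le_trans (den _ wd); rewrite lerD2l lerN2 ler_piMr// ltW.
have hGp : holomorphicD (G \o psi).
  apply: holomorphicD_compD inner_lt1 _; first exact: inner_holo.
  by move=> w /disc_normc w1; apply: hG; exact: lt_trans d1.
have HGp : H2 (G \o psi).
  by apply: (H2_bounded hGp) => w w1; apply: Gb; exact: inner_lt1.
have eG : aeT (fun z => complex.Re (bv (G \o psi) z) = poisson v (bv psi z)).
  apply: aeT_mono2 (bv_comp_continuous d1 hG) inner_bv1 => z _ -> p1.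
  have v1' : normc v < 1 by rewrite v1.
  rewrite /poisson herglotzE//; rewrite -[RHS]cReJ; congr (complex.Re _).
  rewrite /cauchyK cconjB cconjM cconjV cconjB cconjM cconjK cconj1.
  by rewrite (_ : 2^* = 2 :> C) //; exact: rmorph_nat.
have /L1P[iG _] := L2_L1 (H2_L2 HGp).
split.
  by apply: aeint_ae iG; apply: aeT_mono eG => z _ ->.
rewrite -(meanT_ae eG) -Re_meanTC.
have -> : meanTC (bv (G \o psi)) = G (psi 0).
  rewrite -[RHS](H2_poisson HGp n0); apply: meanTC_ae; apply: aeT_all => z z1.
  by rewrite poissonE// normc0 expr0n subr0 subr0 z1 expr1n divr1 mul1r.
apply: le_trans (ler_norm _) _; apply: le_trans (ler_Re _) _.
have e : G (psi 0) = (1 + v^* * psi 0) / (1 - v^* * psi 0).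
  have h : 1 - v^* * psi 0 != 0.
    by rewrite -normc_gt0; apply: lt_le_trans (den0 _ (lt_trans p0 d1)) (den _ (lt_trans p0 d1)).
  by rewrite /G -[1 in X in _ - X](divff h) -mulrBl; congr (_ / _); ring.
have pd := lt_trans p0 d1; have d2 := den _ pd; have d3 := den0 _ pd.
rewrite e normcM normcV; apply: ler_pM; rewrite ?invr_ge0 ?normc_ge0//.
  apply: le_trans (le_normcD _ _) _; rewrite normc1 normcM normc_conj v1.
  by have := normc_ge0 (psi 0); move: p0 s0 s1; nra.
rewrite lef_pV2 ?posrE ?subr_gt0//; last exact: lt_le_trans d3 d2.
by apply: le_trans d2; rewrite lerD2l lerN2 ler_piMl ?normc_ge0// ltW.
Qed.

(** A point within [d] of [c] is within [2 * d] of [(1 - d) c], so the kernel there is at least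
    [(2 - d) / (4 * d)], hence at least [1 / (4 * d)]. For [d >= 1] the base point is 0 and the
    kernel is 1. *)
Lemma arc_le_poisson (c w : C) (d : R) : normc c = 1 -> normc w = 1 -> 0 < d -> normc (w - c) <= d ->
  1 <= 4 * d * poisson ((Num.max 0 (1 - d))%:C * c) w.
Proof.
move=> c1 w1 d0 wc; have [d1|d1] := leP (1 - d) 0.
  rewrite poissonE// mul0r ?normc0//.
  rewrite expr0n /= !subr0 w1 expr1n divr1 mulr1; move: d1; lra.
have n1 : normc ((1 - d)%:C * c) = 1 - d by rewrite normc_circle_scale// ltW.
have n2 : normc ((1 - d)%:C * c) < 1 by rewrite n1; move: d0; lra.
rewrite poissonE// n1; set n := normc (w - _).
have n0 : 0 < n.
  rewrite normc_gt0 subr_eq0; apply/eqP => e; move: n2; rewrite -e w1 ltxx//.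
have nd : n <= 2 * d.
  rewrite /n (_ : w - (1 - d)%:C * c = (w - c) + d%:C * c); last first.
    by rewrite rmorphB rmorph1; ring.
  apply: le_trans (le_normcD _ _) _; rewrite normc_circle_scale ?(ltW d0)//.
  by move: wc; lra.
rewrite mulrA ler_pdivlMr ?exprn_gt0// mul1r.
apply: (@le_trans _ _ ((2 * d) ^+ 2)); first by rewrite ler_sqr ?nnegrE ?(ltW n0) ?mulr_ge0 ?(ltW d0).
rewrite -subr_ge0 (_ : _ - _ = 4 * d * (d * (1 - d))); last by ring.
by rewrite !mulr_ge0 ?(ltW d0) ?(ltW d1).
Qed.

(* A null set is covered by arcs of small total length; the indicator of an arc of
   radius [d] is at most [4 d] times a Poisson kernel, whose composition with the
   boundary function of [psi] has bounded mean. *)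
Lemma inner_null_pullback (P : C -> Prop) : aeT P -> aeT (fun z => P (bv psi z)).
Proof.
move=> aP; pose K := 2 / (1 - normc (psi 0)).
have p0 : normc (psi 0) < 1 by apply: inner_lt1; rewrite normc0.
have K0 : 0 <= K by rewrite divr_ge0// subr_ge0 ltW.
have e0 (n : nat) : 0 < (2^-1 ^+ n : R) by rewrite exprn_gt0// invr_gt0.
have /choice[cd hcd] (n : nat) : exists cd : (nat -> C) * (nat -> R),
    [/\ forall k, normc (cd.1 k) = 1, forall k, 0 <= cd.2 k, forall N, \sum_(k < N) cd.2 k <= 2^-1 ^+ n &
      forall z, normc z = 1 -> ~ P z -> exists2 k, normc (z - cd.1 k) <= cd.2 k & 0 < cd.2 k].
  by have [c [d h]] := aeT_cover aP (e0 n); exists (c, d).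
pose g n k z := 4 * (cd n).2 k * poisson ((Num.max 0 (1 - (cd n).2 k))%:C * (cd n).1 k) (bv psi z).
have gP n k : [/\ aeint (g n k), aeT (fun z => 0 <= g n k z) & meanT (g n k) <= 4 * K * (cd n).2 k].
  have [c1 dge _ _] := hcd n.
  have := dge k; rewrite le_eqVlt => /predU1P[d0|d0].
    have gE z : g n k z = 0 by rewrite /g -d0 mulr0 mul0r.
    split.
    - by apply: aeint_ae (aeint_cst 0); apply: aeT_all => z _.
    - by apply: aeT_all => z _; rewrite gE.
    - rewrite -d0 mulr0 (@meanT_ae _ _ (fun=> 0)) ?meanT_cst//.
      by apply: aeT_all => z _.
  have s01 : 0 <= Num.max 0 (1 - (cd n).2 k) < 1.
    by rewrite le_max lexx /= gt_max ltr01 /= gtrBl.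
  have [ig mg] := meanT_poisson_comp (c1 k) s01.
  split.
  - exact: aeintZ.
  - apply: aeT_mono inner_bv1 => z _ pz; rewrite mulr_ge0 ?mulr_ge0 ?(ltW d0)//.
    apply: poisson_ge0 => //; rewrite normc_circle_scale//; by case/andP: s01.
  - by rewrite meanTZ// (mulrAC 4 K) ler_wpM2l// mulr_ge0// ltW.
have sum_le n N : \sum_(k < N) meanT (g n k) <= 4 * K * 2^-1 ^+ n.
  have [_ _ sd _] := hcd n.
  apply: (@le_trans _ _ (\sum_(k < N) 4 * K * (cd n).2 k)).
    by apply: ler_sum => k _; case: (gP n k).
  by rewrite -mulr_sumr ler_wpM2l// mulr_ge0.
have g0 : aeT (fun z => forall n k, 0 <= g n k z).
  by apply: aeT_forall => n; apply: aeT_forall => k; case: (gP n k).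
pose h n z := limn (series (fun k => g n k z)).
have hcv : aeT (fun z => forall n, cvgn (series (fun k => g n k z))).
  apply: aeT_forall => n; apply: (@meanT_series _ _ (4 * K * 2^-1 ^+ n)) => // k; by case: (gP n k).
have hP n : aeint (h n) /\ meanT (h n) <= 4 * K * 2^-1 ^+ n.
  have isum N : aeint (fun z => \sum_(k < N) g n k z) /\
      meanT (fun z => \sum_(k < N) g n k z) = \sum_(k < N) meanT (g n k).
    elim: N => [|N [iN mN]].
      have h0 : aeT (fun z => \sum_(k < 0) g n k z = 0) by apply: aeT_all => z _; rewrite big_ord0.
      by rewrite big_ord0 (meanT_ae h0) meanT_cst; split => //; apply: aeint_ae h0 (aeint_cst 0).
    have hS : aeT (fun z => \sum_(k < N.+1) g n k z = \sum_(k < N) g n k z + g n N z).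
      by apply: aeT_all => z _; rewrite big_ord_recr.
    have [ig _ _] := gP n N.
    split; first by apply: aeint_ae hS _; exact: aeintD.
    by rewrite (meanT_ae hS) meanTD// big_ord_recr /= mN.
  apply: (@meanT_fatou _ (fun N z => \sum_(k < N) g n k z)) => [N|N|N|].
  - by case: (isum N).
  - by apply: aeT_mono g0 => z _ gz; apply: sumr_ge0 => k _.
  - by case: (isum N) => _ ->.
  - apply: aeT_mono hcv => z _ /(_ n) cz.
    suff -> : (fun N => \sum_(k < N) g n k z) = series (fun k => g n k z) by exact: cz.
    by apply/funext => N; rewrite seriesEord.
have gh : aeT (fun z => forall n k, g n k z <= h n z).
  apply: aeT_mono2 g0 hcv => z _ gz cz n k.
  apply: le_trans (nondecreasing_cvgn_le _ (cz n) k.+1).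
    by rewrite seriesEord /= big_ord_recr /= lerDr sumr_ge0.
  by apply: nondecreasing_series => i _ _.
(* Borel-Cantelli: the covers of total length [2^-n] give summable means, so [h n z] tends to 0 for
   almost every [z], whereas [h n z >= 1] whenever [bv psi z] is exceptional. *)
have sh : aeT (fun z => cvgn (series (fun n => h n z))).
  apply: (@meanT_series _ _ (8 * K)) => [n|n|N].
  - by case: (hP n).
  - by apply: aeT_mono2 g0 gh => z _ gz hz; apply: le_trans (gz n 0%N) (hz n 0%N).
  apply: (@le_trans _ _ (\sum_(n < N) 4 * K * 2^-1 ^+ n)).
    by apply: ler_sum => n _; case: (hP n).
  rewrite -mulr_sumr.
  have gs : (1 - 2^-1) * \sum_(k < N) (2^-1 : R) ^+ k = 1 - 2^-1 ^+ N.
    by rewrite -opprB mulNr -subrX1 opprB.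
  have s2 : \sum_(k < N) (2^-1 : R) ^+ k <= 2.
    by have := ltW (e0 N); move: gs; lra.
  have := ler_wpM2l (mulr_ge0 (ler0n R 4) K0) s2; lra.
apply: aeT_mono2 (aeT_mono2 (fun z _ => @conj _ _) sh gh) inner_bv1 => z z1 [/cvg_series_cvg_0 hz ghz] p1.
apply: contrapT => nP.
have h1 n : 1 <= h n z.
  have [c1 _ _ /(_ _ p1 nP)[k kd d0]] := hcd n.
  by apply: le_trans (ghz n k); exact: arc_le_poisson.
have : (1 : R) <= 0.
  rewrite -(cvg_lim _ hz)//; apply: limr_ge; first by apply/cvg_ex; eexists; exact: hz.
  exact: nearW.
by rewrite leNgt ltr01.
Qed.

End inner_composition.

(** * Boundary functions and symbols composed with an inner function *)

Section boundary_composition.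
Context {R : realType}.
Local Notation C := R[i].
Implicit Types (f g : C -> C) (z w : C) (p : {poly C}).

Lemma measurableTV f : measT f -> aeT (fun z => f z != 0) -> measT (fun z => (f z)^-1).
Proof.
move=> mf f0.
apply: (@measurableT_ae _ _ (fun z => (f z)^* * (expR (- ln (normc (f z) ^+ 2)))%:C)).
  apply: aeT_mono f0 => z _ fz.
  have n0 : 0 < normc (f z) ^+ 2 by rewrite exprn_gt0// normc_gt0.
  apply: (mulfI fz); rewrite divff// mulrA mulcJ expRN lnK ?posrE// -rmorphM /=.
  by rewrite divff ?rmorph1// gt_eqF.
apply: measurableTM; first exact: measurableT_conj.
apply: measurableT_real; apply: (@aemeas_comp _ (fun x => expR (- ln x)) (fun z => normc (f z) ^+ 2)).
  apply: (measurableT_comp (@measurable_expR R)).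
  by apply: (measurableT_comp (@oppr_measurable R setT)); exact: measurable_ln.
exact: aemeas_normc2.
Qed.

(** Turns radial limits into limits of sequences; [n.+2] keeps every radius strictly between 0 and
    1. *)
Definition radius n : R := 1 - n.+2%:R^-1.

Lemma radius01 n : 0 < radius n < 1.
Proof.
have h : 0 < (n.+2%:R^-1 : R) by rewrite invr_gt0.
have h2 : (n.+2%:R^-1 : R) < 1 by rewrite invf_lt1 ?ltr1n.
by rewrite /radius subr_gt0 h2 gtrBl h.
Qed.

Lemma cvg_radius : radius @ \oo --> (1 : R)^'-.
Proof.
move=> P [e /= e0 he]; have [n0 _ hn0] := near_infty_natSinv_lt (PosNum e0).
exists n0 => // n /= n0n; have /andP[r0 r1] := radius01 n; apply: he => //=.
rewrite /ball_ /radius opprB addrC subrK ger0_norm ?invr_ge0//.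
by apply: (hn0 n.+1); rewrite /= (leq_trans n0n).
Qed.

Lemma holo_horner p z : holo (fun w => p.[w]) z.
Proof.
have -> : (fun w => p.[w]) = (fun w => \sum_(i < size p) p`_i * w ^+ i).
  by apply/funext => w; rewrite horner_coef.
by apply: holo_sum => i; apply: holoM; [exact: holo_cst|apply: holoX; exact: holo_id].
Qed.

Lemma bv_horner p z : bv (fun w => p.[w]) z = p.[z].
Proof. by apply: bvE; apply: holo_radial; exact: holo_horner. Qed.

Lemma H2_horner p : H2 (fun w => p.[w]).
Proof.
split; first by move=> z _; exact: holo_horner.
exists (\sum_(i < size p) normc p`_i ^+ 2) => r /andP[r0 r1].
have -> : meanT (fun z => normc p.[r%:C * z] ^+ 2) = sqnorm2 (fun z => (p \Po (r%:C *: 'X)).[z]).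
  by apply: meanT_ae; apply: aeT_all => z _; rewrite horner_comp hornerZ hornerX.
rewrite (@sqnorm2_horner _ _ (size p)); last first.
  have [->|p0] := eqVneq p 0; first by rewrite comp_poly0 size_poly0.
  apply: leq_trans (size_comp_poly_leq _ _) _.
  have : (size (r%:C *: 'X : {poly C}) <= 2)%N by apply: leq_trans (size_scale_leq _ _) _; rewrite size_polyX.
  have : (0 < size p)%N by rewrite size_poly_gt0.
  nia.
apply: ler_sum => i _; rewrite comp_polyE coef_sum (bigD1 i)//= big1 ?addr0; last first.
  move=> j ji; rewrite exprZn !coefZ coefXn (_ : (_ == _)%N = false) ?mulr0//.
  by apply: contra_neqF ji => /eqP ij; apply: val_inj.
rewrite exprZn !coefZ coefXn eqxx mulr1 normcM normcX normc_real ger0_norm//.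
by rewrite exprMn ler_piMr ?sqr_ge0// -exprM exprn_ile1// ltW.
Qed.

Lemma H2B f g : H2 f -> H2 g -> H2 (fun z => f z - g z).
Proof.
move=> [hf [M fM]] [hg [N gN]]; split.
  by move=> z zd; apply: holoB; [exact: hf|exact: hg].
exists (2 * M + 2 * N) => r r01.
have Lf := L2_circle r01 hf; have Lg := L2_circle r01 hg.
apply: (@le_trans _ _ (meanT (fun z => 2 * normc (f (r%:C * z)) ^+ 2 + 2 * normc (g (r%:C * z)) ^+ 2))).
  apply: meanT_le.
  - by apply: L2_int; exact: L2B.
  - by apply: aeintD; apply: aeintZ; exact: L2_int.
  - by apply: aeT_all => z _; apply: le_trans (normcD_sqr _ _) _; rewrite normcN.
rewrite meanTD; [|by apply: aeintZ; exact: L2_int|by apply: aeintZ; exact: L2_int].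
rewrite !meanTZ; [|exact: L2_int|exact: L2_int].
by rewrite lerD// ler_wpM2l// ?fM ?gN.
Qed.

Lemma bvB f g : H2 f -> H2 g -> aeT (fun z => bv (fun w => f w - g w) z = bv f z - bv g z).
Proof.
move=> Hf Hg; apply: aeT_mono2 (H2_radial Hf) (H2_radial Hg) => z _ hf hg.
by apply: bvE; exact: (cvgCB hf hg).
Qed.

Lemma sqnorm2_bv f (M : R) : H2 f ->
  (forall r : R, 0 <= r < 1 -> sqnorm2 (fun z => f (r%:C * z)) <= M) -> sqnorm2 (bv f) <= M.
Proof.
move=> Hf fM.
have r01 n : 0 <= radius n < 1 by have /andP[/ltW -> ->] := radius01 n.
suff [] : aeint (fun z => normc (bv f z) ^+ 2) /\ sqnorm2 (bv f) <= M by [].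
apply: (@meanT_fatou _ (fun n z => normc (f ((radius n)%:C * z)) ^+ 2)).
- by move=> n; apply: L2_int; apply: L2_circle => //; case: Hf.
- by move=> n; apply: aeT_all => z _; exact: sqr_ge0.
- by move=> n; exact: fM.
- apply: aeT_mono (H2_radial Hf) => z _ /cvgC_norm h.
  have h1 := cvg_comp radius (fun r : R => normc (f (r%:C * z))) cvg_radius h.
  exact: (cvgM h1 h1).
Qed.

(** Fatou's lemma on the tails bounds the mean of [|b - a|^2] by every positive [e]. *)
Lemma L2_ae_limit_unique (a_ : nat -> C -> C) (a b : C -> C) :
  (forall n, L2 (a_ n)) -> L2 a -> sqnorm2 (fun z => a_ n z - a z) @[n --> \oo] --> (0 : R) ->
  aeT (fun z => (fun n => a_ n z : C^o) @ \oo --> (b z : C^o)) -> aeT (fun z => a z = b z).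
Proof.
move=> L_ L a0 ab.
have key (e : R) : 0 < e -> aeint (fun z => normc (b z - a z) ^+ 2) /\ sqnorm2 (fun z => b z - a z) <= e.
  move=> e0; move/cvgrPdist_le : a0 => /(_ _ e0)[N _ hN].
  apply: (@meanT_fatou _ (fun n z => normc (a_ (n + N)%N z - a z) ^+ 2)).
  - by move=> n; apply: L2_int; exact: L2B.
  - by move=> n; apply: aeT_all => z _; exact: sqr_ge0.
  - move=> n; have := hN (n + N)%N (leq_addl _ _); rewrite sub0r normrN.
    exact: le_trans (ler_norm _).
  - apply: aeT_mono ab => z _ hz.
    have h : (fun n => normc (a_ (n + N)%N z - a z)) @ \oo --> normc (b z - a z).
      apply: cvgC_norm; apply: cvgCB; last exact: cvg_cst.
      by rewrite (cvg_shiftn N (fun n => a_ n z : C^o)).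
    exact: (cvgM h h).
have [i1 _] := key 1 ltr01.
have : aeT (fun z => normc (b z - a z) ^+ 2 = 0).
  apply: meanT_eq0 => //; first by apply: aeT_all => z _; exact: sqr_ge0.
  by apply/ler_addgt0Pr => e /key[_]; rewrite add0r.
apply: aeT_mono => z _ /eqP; rewrite sqrf_eq0 normc_eq0 subr_eq0 => /eqP ->.
by [].
Qed.

Variable psi : C -> C.
Hypothesis psi_inner : inner_fun psi.
Hypothesis psi_nonconstant : nonconstantD psi.

(** The path [psi (r z)] need not approach the circle radially, so radial limits cannot simply be
    composed. The identity is clear for the polynomials [T n]. Their compositions converge in L^2 to
    the left side by [H2_comp_bound], and almost everywhere to the right side by pulling back null
    sets. *)
Lemma bv_comp f : H2 f -> aeT (fun z => bv (f \o psi) z = bv f (bv psi z)).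
Proof.
move=> Hf; have [_ _ [T [Tf Tae _]]] := H2_boundary Hf.
have HT n : H2 (fun w => (T n).[w]) := H2_horner (T n).
have HD n := H2B Hf (HT n).
have HfP := H2_comp psi_inner psi_nonconstant Hf.
have HTP n : H2 ((fun w => (T n).[w]) \o psi) := H2_comp psi_inner psi_nonconstant (HT n).
have HDP n : H2 ((fun w => f w - (T n).[w]) \o psi) := H2_comp psi_inner psi_nonconstant (HD n).
pose K := 2 / (1 - normc (psi 0)).
have eT n : aeT (fun z => bv ((fun w => (T n).[w]) \o psi) z = (T n).[bv psi z]).
  apply: (@bv_comp_continuous _ _ psi_inner (fun w => (T n).[w]) 2); first by rewrite ltr1n.
  by move=> z _; exact: holo_horner.
have L_ n : L2 (fun z => (T n).[bv psi z]).
  by apply: L2_ae (H2_L2 (HTP n)); apply: aeT_mono (eT n) => z _ ->.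
apply: (L2_ae_limit_unique L_ (H2_L2 HfP)); last exact: (inner_null_pullback psi_inner psi_nonconstant Tae).
apply: (@squeeze_cvgr _ _ _ _ (fun=> 0) (fun n => K * sqnorm2 (fun z => (T n).[z] - bv f z))).
- apply: nearW => n; rewrite sqnorm2_ge0 /=.
  have -> : sqnorm2 (fun z => (T n).[z] - bv f z) = sqnorm2 (bv (fun w => f w - (T n).[w])).
    apply: meanT_ae; apply: aeT_mono (bvB Hf (HT n)) => z _ ->.
    by rewrite bv_horner normcB.
  have -> : sqnorm2 (fun z => (T n).[bv psi z] - bv (f \o psi) z) = sqnorm2 (bv ((fun w => f w - (T n).[w]) \o psi)).
    apply: meanT_ae; have e := bvB HfP (HTP n).
    apply: aeT_mono2 e (eT n) => z _ e1 e2.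
    by rewrite normcB -e2 -e1.
  apply: sqnorm2_bv => // r r01.
  exact: (H2_comp_bound psi_inner psi_nonconstant (HD n) r01).
- exact: cvg_cst.
- by rewrite -(mulr0 K); exact: cvgMr.
Qed.

(** After scaling by a radius below 1 the Cauchy integral is holomorphic across the circle, so its
    composition with [bv psi] is the boundary function of a bounded holomorphic function. *)
Lemma measT_cauchy_comp f n : L1 f -> measT (fun z => meanTC (fun zeta => cauchyK ((radius n)%:C * bv psi z) zeta * f zeta)).
Proof.
move=> Lf; pose g w := meanTC (fun zeta => cauchyK ((radius n)%:C * w) zeta * f zeta).
have /andP[r0 r1] := radius01 n; have [_ iN] := Lf.
have nr w : normc ((radius n)%:C * w) = radius n * normc w.
  by rewrite normcM normc_real gtr0_norm.
have hg w : normc w < (radius n)^-1 -> holo g w.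
  move=> w1; apply: (@holo_comp _ (fun w => (radius n)%:C * w) (fun v => meanTC (fun zeta => cauchyK v zeta * f zeta))).
    by apply: holoM; [exact: holo_cst|exact: holo_id].
  by apply: cauchy_holo => //; rewrite nr -ltr_pdivlMl// mulr1.
have d1 : 1 < (radius n)^-1 by rewrite invf_gt1.
have e := bv_comp_continuous psi_inner d1 hg.
apply: (@measurableT_ae _ _ (bv (g \o psi))); first by apply: aeT_mono e => z _ ->.
apply: L2_measT; apply: H2_L2.
apply: (@H2_bounded _ _ ((1 - radius n)^-1 * meanT (fun z => normc (f z)))).
  apply: holomorphicD_compD (inner_lt1 psi_inner psi_nonconstant) _; first exact: inner_holo.
  by move=> w /disc_normc w1; apply: hg; exact: lt_trans d1.
move=> z /(inner_lt1 psi_inner psi_nonconstant) p1 /=.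
have v1 : normc ((radius n)%:C * psi z) <= radius n by rewrite nr ler_piMr// ltW.
have v2 := le_lt_trans v1 r1.
apply: le_trans (meanTC_norm (L1_cauchyK v2 Lf)) _.
rewrite -meanTZ//; apply: meanT_le; [by case: (L1_cauchyK v2 Lf)|exact: aeintZ|].
apply: aeT_all => w w1; rewrite normcM ler_wpM2r ?normc_ge0//.
apply: le_trans (normc_cauchyK w1 v2) _.
by rewrite lef_pV2 ?posrE ?subr_gt0// lerD2l lerN2.
Qed.

(* [f] is the radial limit of its Poisson integral, which is a combination of
   Cauchy integrals and their conjugates. *)
Lemma measT_comp f : L1 f -> measT (fun z => f (bv psi z)).
Proof.
move=> Lf; have Lc := L1_conj Lf.
pose P n w := meanTC (fun zeta => (poisson ((radius n)%:C * w) zeta)%:C * f zeta).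
apply: (@measurableT_cvg _ (fun n z => P n (bv psi z))).
  move=> n; have /andP[r0 r1] := radius01 n.
  apply: (measurableT_ae _ (measurableTB (measurableTD (measT_cauchy_comp n Lf)
    (measurableT_conj (measT_cauchy_comp n Lc))) (measurableT_cst (meanTC f)))).
  apply: aeT_mono (inner_bv1 psi_inner) => z _ p1.
  have v1 : normc ((radius n)%:C * bv psi z) < 1 by rewrite normc_circle_scale// ltW.
  rewrite /P; move: ((radius n)%:C * bv psi z) v1 => v v1 {z p1}.
  have LK := L1_cauchyK v1 Lf; have LKc := L1_cauchyK v1 Lc.
  rewrite -meanTC_conj// -meanTCD//; last exact: L1_conj.
  rewrite -meanTCB//; last by apply: L1D => //; exact: L1_conj.
  apply: meanTC_ae; apply: aeT_all => w w1.
  by rewrite poisson_conjE// cconjM cconjK; ring.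
suff h : aeT (fun z => (fun n => P n z : C^o) @ \oo --> (f z : C^o)).
  exact: (inner_null_pullback psi_inner psi_nonconstant h).
apply: aeT_mono (lebesgueT_L1 Lf) => z z1 Lz.
exact: (cvg_comp radius (fun r : R => meanTC (fun w => (poisson (r%:C * z) w)%:C * f w) : C^o) cvg_radius (fatou_poisson z1 Lf Lz)).
Qed.

Lemma Linfty_comp f : Linfty f -> Linfty (fun z => f (bv psi z)).
Proof.
move=> [mf [M fM]]; split; first by apply: measT_comp; exact: L1_bounded fM.
by exists M; exact: (inner_null_pullback psi_inner psi_nonconstant fM).
Qed.

End boundary_composition.

(** * Toeplitz kernels *)

Section toeplitz_kernels.
Context {R : realType}.
Local Notation C := R[i].
Implicit Types (f g h k p q s : C -> C) (z w : C).

Lemma aeT_const (P : Prop) : aeT (fun _ : C => P) -> P.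
Proof.
move=> h; apply: contrapT => nP; have : aeT (fun _ : C => (1 : R) = 0).
  by apply: aeT_mono h => z _ /nP.
by move/meanT_ae; rewrite !meanT_cst => /eqP; rewrite oner_eq0.
Qed.

Lemma H2_bv_neq0 f : H2 f -> nonzeroD f -> aeT (fun z => bv f z != 0).
Proof. by move=> Hf fn; have [] := log_integrable Hf fn. Qed.

Lemma nonzeroD_not f : ~ aeT (fun z => bv f z = 0) -> H2 f -> nonzeroD f.
Proof.
move=> nf Hf; apply: contrapT => f0; apply: nf.
have fz z : normc z < 1 -> 0 = f z.
  by move=> z1; apply/esym/eqP/negPn/negP => fz; apply: f0; exists z => //; apply/disc_normc.
by apply: aeT_mono (bv_eq fz (H2_cst 0)) => z _ ->; rewrite bv_cst.
Qed.

Lemma circle_conj_conj z (h : C) : normc z = 1 -> (z * (z * h)^*)^* = h.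
Proof.
by move=> z1; rewrite !cconjM !cconjK mulrA [z^* * z]mulrC circle_conj// mul1r.
Qed.

(** Testing orthogonality of [g f] against [z ^+ n] and conjugating gives the moment condition of
    [H2_of_L2] for [conj(z g f)], with the extra [z] accounting for the shift from [n] to [n.+1]. *)
Lemma toeplitz_kerP g f : Linfty g ->
  toeplitz_ker g f <->
  H2 f /\ exists2 p, H2 p & aeT (fun z => g z * bv f z = (z * bv p z)^*).
Proof.
move=> [mg [M gM]]; split=> [[Hf [Lh _ orth]]|[Hf [p Hp e]]].
  split=> //; set h := fun z => g z * bv f z in Lh orth.
  have Lw : L2 (fun z => (z * h z)^*).
    apply: L2_conj; apply: (@L2_bounded_mul _ _ _ 1) => //; first exact: measurableT_id.
    by apply: aeT_all => z ->.
  have [n|p Hp ep] := H2_of_L2 Lw.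
    have Xe z : ('X^n : {poly C}).[z] = z ^+ n by rewrite hornerXn.
    have := orth _ (H2_horner 'X^n) => /(congr1 (fun x : C => x^*)).
    rewrite cconj0 -meanTC_conj; last first.
      apply: L1_L2M; last by apply: L2_conj; exact: H2_L2 (H2_horner _).
      by apply: L2B => //; apply: H2_L2; exact: (H2_cst 0).
    move=> <-; apply: meanTC_ae; apply: aeT_all => z z1.
    rewrite (bv_cst 0) subr0 bv_horner Xe !cconjM cconjK exprSr.
    by rewrite -mulrA [z * _]mulrA circle_conj// mul1r mulrC.
  by exists p => //; apply: aeT_mono ep => z z1 ->; rewrite circle_conj_conj.
have Lh : L2 (fun z => g z * bv f z) := L2_bounded_mul mg gM (H2_L2 Hf).
split=> //; split=> //; first exact: (H2_cst 0).
move=> k Hk; have L := L1_L2M (H2_L2 Hp) (H2_L2 Hk).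
rewrite /inner_product (@meanTC_ae _ _ (fun z => (z ^+ 1 * (bv p z * bv k z))^*)).
  by rewrite meanTC_conj ?H2_mul_analytic ?cconj0//; exact: L1_X.
by apply: aeT_mono e => z _ ->; rewrite (bv_cst 0) subr0 expr1 !cconjM mulrA.
Qed.

Lemma toeplitz_ker_min g k q : Linfty g -> H2 k -> H2 q -> approx_invertible q ->
  aeT (fun z => g z * bv k z = (z * bv q z)^*) ->
  forall h, Linfty h -> toeplitz_ker h k -> toeplitz_ker g `<=` toeplitz_ker h.
Proof.
move=> gL Hk Hq oq gk h hL /(toeplitz_kerP _ hL)[_ [t Ht hk]] f /(toeplitz_kerP _ gL)[Hf [s Hs gf]].
have [mh [M hM]] := hL.
have Lhf : L2 (fun z => h z * bv f z) := L2_bounded_mul mh hM (H2_L2 Hf).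
have Lw : L2 (fun z => (z * (h z * bv f z))^*).
  apply: L2_conj; apply: (@L2_bounded_mul _ _ _ 1) => //; first exact: measurableT_id.
  by apply: aeT_all => z ->.
have [|G HG eG] := division Lw Hq Hs Ht oq.
  apply: aeT_mono2 gk (aeT_mono2 (fun z _ => @conj _ _) hk gf) => z z1 gk1 [hk1 gf1].
  have [qE tE sE] : [/\ bv q z = (z * (g z * bv k z))^*, bv t z = (z * (h z * bv k z))^* &
      bv s z = (z * (g z * bv f z))^*].
    by rewrite gk1 hk1 gf1 !cconjM !cconjK !mulrA [z^* * z]mulrC circle_conj// !mul1r.
  by rewrite qE tE sE -!cconjM; congr (_^*); ring.
apply/(toeplitz_kerP _ hL); split=> //; exists G => //.
by apply: aeT_mono eG => z z1 ->; rewrite circle_conj_conj.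
Qed.

Lemma toeplitz_ker_neq0 g f p : ~ aeT (fun z => g z = 0) -> H2 f -> nonzeroD f -> H2 p ->
  aeT (fun z => g z * bv f z = (z * bv p z)^*) -> nonzeroD p.
Proof.
move=> g0 Hf fn Hp e; apply: nonzeroD_not => // p0; apply: g0.
apply: aeT_mono2 (H2_bv_neq0 Hf fn) (aeT_mono2 (fun z _ => @conj _ _) e p0) => z z1 fz [+ pz].
by rewrite pz mulr0 cconj0 => /eqP; rewrite mulf_eq0 (negPf fz) orbF => /eqP.
Qed.

Lemma H2_mul_inner f b : inner_fun b -> H2 f -> H2 (fun z => f z * b z).
Proof.
move=> ib Hf; apply: (@H2_eq _ (fun z => b z * f z)) => [z _|]; first by rewrite mulrC.
exact: (H2_bounded_mul (inner_H2 ib) (inner_le1 ib) Hf).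
Qed.

Lemma mul_inner_toeplitz g f p po b : H2 f -> H2 p -> H2 po -> inner_fun b ->
  (forall z, normc z < 1 -> p z = b z * po z) ->
  aeT (fun z => g z * bv f z = (z * bv p z)^*) ->
  aeT (fun z => g z * bv (fun w => f w * b w) z = (z * bv po z)^*).
Proof.
move=> Hf Hp Hpo ib pE e; have Hb := inner_H2 ib.
have e1 := bvM Hf Hb; have e2 := bvM Hb Hpo.
have e3 : aeT (fun z => bv (fun w => b w * po w) z = bv p z) by exact: (bv_eq pE Hp).
apply: aeT_mono2 (aeT_mono2 (fun z _ => @conj _ _) e1 e2)
  (aeT_mono2 (fun z _ => @conj _ _) e3 (aeT_mono2 (fun z _ => @conj _ _) e (inner_bv1 ib))).
move=> z z1 [-> E2] [E3 [E b1]]; rewrite mulrA E -E3 E2 !cconjM.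
by rewrite -mulrA -mulrA [(bv po z)^* * _]mulrC [_^* * (bv b z * _)]mulrA [(bv b z)^* * _]mulrC circle_conj// mul1r.
Qed.

(* The unimodular symbol [conj(z phi) / phi_o] has [phi] in its kernel with outer
   companion, so maximality of [phi] puts [phi b] in that kernel as well, which
   makes the inner factor [b] of [p] invertible. *)
Lemma maximal_vector_outer g phi p : Linfty g -> ~ aeT (fun z => g z = 0) ->
  maximal_vector phi (toeplitz_ker g) -> H2 p ->
  aeT (fun z => g z * bv phi z = (z * bv p z)^*) -> approx_invertible p.
Proof.
move=> gL g0 [Hphi phin [_ phi_in phi_min]] Hp e.
have pn := toeplitz_ker_neq0 g0 Hphi phin Hp e.
have [po [b [Hpo apo ib pE]]] := inner_outer Hp pn.
have [a [c [Ha aa ic phiE]]] := inner_outer Hphi phin.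
have Hc := inner_H2 ic; have Hb := inner_H2 ib.
have n0 : normc (0 : C) < 1 by rewrite normc0.
have an : nonzeroD a by exists 0; [apply/disc_normc|exact: approx_invertible_neq0 aa n0].
have a0 := H2_bv_neq0 Ha an.
have ephi : aeT (fun z => bv phi z = bv c z * bv a z).
  by apply: aeT_mono2 (bvM Hc Ha) (bv_eq phiE Hphi) => z _ <- ->.
pose h z := (z * bv phi z)^* / bv a z.
have hn : aeT (fun z => normc (h z) = 1).
  apply: aeT_mono2 ephi (aeT_mono2 (fun z _ => @conj _ _) a0 (inner_bv1 ic)) => z z1 E [az cz].
  rewrite /h normcM normcV normc_conj normcM z1 mul1r E normcM cz mul1r divff//.
  by rewrite gt_eqF// normc_gt0.
have hL : Linfty h.
  split; last by exists 1; apply: aeT_mono hn => z _ ->.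
  apply: measurableTM; last by apply: measurableTV => //; exact: L2_measT (H2_L2 Ha).
  apply: measurableT_conj; apply: measurableTM; first exact: measurableT_id.
  exact: L2_measT (H2_L2 Hphi).
have hphi : aeT (fun z => h z * bv phi z = (z * bv a z)^*).
  apply: aeT_mono2 ephi (aeT_mono2 (fun z _ => @conj _ _) a0 (inner_bv1 ic)) => z z1 E [az cz].
  rewrite /h E !cconjM.
  have -> : z^* * ((bv c z)^* * (bv a z)^*) / bv a z * (bv c z * bv a z) =
    z^* * (bv a z)^* * (bv c z * (bv c z)^*) * ((bv a z) / bv a z) by ring.
  by rewrite circle_conj// divff// !mulr1.
have phib : toeplitz_ker g (fun w => phi w * b w).
  apply/(toeplitz_kerP _ gL); split; first exact: H2_mul_inner.
  by exists po => //; exact: mul_inner_toeplitz e.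
have : toeplitz_ker h (fun w => phi w * b w).
  apply: (phi_min h hL _ _ phib) => _ ->; apply/(toeplitz_kerP _ hL); split => //.
  by exists a.
move=> /(toeplitz_kerP _ hL)[_ [s Hs hs]].
(* Dividing the two kernel equations for [h] gives [s = a conj(b)] on the circle, that is [a = s b],
   since [b] is unimodular there. *)
have as_ z : normc z < 1 -> a z = s z * b z.
  move=> z1; apply: (H2_bv_inj Ha (H2_mul_inner ib Hs) _ z1).
  have e1 := bvM Hphi Hb; have e2 := bvM Hs Hb.
  apply: aeT_mono2 (aeT_mono2 (fun z _ => @conj _ _) e1 e2)
    (aeT_mono2 (fun z _ => @conj _ _) hs (aeT_mono2 (fun z _ => @conj _ _) hphi (inner_bv1 ib))).
  move=> w w1 [E1 ->] [E3 [E4 b1]].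
  move: E3; rewrite E1 mulrA E4 => /(congr1 (fun x : C => w * x^*)).
  rewrite !cconjM !cconjK => E5.
  have [w2 b2] : w^* * w = 1 /\ (bv b w)^* * bv b w = 1.
    by split; rewrite mulrC circle_conj.
  have w0 : w != 0 by rewrite -normc_gt0 w1.
  have -> : bv s w = bv a w * (bv b w)^* by apply: (mulfI w0); apply: (mulfI w0); rewrite -E5; ring.
  by rewrite -mulrA b2 mulr1.
(* On the circle [|r_n s| = |r_n a| <= 1], so the maximum principle bounds [r_n s] by 1 in the disc.
   Hence [|r_n a| <= |b|], while [r_n a] tends to 1. *)
have b1 z : normc z < 1 -> 1 <= normc (b z).
  move=> z1; have [r [hr br nr cr]] := aa.
  have rs n w : normc w < 1 -> normc (r n w * s w) <= 1.
    have [M rM] := br n; have Hr := H2_bounded (hr n) rM.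
    have Hrs := H2_bounded_mul Hr rM Hs; have Hra := H2_bounded_mul Hr rM Ha.
    apply: (maximum_principle Hrs).
    have as_r z' : normc z' < 1 -> r n z' * a z' = (r n z' * s z') * b z' by move=> /as_ ->; rewrite mulrA.
    have e1 := bvM Hrs Hb.
    have e2 := bv_eq as_r Hra.
    apply: aeT_mono2 (aeT_mono2 (fun z _ => @conj _ _) e1 e2)
      (aeT_mono2 (fun z _ => @conj _ _) (bv_bounded Hra (nr n)) (inner_bv1 ib)) => x x1 [E1 E2] [ra bx].
    by move: ra; rewrite -E2 E1 normcM bx mulr1.
  have h1 : (fun n => normc (r n z * a z)) @ \oo --> normc (1 : C).
    exact: (cvgC_norm (cr z z1)).
  rewrite normc1 in h1.
  rewrite -(cvg_lim _ h1)//; apply: limr_le; first by apply/cvg_ex; eexists; exact: h1.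
  apply: nearW => n; rewrite as_// mulrA normcM ler_piMl ?normc_ge0//; exact: rs.
have b0 z : normc z < 1 -> b z != 0 by move=> /b1 h1; rewrite -normc_gt0 (lt_le_trans ltr01).
have [r [hr br nr cr]] := apo.
have rE n z : normc z < 1 -> r n z / b z * p z = r n z * po z.
  by move=> z1; rewrite pE// mulrA divfK ?b0.
exists (fun n z => r n z / b z); split.
- move=> n z zd; apply: holoM; first exact: hr.
  apply: holoV; first by apply: b0; apply/disc_normc.
  exact: (inner_holo ib).
- move=> n; have [M rM] := br n; exists M => z z1.
  rewrite normcM normcV; apply: le_trans (rM z z1).
  by rewrite ler_piMr ?normc_ge0// invf_le1 ?b1// normc_gt0 b0.
- by move=> n z z1; rewrite rE//; exact: nr.
- move=> z z1; have -> : (fun n => r n z / b z * p z) = (fun n => r n z * po z).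
    by apply/funext => n; exact: rE.
  exact: cr.
Qed.

End toeplitz_kernels.

(** * The symbol [H] and the minimality of its kernel *)

Theorem theorem3p6 (R : realType) (F u uo psi : R[i] -> R[i])
  (F_Linfty : Linfty F) (F_neq0 : ~ aeT (fun zeta => F zeta = 0))
  (u_H2 : H2 u) (u_neq0 : nonzeroD u)
  (kerF_neq0 : exists2 f, toeplitz_ker F f & nonzeroD f)
  (u_kerF : mul_op u @` toeplitz_ker F `<=` H2)
  (uo_outer_factor : outer_factor u uo)
  (psi_inner : inner_fun psi) (psi_nonconstant : nonconstantD psi) :
  let H : R[i] -> R[i] := fun zeta =>
    bv psi zeta * F (bv psi zeta) *
    ((bv (comp_op psi u) zeta)^* / (zeta * bv (comp_op psi uo) zeta)) in
  [/\ Linfty H,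
      is_min_toeplitz_ker (comp_op psi @` (mul_op u @` toeplitz_ker F))
        (toeplitz_ker H) &
      forall phim : R[i] -> R[i], maximal_vector phim (toeplitz_ker F) ->
        maximal_vector (comp_op psi (mul_op u phim)) (toeplitz_ker H)].
Proof.
move=> H.
have [Huo ouo [ui iui uE]] := uo_outer_factor.
have auo := outer_fun_approx_invertible ouo.
have n0 : normc (0 : R[i]) < 1 by rewrite normc0.
have uon : nonzeroD uo by exists 0; [apply/disc_normc|exact: approx_invertible_neq0 auo n0].
have pull := inner_null_pullback psi_inner psi_nonconstant.
have Hcomp f : H2 f -> H2 (comp_op psi f) by exact: H2_comp.
have comp_bv f : H2 f -> aeT (fun z => bv (comp_op psi f) z = bv f (bv psi z)).
  by move=> Hf; exact: bv_comp.
have comp_inv o : approx_invertible o -> approx_invertible (comp_op psi o).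
  move=> ao; apply: approx_invertible_comp => //; first exact: inner_holo.
  exact: inner_lt1.
have norm_u : aeT (fun z => bv uo z != 0 /\ normc (bv u z) = normc (bv uo z)).
  have uE' z : normc z < 1 -> u z = ui z * uo z by move=> /disc_normc; exact: uE.
  have e1 := bvM (inner_H2 iui) Huo; have e2 := bv_eq uE' u_H2.
  apply: aeT_mono2 (aeT_mono2 (fun z _ => @conj _ _) e1 e2)
    (aeT_mono2 (fun z _ => @conj _ _) (H2_bv_neq0 Huo uon) (inner_bv1 iui)) => z z1 [E1 E2] [E3 E4].
  by split=> //; rewrite -E2 E1 normcM E4 mul1r.
have U := comp_bv _ u_H2; have V := comp_bv _ Huo.
have HL : Linfty H.
  have [mF [M FM]] := Linfty_comp psi_inner psi_nonconstant F_Linfty.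
  split.
    apply: measurableTM; first by apply: measurableTM => //; exact: L2_measT (H2_L2 (inner_H2 psi_inner)).
    apply: measurableTM; first by apply: measurableT_conj; exact: L2_measT (H2_L2 (Hcomp _ u_H2)).
    apply: measurableTV.
      by apply: measurableTM; [exact: measurableT_id|exact: L2_measT (H2_L2 (Hcomp _ Huo))].
    apply: aeT_mono2 V (pull _ norm_u) => z z1 -> [vz _].
    by rewrite mulf_neq0// -normc_gt0 z1.
  exists M; apply: aeT_mono2 (aeT_mono2 (fun z _ => @conj _ _) U V)
    (aeT_mono2 (fun z _ => @conj _ _) (pull _ norm_u) (aeT_mono2 (fun z _ => @conj _ _) FM (inner_bv1 psi_inner))).
  move=> z z1 [EU EV] [[vz uv] [Fz pz]].
  rewrite /H EU EV !normcM pz mul1r normcV normc_conj normcM z1 mul1r uv divff ?mulr1//.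
  by rewrite gt_eqF// normc_gt0.
have shift f p : toeplitz_ker F f -> H2 p -> aeT (fun z => F z * bv f z = (z * bv p z)^*) ->
    [/\ H2 (comp_op psi (mul_op u f)), H2 (comp_op psi (fun z => p z * uo z)) &
      aeT (fun z => H z * bv (comp_op psi (mul_op u f)) z = (z * bv (comp_op psi (fun z => p z * uo z)) z)^*)].
  move=> kf Hp e; have [Hf _] := (toeplitz_kerP f F_Linfty).1 kf.
  have Huf : H2 (mul_op u f) by apply: u_kerF; exists f.
  have euf : aeT (fun z => bv (mul_op u f) z = bv u z * bv f z) := bvM u_H2 Hf.
  have [_ [M FM]] := F_Linfty.
  have Hpuo : H2 (fun z => p z * uo z).
    apply: H2M => //; apply: (@L2_mul_le _ _ (bv (mul_op u f)) M).
    - by apply: measurableTM; [exact: L2_measT (H2_L2 Hp)|exact: L2_measT (H2_L2 Huo)].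
    - exact: H2_L2.
    apply: aeT_mono2 (aeT_mono2 (fun z _ => @conj _ _) e euf) (aeT_mono2 (fun z _ => @conj _ _) norm_u FM).
    move=> z z1 [e1 ->] [[_ uv] Fz].
    have pz : normc (bv p z) = normc (F z) * normc (bv f z).
      by rewrite -normcM e1 normc_conj normcM z1 mul1r.
    rewrite !normcM pz uv mulrAC -mulrA ler_wpM2r//.
    by rewrite mulr_ge0 ?normc_ge0.
  split; [exact: Hcomp|exact: Hcomp|].
  have epuo := bvM Hp Huo.
  have c1 := comp_bv _ Huf; have c2 := comp_bv _ Hpuo.
  apply: aeT_mono2 (aeT_mono2 (fun z _ => @conj _ _) (aeT_mono2 (fun z _ => @conj _ _) c1 c2)
      (aeT_mono2 (fun z _ => @conj _ _) U V))
    (aeT_mono2 (fun z _ => @conj _ _) (pull _ (aeT_mono2 (fun z _ => @conj _ _) euf epuo))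
      (aeT_mono2 (fun z _ => @conj _ _) (pull _ e) (aeT_mono2 (fun z _ => @conj _ _) (pull _ norm_u) (inner_bv1 psi_inner)))).
  move=> z z1 [[C1 C2] [C3 C4]] [[E1 E2] [E3 [[vz uv] pz]]].
  rewrite /H C1 C2 C3 C4 E1 E2.
  (* What remains is an identity at the single point [w], with [w] and [z] unimodular. *)
  move: (bv psi z) E3 vz uv pz => w E3 vz uv pz.
  have z0 : z != 0 by rewrite -normc_gt0 z1.
  have zV : z^-1 = z^* by apply: (mulfI z0); rewrite divff// circle_conj.
  have uu : bv u w * (bv u w)^* = bv uo w * (bv uo w)^* by rewrite !mulcJ uv.
  transitivity (w * (F w * bv f w) * (bv u w * (bv u w)^*) / (z * bv uo w)); first by ring.
  rewrite E3 uu invfM zV !cconjM.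
  transitivity ((w * w^*) * (z^* * ((bv p w)^* * (bv uo w)^*)) * (bv uo w / bv uo w)); first by ring.
  by rewrite circle_conj// divff// mulr1 mul1r.
have min_of f p : toeplitz_ker F f -> H2 p -> aeT (fun z => F z * bv f z = (z * bv p z)^*) ->
    approx_invertible p -> forall h, Linfty h -> toeplitz_ker h (comp_op psi (mul_op u f)) ->
    toeplitz_ker H `<=` toeplitz_ker h.
  move=> kf Hp e ap; have [H1 H3 e1] := shift f p kf Hp e.
  apply: (toeplitz_ker_min HL H1 H3 _ e1).
  by apply: comp_inv; exact: approx_invertibleM.
have in_H f : toeplitz_ker F f -> toeplitz_ker H (comp_op psi (mul_op u f)).
  move=> kf; have [Hf [p Hp e]] := (toeplitz_kerP f F_Linfty).1 kf.
  have [H1 H3 e1] := shift f p kf Hp e.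
  by apply/(toeplitz_kerP _ HL); split=> //; exists (comp_op psi (fun z => p z * uo z)).
split=> //.
  split; first by exists H.
    by move=> _ [_ [f kf <-] <-]; exact: in_H.
  move=> h hL Eh; have [f kf fn] := kerF_neq0.
  have [Hf [p Hp e]] := (toeplitz_kerP f F_Linfty).1 kf.
  have pn := toeplitz_ker_neq0 F_neq0 Hf fn Hp e.
  have [po [b [Hpo apo ib pE]]] := inner_outer Hp pn.
  have e1 := mul_inner_toeplitz Hf Hp Hpo ib pE e.
  have kfb : toeplitz_ker F (fun w => f w * b w).
    by apply/(toeplitz_kerP _ F_Linfty); split; [exact: H2_mul_inner|exists po].
  apply: (min_of _ po kfb Hpo e1 apo h hL); apply: Eh.
  by exists (mul_op u (fun w => f w * b w)) => //; exists (fun w => f w * b w).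
move=> phim mphi; have [Hphi phin [_ phi_in _]] := mphi.
have kphi : toeplitz_ker F phim by exact: phi_in.
have [_ [p Hp e]] := (toeplitz_kerP phim F_Linfty).1 kphi.
have ap := maximal_vector_outer F_Linfty F_neq0 mphi Hp e.
have [H1 H3 e1] := shift phim p kphi Hp e.
split=> //.
  (* The companion of [C_psi (u phim)] is approximately invertible, hence nonzero almost everywhere
     on the circle; if [C_psi (u phim)] vanished there, [e1] would make the companion vanish too. *)
  apply: nonzeroD_not => // k0.
  have aq : approx_invertible (comp_op psi (fun z => p z * uo z)).
    by apply: comp_inv; exact: approx_invertibleM.
  have qn : nonzeroD (comp_op psi (fun z => p z * uo z)).
    by exists 0; [apply/disc_normc|exact: approx_invertible_neq0 aq n0].
  apply: (@aeT_const R); apply: aeT_mono2 (H2_bv_neq0 H3 qn) (aeT_mono2 (fun z _ => @conj _ _) e1 k0).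
  move=> z z1 qz [E kz]; move: E; rewrite kz mulr0 => /(congr1 (fun x : R[i] => x^*)).
  rewrite cconjK cconj0 => /esym/eqP; rewrite mulf_eq0 (negPf qz) orbF => /eqP z0.
  by move: z1; rewrite z0 normc0 => /eqP; rewrite eq_sym oner_eq0.
split; first by exists H.
  by move=> _ ->; exact: in_H.
by move=> h hL kh; apply: (min_of phim p kphi Hp e ap h hL); exact: kh.
Qed.
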